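(* Let $\mathcal{G}$ be a locally compact topological group which contains a cocompact lattice in the class $\langle\langle F_n\rangle\rangle$. Then there exists a cocompact action of $\mathcal{G}$ on a bushy tree $T$ of bounded valence, inducing a continuous, proper homomorphism $\mathcal{G}\to\mathrm{Isom}(T)$ with compact kernel and cocompact image.
   Context: $F_n$ denotes the free group of rank $n\ge2$, and $\langle\langle F_n\rangle\rangle$ denotes the class of finitely generated groups quasi-isometric to $F_n$ (this class does not depend on $n\ge2$; it is the class of groups that are virtually free of finite rank $\ge2$). A cocompact lattice in $\mathcal{G}$ is a discrete subgroup with compact quotient. Trees are simplicial with the geodesic metric in which each edge has length $1$. Bounded valence means vertices have uniformly finite valence; bushy means each point is within a uniformly bounded distance of some vertex having at least $3$ unbounded complementary components. $\mathrm{Isom}(T)$, identified with the automorphism group of $T$, has the compact-open topology. A homomorphism is proper if preimages of compact sets are compact. *)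

(* Defs.v *)
From HB Require Import structures.
From mathcomp Require Import all_boot all_order all_algebra.
From mathcomp Require Import all_classical all_reals all_analysis.

Set Implicit Arguments.
Unset Strict Implicit.
Unset Printing Implicit Defensive.

Import Order.TTheory GRing.Theory Num.Theory.
Local Open Scope classical_set_scope.
Local Open Scope ring_scope.

#[short(type="preTopologicalGroupType")]
HB.structure Definition PreTopologicalGroup := {G of Group G & Topological G}.

HB.mixin Record isTopologicalGroup G of PreTopologicalGroup G := {
  mulg_continuous : continuous (fun xy : G * G => (xy.1 * xy.2)%g) ;
  invg_continuous : continuous (fun x : G => (x^-1)%g)
}.

(* As in the library's topological algebraic structures, separation is not
   part of the definition. *)
#[short(type="topologicalGroupType")]
HB.structure Definition TopologicalGroup :=
  {G of PreTopologicalGroup G & isTopologicalGroup G}.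

Section SubgroupType.
Context {G : groupType}.

Definition subgroup (S : groupClosed G) : Type := {x : G | x \in S}.

Variable S : groupClosed G.

Lemma subgroup_closed : group_closed (mem S).
Proof. by split=> [|x y xS yS]; [exact: gpred1 | exact: gpredF]. Qed.

HB.instance Definition _ := SubChoice.copy (subgroup S) {x : G | x \in S}.
HB.instance Definition _ :=
  SubChoice_isSubGroup.Build G (mem S) (subgroup S) subgroup_closed.

End SubgroupType.

Section FreeGroup.
Context {A : choiceType}.

(* The letter (a, true) stands for the generator a, and (a, false) for its
   inverse. *)
Definition letter := (A * bool)%type.

Definition letter_inv (a : letter) : letter := (a.1, ~~ a.2).

Definition reduced (w : seq letter) : bool :=
  sorted (fun a b => b != letter_inv a) w.

Definition push (a : letter) (w : seq letter) : seq letter :=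
  if w is b :: w' then if b == letter_inv a then w' else a :: w else [:: a].

Lemma letter_invK : involutive letter_inv.
Proof. by case=> a b; rewrite /letter_inv /= negbK. Qed.

Lemma reduced_cons a w : reduced (a :: w) -> reduced w.
Proof. exact: path_sorted. Qed.

Lemma push_reduced a w : reduced w -> reduced (push a w).
Proof.
case: w => [//|b w] bw; rewrite /push; case: ifPn => [_|ba].
  exact: reduced_cons bw.
by rewrite /reduced /= ba.
Qed.

Lemma push_inv a w : reduced w -> push (letter_inv a) (push a w) = w.
Proof.
case: w => [_|b w bw] /=; first by rewrite letter_invK eqxx.
case: ifPn => [/eqP ba|_]; last by rewrite /= letter_invK eqxx.
subst b; case: w bw => [//|c w] /=; rewrite /reduced /= letter_invK.
by move=> /andP[/negbTE ->].
Qed.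

Lemma foldr_push_reduced u w : reduced w -> reduced (foldr push w u).
Proof. by move=> rw; elim: u => //= a u; exact: push_reduced. Qed.

Lemma foldr_push u a w : reduced w ->
  foldr push w (push a u) = push a (foldr push w u).
Proof.
move=> rw; case: u => [//|b u] /=; case: ifPn => [/eqP ->|//].
by rewrite -{1}[a]letter_invK push_inv//; exact: foldr_push_reduced.
Qed.

Lemma foldr_push_cat u v w : reduced w ->
  foldr push w (foldr push v u) = foldr push (foldr push w v) u.
Proof. by move=> rw; elim: u => //= a u <-; exact: foldr_push. Qed.

Lemma foldr_push_id u : reduced u -> foldr push [::] u = u.
Proof.
elim: u => //= a u IH au; rewrite IH; last exact: reduced_cons au.
by case: u au {IH} => [//|b u] /= /andP[/negbTE ->].
Qed.

(* Equality of reduced words is equality in the free group, and the product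
   of two of them is the reduced form of their concatenation. *)
Definition free_group : Type := {w : seq letter | reduced w}.

HB.instance Definition _ := SubChoice.copy free_group {w | reduced w}.

Definition free_one : free_group := exist _ [::] isT.

Definition free_mul (u v : free_group) : free_group :=
  exist _ (foldr push (val v) (val u)) (foldr_push_reduced (val u) (valP v)).

Lemma reduced_inv u : reduced u -> reduced (rev (map letter_inv u)).
Proof.
rewrite /reduced rev_sorted sorted_map; apply: sub_sorted => a b /=.
by rewrite letter_invK eq_sym.
Qed.

Definition free_inv (u : free_group) : free_group :=
  exist _ (rev (map letter_inv (val u))) (reduced_inv (valP u)).

Lemma free_mulA : associative free_mul.
Proof.
by move=> u v w; apply/val_inj; rewrite /= foldr_push_cat//; exact: valP.
Qed.

Lemma free_mul1 : left_id free_one free_mul.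
Proof. by move=> u; exact/val_inj. Qed.

Lemma free_mulr1 : right_id free_one free_mul.
Proof. by move=> u; apply/val_inj; rewrite /= foldr_push_id//; exact: valP. Qed.

Lemma free_mulV : left_inverse free_one free_inv free_mul.
Proof.
move=> [u ru]; apply/val_inj => /=; elim: u ru => //= a u IH au.
have ru := reduced_cons au.
rewrite rev_cons -cats1 foldr_cat /= eq_sym letter_invK eqxx; exact: IH.
Qed.

Lemma free_mulrV : right_inverse free_one free_inv free_mul.
Proof.
move=> [u ru]; apply/val_inj => /=.
have rv := reduced_inv ru; have e : u = rev (map letter_inv (rev (map letter_inv u))).
  by rewrite map_rev revK -map_comp map_id_in// => x _ /=; rewrite letter_invK.
rewrite {2}e; move: (rev _) rv => v rv {ru e}; elim: v rv => //= a v IH av.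
have rv := reduced_cons av.
by rewrite rev_cons -cats1 foldr_cat /= eq_sym letter_invK eqxx; exact: IH.
Qed.

HB.instance Definition _ := isGroup.Build free_group
  free_mulA free_mul1 free_mulr1 free_mulV free_mulrV.

Definition free_gen (a : A) : free_group := exist _ [:: (a, true)] isT.

End FreeGroup.
Arguments free_group A : clear implicits.

Definition free_gens (n : nat) : seq (free_group 'I_n) :=
  [seq free_gen i | i <- enum 'I_n].

Section WordMetric.
Context {R : realType} {H : groupType}.
Variable S : seq H.

Definition word (w : seq H) : bool :=
  all (fun a => (a \in S) || ((a^-1)%g \in S)) w.

Definition generates : Prop :=
  forall g : H, exists2 w, word w & (\prod_(a <- w) a)%g = g.

(* The infimum is attained, and is the least word length, as soon as S
   generates. *)
Definition word_norm (g : H) : R :=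
  inf [set (size w)%:R | w in [set w | word w /\ (\prod_(a <- w) a)%g = g]].

Definition word_dist (g h : H) : R := word_norm (g^-1 * h)%g.

End WordMetric.

Definition quasi_isometric {R : realType} (X Y : Type)
    (dX : X -> X -> R) (dY : Y -> Y -> R) : Prop :=
  exists (f : X -> Y) (K C : R), [/\ 1 <= K, 0 <= C,
    (forall x x', K^-1 * dX x x' - C <= dY (f x) (f x') <= K * dX x x' + C) &
    forall y, exists x, dY (f x) y <= C].

Definition in_qi_class_free (R : realType) (n : nat) (H : groupType) : Prop :=
  exists2 S : seq H, generates S &
    quasi_isometric (word_dist (R := R) S) (word_dist (free_gens n)).

Section Cocompact.
Context {G : groupType}.

(* Left cosets x S. *)
Definition coset_rel (S : groupClosed G) (x y : G) : bool := (x^-1 * y)%g \in S.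

Variable S : groupClosed G.

Lemma coset_refl : reflexive (coset_rel S).
Proof. by move=> x; rewrite /coset_rel mulVg gpred1. Qed.

Lemma coset_sym : symmetric (coset_rel S).
Proof.
by move=> x y; rewrite /coset_rel -gpredV invgM invgK.
Qed.

Lemma coset_trans : transitive (coset_rel S).
Proof.
move=> y x z xy yz; rewrite /coset_rel.
have -> : (x^-1 * z = (x^-1 * y) * (y^-1 * z))%g by rewrite -mulgA mulVKg.
exact: gpredM.
Qed.

Canonical coset_equiv := EquivRel (coset_rel S) coset_refl coset_sym coset_trans.

End Cocompact.


(* The quotient of X by an equivalence relation, with the quotient topology,
   is compact. *)
Definition cocompact_rel (X : topologicalType) (e : equiv_rel X) : Prop :=
  compact [set: quotient_topology {eq_quot e}%qT].

Definition cocompact_subgroup (G : preTopologicalGroupType)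
  (S : groupClosed G) : Prop := cocompact_rel (coset_equiv S).

Definition discrete_subgroup (G : preTopologicalGroupType)
  (S : groupClosed G) : Prop := [set` S] `<=` isolated [set` S].

Section Image.
Context {G H : groupType} (f : UMagmaMorphism.type G H).

Definition gimage : {pred H} := [pred y | `[< exists x, f x = y >]].

Lemma gimage_mul : mulg_closed gimage.
Proof.
move=> _ _ /asboolP[x <-] /asboolP[y <-].
by apply/asboolP; exists (x * y)%g; rewrite gmulfM.
Qed.

Lemma gimage_one : 1%g \in gimage.
Proof. by apply/asboolP; exists 1%g; rewrite gmulf1. Qed.

Lemma gimage_inv : invg_closed gimage.
Proof.
by move=> _ /asboolP[x <-]; apply/asboolP; exists (x^-1)%g; rewrite gmulfV.
Qed.

HB.instance Definition _ := isMulClosed.Build H gimage gimage_mul.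
HB.instance Definition _ := isMul1Closed.Build H gimage gimage_one.
HB.instance Definition _ := isInvClosed.Build H gimage gimage_inv.

Definition gker : set G := [set x | f x = 1%g].

End Image.

Section Isometries.
Context {R : realType} (X : metricType R).

Record isom := Isom {
  isom_fun :> X -> X ;
  isom_dist : forall x y, mdist (isom_fun x) (isom_fun y) = mdist x y ;
  isom_surj : forall y, exists x, isom_fun x = y }.

Implicit Types f g : isom.

Lemma isom_eq f g : (forall x, f x = g x) -> f = g.
Proof.
case: f g => [f df sf] [g dg sg] /= /funext fg; subst g.
by rewrite (Prop_irrelevance df dg) (Prop_irrelevance sf sg).
Qed.

Definition isom_one : isom :=
  Isom (isom_fun := id) (fun _ _ => erefl) (fun y => ex_intro _ y erefl).

Lemma isom_mul_dist (f g : isom) x y : mdist (f (g x)) (f (g y)) = mdist x y.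
Proof. by rewrite !isom_dist. Qed.

Lemma isom_mul_surj (f g : isom) y : exists x, f (g x) = y.
Proof. by have [z <-] := isom_surj f y; have [x <-] := isom_surj g z; exists x. Qed.

Definition isom_mul (f g : isom) : isom :=
  Isom (isom_mul_dist f g) (isom_mul_surj f g).

Definition isom_preim (f : isom) (y : X) : X := sval (cid (isom_surj f y)).

Lemma isom_preimK f y : f (isom_preim f y) = y.
Proof. exact: svalP (cid (isom_surj f y)). Qed.

Lemma isom_funK f x : isom_preim f (f x) = x.
Proof.
by apply: mdist_positivity; rewrite -(isom_dist f) isom_preimK mdistxx.
Qed.

Lemma isom_inv_dist f x y :
  mdist (isom_preim f x) (isom_preim f y) = mdist x y.
Proof. by rewrite -(isom_dist f) !isom_preimK. Qed.

Lemma isom_inv_surj f y : exists x, isom_preim f x = y.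
Proof. by exists (f y); rewrite isom_funK. Qed.

Definition isom_inv (f : isom) : isom :=
  Isom (isom_inv_dist f) (isom_inv_surj f).

Lemma isom_mulA : associative isom_mul.
Proof. by move=> f g h; exact: isom_eq. Qed.

Lemma isom_mul1 : left_id isom_one isom_mul.
Proof. by move=> f; exact: isom_eq. Qed.

Lemma isom_mulr1 : right_id isom_one isom_mul.
Proof. by move=> f; exact: isom_eq. Qed.

Lemma isom_mulV : left_inverse isom_one isom_inv isom_mul.
Proof. by move=> f; apply: isom_eq => x /=; rewrite isom_funK. Qed.

Lemma isom_mulrV : right_inverse isom_one isom_inv isom_mul.
Proof. by move=> f; apply: isom_eq => x /=; rewrite isom_preimK. Qed.

HB.instance Definition _ := gen_eqMixin isom.
HB.instance Definition _ := gen_choiceMixin isom.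
HB.instance Definition _ := isGroup.Build isom
  isom_mulA isom_mul1 isom_mulr1 isom_mulV isom_mulrV.

(* The group of isometries carries the compact-open topology. *)
Definition isom_compact_open (f : isom) : {compact-open, X -> X} := f.

HB.instance Definition _ :=
  Topological.copy isom (initial_topology isom_compact_open).

End Isometries.

Section IsometricAction.
Context {R : realType} {G : groupType} {X : metricType R}.
Variable a : UMagmaMorphism.type G (isom X).

Definition orbit_rel (x y : X) : bool := `[< exists g, a g x = y >].

Lemma orbit_refl : reflexive orbit_rel.
Proof. by move=> x; apply/asboolP; exists 1%g; rewrite gmulf1. Qed.

Lemma orbit_sub x y : orbit_rel x y -> orbit_rel y x.
Proof.
move=> /asboolP[g <-]; apply/asboolP; exists (g^-1)%g.
by rewrite gmulfV; exact: isom_funK.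
Qed.

Lemma orbit_sym : symmetric orbit_rel.
Proof. by move=> x y; apply/idP/idP; exact: orbit_sub. Qed.

Lemma orbit_trans : transitive orbit_rel.
Proof.
move=> _ x _ /asboolP[g <-] /asboolP[h <-].
by apply/asboolP; exists (h * g)%g; rewrite gmulfM.
Qed.

Canonical orbit_equiv := EquivRel orbit_rel orbit_refl orbit_sym orbit_trans.

Definition cocompact_action : Prop := cocompact_rel orbit_equiv.

End IsometricAction.

Definition proper_map (X Y : topologicalType) (f : X -> Y) : Prop :=
  forall K : set Y, compact K -> compact (f @^-1` K).

Record tree := Tree {
  vertex : eqType ;
  edge : rel vertex ;
  tree_inhabited : inhabited vertex ;
  edge_sym : symmetric edge ;
  edge_irr : irreflexive edge ;
  tree_connected : forall u v, exists2 p, path edge u p & last u p = v ;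
  tree_acyclic : forall c, (2 < size c)%N -> uniq c -> ~~ cycle edge c }.

Section Realization.
Context {R : realType} (T : tree).
Notation V := (vertex T).

Definition on_vertex (u : V) (x : V -> R) : Prop :=
  x = fun w => (w == u)%:R.

Definition on_edge (u v : V) (x : V -> R) : Prop :=
  [/\ edge u v, 0 <= x u, 0 <= x v, x u + x v = 1 &
      forall w, w != u -> w != v -> x w = 0].

(* A point of the geometric realization is given by its barycentric
   coordinates: they are supported on a vertex or on an edge. *)
Record realization := Realization {
  bary :> V -> R ;
  baryP : (exists u, on_vertex u bary) \/ (exists u v, on_edge u v bary) }.

Implicit Types (x y z : realization) (l m : R).

Lemma realization_eq x y : (forall w, x w = y w) -> x = y.
Proof.
case: x y => [x px] [y py] /= /funext xy; subst y.
by rewrite (Prop_irrelevance px py).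
Qed.

HB.instance Definition _ := gen_eqMixin realization.
HB.instance Definition _ := gen_choiceMixin realization.

Definition vertex_point (u : V) : realization :=
  @Realization (fun w => (w == u)%:R) (or_introl (ex_intro _ u erefl)).

(* [chain x y l]: x and y are joined by a piecewise linear path of length l;
   each edge is parametrized by barycentric coordinate, so has length 1. *)
Inductive chain : realization -> realization -> R -> Prop :=
| chain_nil x : chain x x 0
| chain_step u v (x y z : realization) (l : R) : on_edge u v x -> on_edge u v y -> chain y z l ->
    chain x z (`|x u - y u| + l).

Definition tree_dist (x y : realization) : R := inf [set l | chain x y l].

Lemma chain_cat x y z l m : chain x y l -> chain y z m -> chain x z (l + m).
Proof.
elim=> [{}x|u v {}x y' {}y {}l ux uy _ IH] yz; first by rewrite add0r.
by rewrite -addrA; apply: chain_step ux uy (IH yz).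
Qed.

Lemma chain_rev x y l : chain x y l -> chain y x l.
Proof.
elim=> [{}x|u v {}x y' {}y {}l ux uy _ IH]; first exact: chain_nil.
rewrite addrC; apply: chain_cat IH _; rewrite -[`|_|]addr0 distrC.
exact: chain_step uy ux (chain_nil _).
Qed.

Lemma chain_lip x y l w : chain x y l -> `|x w - y w| <= l.
Proof.
elim=> [{}x|u v {}x y' {}y {}l ux uy _ IH]; first by rewrite subrr normr0.
apply: le_trans (ler_distD (y' w) _ _) _; apply: lerD IH.
case: ux uy => _ _ _ xs x0 [_ _ _ ys y0].
have [->//|wu] := eqVneq w u.
have [->|wv] := eqVneq w v; last by rewrite x0// y0// subrr normr0.
have -> : x v - y' v = - (x u - y' u).
  by apply/eqP; rewrite -subr_eq0 opprK addrACA -opprD [x v + _]addrC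
    [y' v + _]addrC xs ys subrr.
by rewrite normrN.
Qed.

Lemma chain_ge0 x y l : chain x y l -> 0 <= l.
Proof. by elim=> // u v {}x y' {}y {}l _ _ _ IH; rewrite addr_ge0. Qed.

Lemma vertex_on_edgel u v : edge u v -> on_edge u v (vertex_point u).
Proof.
move=> uv; have vu : v != u by apply: contraTneq uv => ->; rewrite edge_irr.
by split=> //=; rewrite ?ler0n ?eqxx ?(negbTE vu) ?addr0// => w /negbTE->.
Qed.

Lemma on_edgeC u v x : on_edge u v x -> on_edge v u x.
Proof.
case=> uv xu xv xs x0; split=> //.
- by rewrite edge_sym.
- by rewrite addrC.
by move=> w wv wu; exact: x0.
Qed.

Lemma vertex_on_edger u v : edge u v -> on_edge u v (vertex_point v).
Proof.
by move=> uv; apply: on_edgeC; apply: vertex_on_edgel; rewrite edge_sym.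
Qed.

Lemma chain_vertex u v : exists l, chain (vertex_point u) (vertex_point v) l.
Proof.
have [p] := tree_connected u v; elim: p u => [|w p IH] u /=.
  by move=> _ ->; exists 0; exact: chain_nil.
move=> /andP[uw wp] /(IH _ wp)[l wl]; eexists.
by apply: chain_step (vertex_on_edgel uw) (vertex_on_edger uw) wl.
Qed.

Lemma chain_to_vertex x : exists u l, chain x (vertex_point u) l.
Proof.
case: (baryP x) => [[u xu]|[u [v xuv]]].
  exists u, 0; have -> : vertex_point u = x.
    by apply: realization_eq => w; rewrite xu.
  exact: chain_nil.
have uv : edge u v by case: xuv.
by exists u; eexists; apply: chain_step xuv (vertex_on_edgel uv) (chain_nil _).
Qed.

Lemma chain_exists x y : exists l, chain x y l.
Proof.
have [u [l xu]] := chain_to_vertex x; have [v [m yv]] := chain_to_vertex y.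
have [k uv] := chain_vertex u v.
by eexists; apply: chain_cat xu (chain_cat uv (chain_rev yv)).
Qed.

Lemma chain_lbound x y : has_lbound [set l | chain x y l].
Proof. by exists 0 => l /chain_ge0. Qed.

Lemma tree_dist_xx x : tree_dist x x = 0.
Proof.
apply/eqP; rewrite eq_le; apply/andP; split.
  by apply: ge_inf; [exact: chain_lbound | exact: chain_nil].
apply: lb_le_inf; first by exists 0; exact: chain_nil.
by move=> l /chain_ge0.
Qed.

Lemma tree_dist_eq0 x y : tree_dist x y = 0 -> x = y.
Proof.
move=> xy; apply: realization_eq => w; apply/eqP; rewrite -subr_eq0 -normr_le0.
rewrite -xy; apply: lb_le_inf; first exact: chain_exists.
by move=> l; exact: chain_lip.
Qed.

Lemma tree_dist_sym x y : tree_dist x y = tree_dist y x.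
Proof.
by rewrite /tree_dist; congr inf; apply/seteqP; split=> l; exact: chain_rev.
Qed.

Lemma tree_dist_triangle y x z : tree_dist x z <= tree_dist x y + tree_dist y z.
Proof.
rewrite -lerBlDr; apply: lb_le_inf; first exact: chain_exists.
move=> l xy; rewrite lerBlDr -lerBlDl.
apply: lb_le_inf; first exact: chain_exists.
move=> m yz; rewrite lerBlDl; apply: ge_inf; first exact: chain_lbound.
exact: chain_cat xy yz.
Qed.

HB.instance Definition _ := isMetric.Build R realization
  tree_dist_xx tree_dist_eq0 tree_dist_sym tree_dist_triangle.

End Realization.
Arguments realization R T : clear implicits.
Arguments vertex_point R {T} u.

Definition bounded_valence (T : tree) : Prop :=
  exists N : nat, forall (v : vertex T) (s : seq (vertex T)),
    uniq s -> all (edge v) s -> (size s <= N)%N.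

Section Bushy.
Context {R : realType}.

Definition bounded_subset {X : metricType R} (A : set X) : Prop :=
  exists M : R, forall x y, A x -> A y -> mdist x y <= M.

Definition complementary_component {X : metricType R} (v : X) (A : set X) :
    Prop :=
  exists2 x, x != v & A = connected_component [set~ v] x.

Definition bushy (T : tree) : Prop :=
  exists C : R, forall x : realization R T, exists v : vertex T,
    mdist x (vertex_point R v) <= C /\
    exists A : 'I_3 -> set (realization R T), injective A /\
      forall i, complementary_component (vertex_point R v) (A i) /\
                ~ bounded_subset (A i).

End Bushy.
Arguments bushy R T : clear implicits.

(* Main.v *)
(* A coarse equivalence psi from G to the free group F_n, obtained from the
   lattice, pulls a half-tree of the Cayley tree back to a subset of G. The
   elements of G preserving this subset up to a bounded set form an open,
   relatively compact subgroup U, because a half-tree is determined up to bounded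
   sets by finitely many of its points, and because n >= 2 makes half-trees based
   at distant vertices inequivalent. Hence G acts on the locally finite graph G/U,
   which is coarsely a tree.

   A cut of this graph is a vertex set with finite coboundary. For each pair of
   ends (ultrafilters on the vertices) separated by a cut of size at most K,
   consider the cuts of least size separating them and, among these, those which
   cross the fewest others. Submodularity of the size shows that any two cuts
   chosen in this way are nested (Diekert and Weiss), so they are the edges of a
   tree, whose vertices are the orientations of this family. Since the graph is
   coarsely a tree, an ultrafilter limit shows that only finitely many vertices
   cannot be separated from a given one by a chosen cut; this bounds the valence
   and makes the stabilizers compact. Three distinct ends of F_n provide a vertex
   with three unbounded branches.

   Isometries of a proper metric space moving a base point by a bounded amount
   form a compact set (Arzela-Ascoli), hence the cocompactness of the image. *)

(* The map [psi] from G to the free group is neither equivariant nor continuous, so G does not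
   permute the half-trees pulled back along it, and they cannot serve as edges of the tree. They
   only guarantee that small cuts exist: some translate of each has its coboundary in one fixed
   finite set of pairs, and the number of these pairs is the bound K. The edges have to be chosen by
   a rule that every automorphism of the graph respects, hence the two successive minimizations.
   Least size alone does not suffice: submodularity can yield mere equality of sizes for crossing
   cuts, and then the number of crossed cuts decides. This number is finite because minimal cuts
   have connected sides, and only finitely many such cuts of bounded size separate two given
   vertices. All estimates taken from [psi] are made uniform over translates by G, which replaces
   equivariance. *)
Require Import Defs.
From HB Require Import structures.
From mathcomp Require Import all_boot all_order all_algebra finmap.
From mathcomp Require Import all_classical all_reals all_analysis.
From mathcomp Require Import zify ring lra.

Set Implicit Arguments.
Unset Strict Implicit.
Unset Printing Implicit Defensive.
Import Order.TTheory GRing.Theory Num.Theory.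
Import numFieldTopology.Exports numFieldNormedType.Exports.
Local Open Scope classical_set_scope.

(** * Coboundaries and tight cuts of a graph *)

(** The value on an infinite set is 0, so a bound on [fcard] carries information only together with
    finiteness. *)
Definition fcard (T : choiceType) (A : set T) : nat := #|` fset_set A|%fset.

Lemma fcard_sub (T : choiceType) (A B : set T) :
  finite_set B -> A `<=` B -> (fcard A <= fcard B)%N.
Proof.
move=> fB AB; apply: fsubset_leq_card; apply/fsubsetP => x.
have fA := sub_finite_set AB fB.
by rewrite !in_fset_set// !inE; exact: AB.
Qed.

Lemma fcardUI (T : choiceType) (A B : set T) : finite_set A -> finite_set B ->
  (fcard (A `|` B) + fcard (A `&` B) = fcard A + fcard B)%N.
Proof. by move=> fA fB; rewrite /fcard fset_setU// fset_setI// cardfsUI. Qed.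

Lemma fcard_exchange (T : choiceType) (A B X Y : set T) :
  finite_set A -> finite_set B ->
  X `|` Y `<=` A `|` B -> X `&` Y `<=` A `&` B ->
  (fcard X + fcard Y <= fcard A + fcard B)%N.
Proof.
move=> fA fB XY_U XY_I; have fU : finite_set (A `|` B) by rewrite finite_setU.
have fXY := sub_finite_set XY_U fU; have [fX fY] : finite_set X /\ finite_set Y.
  by move: fXY; rewrite finite_setU.
rewrite -fcardUI// -(fcardUI fA fB) leq_add//; apply: fcard_sub => //.
exact: sub_finite_set (@subIsetl _ A B) fA.
Qed.

Lemma fcard_exchange_lt (T : choiceType) (A B X Y : set T) (z : T) :
  finite_set A -> finite_set B ->
  X `|` Y `<=` A `|` B -> X `&` Y `<=` A `&` B ->
  (A `|` B) z -> ~ (X `|` Y) z ->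
  (fcard X + fcard Y < fcard A + fcard B)%N.
Proof.
move=> fA fB XY_U XY_I zU nz.
have fU : finite_set (A `|` B) by rewrite finite_setU.
have fXY := sub_finite_set XY_U fU; have [fX fY] : finite_set X /\ finite_set Y.
  by move: fXY; rewrite finite_setU.
rewrite -fcardUI// -(fcardUI fA fB) -addSn leq_add//; last first.
  by apply: fcard_sub XY_I; exact: sub_finite_set (@subIsetl _ A B) fA.
apply: fproper_ltn_card; rewrite fproperEneq; apply/andP; split.
  apply: contra_notN nz => /eqP E; have : z \in fset_set (X `|` Y).
    by rewrite E in_fset_set// inE.
  by rewrite in_fset_set// inE.
by apply/fsubsetP => x; rewrite !in_fset_set// !inE; exact: XY_U.
Qed.

Lemma fcard_inj (T U : choiceType) (f : T -> U) (A : set T) :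
  injective f -> finite_set A -> fcard (f @` A) = fcard A.
Proof.
move=> fi fA; rewrite /fcard fset_set_image// card_imfset//=.
Qed.

Section Graph.
Variable V : choiceType.
Implicit Types (e : V -> V -> Prop) (C D P : set V).

Definition coboundary e C : set (V * V) :=
  [set p | [/\ C p.1, ~ C p.2 & e p.1 p.2]].

(** Connectedness without paths. It serves as an induction principle: a property that holds
    somewhere in C and passes along the edges inside C holds throughout C. *)
Definition connected_in e C : Prop := forall P,
  (exists2 x, C x & P x) -> (exists2 x, C x & ~ P x) ->
  exists u v, [/\ C u, C v & coboundary e P (u, v)].

Definition tight e C : Prop := connected_in e C /\ connected_in e (~` C).

Lemma coboundaryC e C : (forall x y, e x y -> e y x) ->
  coboundary e (~` C) = (fun p => (p.2, p.1)) @` coboundary e C.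
Proof.
move=> esym; apply/seteqP; split=> [[x y] [/= nx /contrapT y' xy]|_ [[x y] [/= ? ? ?] <-]].
  by exists (y, x) => //; split=> //; exact: esym.
by split=> //=; exact: esym.
Qed.

Lemma fcard_coboundaryC e C : (forall x y, e x y -> e y x) ->
  finite_set (coboundary e C) ->
  fcard (coboundary e (~` C)) = fcard (coboundary e C).
Proof.
by move=> esym fC; rewrite coboundaryC// fcard_inj// => -[? ?] [? ?] [-> ->].
Qed.

Lemma coboundary_corner e C D : finite_set (coboundary e C) ->
  finite_set (coboundary e D) ->
  (fcard (coboundary e (C `&` D)) + fcard (coboundary e (C `|` D)) <=
   fcard (coboundary e C) + fcard (coboundary e D))%N.
Proof.
move=> fC fD; apply: fcard_exchange => //.
  move=> -[x y] /= [[[/= xC xD] nCD xy]|[/= xCD nCD xy]].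
    by have [yC|yC] := pselect (C y); [right; split=> // yD; exact: nCD|left].
  by case: xCD => ?; [left|right]; split=> //= ?; apply: nCD; [left|right].
by move=> -[x y] [[[/= xC xD] _ xy] [_ /= nCD _]]; split; split=> //= ?;
  apply: nCD; [left|right].
Qed.

(** The vertices on which C and D agree include u; an edge leaving this set, suitably oriented,
    would lie in exactly one of the coboundaries. The edge (u, v) is what tells the empty set from
    the whole vertex set. *)
Lemma coboundary_inj e C D u v : (forall x y, e x y -> e y x) ->
  connected_in e setT -> coboundary e C (u, v) ->
  coboundary e C = coboundary e D -> C = D.
Proof.
move=> esym econn uv E.
pose P x := C x <-> D x; apply: contrapT => nCD.
have [y nPy] : exists y, ~ P y.
  apply: contrapT => H; apply: nCD; apply/seteqP; split=> y Cy;
    by have [] : P y; do ?[by apply: contrapT => ?; apply: H; exists y|auto].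
have Pu : P u.
  have uvD : coboundary e D (u, v) by rewrite -E.
  by case: uv uvD => /= ? ? ? [].
have [||a [b] [_ _ [/= Pa nPb ab]]] := econn P; [by exists u|by exists y|].
apply: nPb; split=> [Cb|Db]; apply: contrapT => nb.
  have : coboundary e C (b, a) \/ C a by have [|] := pselect (C a); [right|left; split=> //; exact: esym].
  case=> [|/[dup] Ca /Pa Da]; first by rewrite E => -[].
  have : coboundary e D (a, b) by split.
  by rewrite -E => -[].
have : coboundary e D (b, a) \/ D a by have [|] := pselect (D a); [right|left; split=> //; exact: esym].
case=> [|/[dup] Da /Pa Ca]; first by rewrite -E => -[].
have : coboundary e C (a, b) by split.
by rewrite E => -[].
Qed.

Lemma coboundary_eq0 e C : connected_in e setT -> coboundary e C = set0 ->
  C = set0 \/ C = setT.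
Proof.
move=> econn C0; have [->|/set0P[x Cx]] := eqVneq C set0; first by left.
right; apply/seteqP; split=> // y _; apply: contrapT => nCy.
have [||u [v] [_ _]] := econn C; [by exists x|by exists y|by rewrite C0].
Qed.

Lemma finite_subsets (T : choiceType) (F : set T) :
  finite_set F -> finite_set [set A | A `<=` F].
Proof.
move=> fF; apply: (@sub_finite_set _ _ ((fun X : {fset T} => [set` X]) @`
    [set` fpowerset (fset_set F)])); last exact: finite_image (finite_fset _).
move=> A AF; have fA := sub_finite_set AF fF.
exists (fset_set A); last exact: fset_setK.
by rewrite /= fpowersetE; apply/fsubsetP => x; rewrite !in_fset_set// !inE; exact: AF.
Qed.

Lemma finite_coboundary_in e (F : set (V * V)) : (forall x y, e x y -> e y x) ->
  connected_in e setT -> finite_set F -> finite_set [set C | coboundary e C `<=` F].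
Proof.
move=> esym econn fF; apply: (@sub_finite_set _ _
  (\bigcup_(A in [set A | A `<=` F]) [set C | coboundary e C = A])).
  by move=> C CF; exists (coboundary e C).
apply: bigcup_finite => [|A _]; first exact: finite_subsets.
have [A0|/set0P[[u v] uvA]] := eqVneq A set0.
  by apply: sub_finite_set (finite_set2 set0 setT) => C /=; rewrite A0 => /coboundary_eq0; apply.
have [[C CA]|nE] := pselect ([set C | coboundary e C = A] !=set0); last first.
  by apply: sub_finite_set (@finite_set0 _) => C CA; apply: nE; exists C.
apply: sub_finite_set (finite_set1 C) => D /= DA; rewrite /= in CA.
apply: (coboundary_inj esym econn (u := u) (v := v)); by rewrite DA ?CA.
Qed.

(** E plays the role of the edges of a path from x to y: the vertices reachable by such a finite set
    contain x, and one more edge can always be added. *)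
Lemma crossing_edges e x y : connected_in e setT ->
  exists2 E : set (V * V), finite_set E &
    forall P, P x -> ~ P y -> coboundary e P `&` E !=set0.
Proof.
move=> conn; apply: contrapT => nE.
pose Q z := exists2 E : set (V * V), finite_set E &
    forall P, P x -> ~ P z -> coboundary e P `&` E !=set0.
have [] := conn Q; [by exists x => //; exists set0|by exists y|].
move=> u [v] [_ _] [/= [E fE Eu] nv uv]; apply: nv.
exists (E `|` [set (u, v)]); first by rewrite finite_setU; split.
move=> P Px nPv; have [Pu|nPu] := pselect (P u).
  by exists (u, v); split; [split|right].
by have [p [pP pE]] := Eu P Px nPu; exists p; split=> //; left.
Qed.

(** Some edge of a path from x to y lies in the coboundary, so it is enough to treat the tight cuts
    through one fixed edge; that edge is deleted and k lowered. *)
Lemma finite_tight k e x y : (forall x y, e x y -> e y x) ->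
  connected_in e setT ->
  finite_set [set C | [/\ tight e C, C x /\ ~ C y,
    finite_set (coboundary e C) & (fcard (coboundary e C) <= k)%N]].
Proof.
elim: k e x y => [|k IH] e x y esym conn.
  apply: sub_finite_set (@finite_set0 _) => C [_ [Cx nCy] fC].
  rewrite leqn0 => /eqP/cardfs0_eq C0.
  have [|| u [v] [_ _ uv]] := conn C; [by exists x|by exists y|].
  have : (u, v) \in fset_set (coboundary e C) by rewrite in_fset_set// inE.
  by rewrite C0.
have [E fE Exy] := crossing_edges x y conn.
pose S p := [set C | [/\ tight e C, coboundary e C p,
    finite_set (coboundary e C) & (fcard (coboundary e C) <= k.+1)%N]].
apply: (@sub_finite_set _ _ (\bigcup_(p in E) S p)).
  by move=> C [tC [Cx nCy] fC kC]; have [p [pC pE]] := Exy C Cx nCy; exists p.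
apply: bigcup_finite => // -[a b] _.
have [[C0 [_ [/= _ _ ab] _ _]]|S0] := pselect (S (a, b) !=set0); last first.
  by apply: sub_finite_set (@finite_set0 _) => C SC; apply: S0; exists C.
(* Deleting an edge of the cut keeps both sides connected. *)
pose e' u v := [/\ e u v, (u, v) <> (a, b) & (u, v) <> (b, a)].
have e'sym u v : e' u v -> e' v u.
  by case=> uv n1 n2; split=> [|[? ?]|[? ?]]; [exact: esym|subst; exact: n2|subst; exact: n1].
have conn' C : C a -> ~ C b -> tight e C -> tight e' C.
  move=> Ca nCb [cC cC']; split=> P xP yP.
    have [u [v] [Cu Cv [/= Pu Pv uv]]] := cC P xP yP.
    exists u, v; split=> //; split=> //=; split=> // -[? ?]; subst; exact: nCb.
  have [u [v] [Cu Cv [/= Pu Pv uv]]] := cC' P xP yP.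
  by exists u, v; split=> //; split=> //=; split=> // -[? ?]; subst.
(* If the graph stays connected, every such cut loses the edge (a, b), stays tight, and falls under
   the induction hypothesis for a and b. *)
have [c'|nc'] := pselect (connected_in e' setT).
  apply: sub_finite_set (IH e' a b e'sym c') => C [tC [/= Ca nCb _] fC kC].
  have sub : coboundary e' C `|` [set (a, b)] `<=` coboundary e C.
    by move=> [u v] [[/= Cu nCv [uv _ _]]|[-> ->]].
  have fC' : finite_set (coboundary e' C).
    by apply: sub_finite_set fC => p ?; apply: sub; left.
  split=> //; first exact: conn'.
  have := fcard_sub fC sub; rewrite /fcard fset_setU// fset_set1 fsetUC.
  rewrite cardfsU1 in_fset_set// memNset ?add1n; last by move=> [/= _ _ []].
  by move=> /leq_trans/(_ kC).
(* Otherwise (a, b) is a bridge: P is a union of components of the remaining graph, and a cut with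
   both sides connected there can only be P or its complement. *)
have [P [[u Pu] [v nPv] nP]] : exists P, [/\ exists x, P x, exists x, ~ P x &
    forall u v, ~ coboundary e' P (u, v)].
  apply: contrapT => H; apply: nc' => P [u _ Pu] [v _ Pv]; apply: contrapT => H'.
  apply: H; exists P; split; [by exists u|by exists v|].
  by move=> a' b' ab'; apply: H'; exists a', b'.
apply: (@sub_finite_set _ _ [set P; ~` P]); last exact: finite_set2.
move=> C [tC [/= Ca nCb _] fC kC].
have [cC cC'] := conn' C Ca nCb tC.
have mono D : connected_in e' D -> D `<=` P \/ D `<=` ~` P.
  move=> cD; have [[w Dw Pw]|nD] := pselect (exists2 w, D w & P w); last first.
    by right=> w Dw Pw; apply: nD; exists w.
  left=> z Dz; apply: contrapT => nPz.
  have [||a' [b'] [_ _ /nP//]] := cD P; [by exists w|by exists z].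
have [CP|CP] := mono _ cC; have [CP'|CP'] := mono _ cC'.
- by have [] := nPv; have [/CP|/CP'] := pselect (C v).
- left; apply/seteqP; split=> // z Pz; apply: contrapT => /CP'; exact.
- right; apply/seteqP; split=> // z nPz; apply: contrapT => /CP'; exact.
- by have [/CP|/CP'] := pselect (C u).
Qed.

End Graph.

(** * Optimal cuts are nested *)

Lemma exists_minimizer (T : Type) (P : set T) (f : T -> nat) :
  P !=set0 -> exists2 x, P x & forall y, P y -> (f x <= f y)%N.
Proof.
move=> [x Px]; have ex : exists n, `[< exists2 y, P y & f y = n >].
  by exists (f x); apply/asboolP; exists x.
case: (ex_minnP ex) => n /asboolP[y Py <-] miny; exists y => // z Pz.
by apply: miny; apply/asboolP; exists z.
Qed.

(** Ultrafilters act on sets as Boolean homomorphisms; with the next two lemmas, the question which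
    cut splits which pair becomes a finite truth table. *)
Lemma ultra_setI (T : Type) (p : set_system T) (C D : set T) : UltraFilter p ->
  `[< p (C `&` D) >] = `[< p C >] && `[< p D >].
Proof.
move=> pU; apply/asboolP/andP => [pCD|[/asboolP pC /asboolP pD]].
  by split; apply/asboolP; apply: filterS pCD => x [].
exact: filterI.
Qed.

Lemma ultra_setC (T : Type) (p : set_system T) (C : set T) : UltraFilter p ->
  `[< p (~` C) >] = ~~ `[< p C >].
Proof.
move=> pU; apply/asboolP/negP => [pC' /asboolP pC|].
  by have [x []] := filter_ex (filterI pC pC').
by case: (in_ultra_setVsetC C pU) => // pC []; apply/asboolP.
Qed.

Lemma ultra_setU (T : Type) (p : set_system T) (C D : set T) : UltraFilter p ->
  `[< p (C `|` D) >] = `[< p C >] || `[< p D >].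
Proof.
by move=> pU; rewrite -(setCK (C `|` D)) setCU ultra_setC ultra_setI !ultra_setC
  -negb_or negbK.
Qed.

(** One of the four corners of C and D is empty. *)
Definition nested (T : Type) (C D : set T) : Prop :=
  [\/ C `<=` D, C `<=` ~` D, ~` C `<=` D | ~` C `<=` ~` D].

Lemma nested_sym (T : Type) (C D : set T) : nested C D -> nested D C.
Proof.
case=> H; [apply: Or44|apply: Or42|apply: Or43|apply: Or41] => x.
- by move=> nD /H.
- by move=> Dx /H.
- by move=> nD; apply: contrapT => /H.
- by move=> Dx; apply: contrapT => /H.
Qed.

Lemma nestedC (T : Type) (C D : set T) : nested C D -> nested C (~` D).
Proof.
by case=> H; [apply: Or42|apply: Or41|apply: Or44|apply: Or43]; rewrite ?setCK.
Qed.

Lemma nestedCE (T : Type) (C D : set T) : nested C (~` D) = nested C D.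
Proof.
by apply/propext; split=> [/nestedC|/nestedC//]; rewrite setCK.
Qed.

(** The crossing of C and D is used when X lies in one of them and its complement in the other: then
    C and D would cover everything, which is a nested position. *)
Lemma nested_corner (T : Type) (X C D : set T) : ~ nested C D ->
  nested X C -> nested X D -> nested X (C `&` D).
Proof.
move=> nCD [] XC.
- case=> XD.
  + by apply: Or41 => x Xx; split; [exact: XC|exact: XD].
  + by apply: Or42 => x Xx [_]; exact: XD.
  + by case: nCD; apply: Or43 => x nC; apply: contrapT => nD; apply: nC;
      apply: XC; apply: contrapT => /XD.
  + by apply: Or44 => x nX [_]; exact: XD.
- by move=> _; apply: Or42 => x Xx [+ _]; exact: XC.
- case=> XD.
  + by case: nCD; apply: Or43 => x nC; apply: XD; apply: contrapT => /XC.
  + by apply: Or42 => x Xx [_]; exact: XD.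
  + by apply: Or43 => x nX; split; [exact: XC|exact: XD].
  + by apply: Or44 => x nX [_]; exact: XD.
- by move=> _; apply: Or44 => x nX [+ _]; exact: XC.
Qed.

(** Hence a set crossing both the intersection and the union crosses C and, by symmetry, D. *)
Lemma nested_corners (T : Type) (X C D : set T) :
  nested X C -> nested X (C `&` D) \/ nested X (C `|` D).
Proof.
case=> XC.
- by right; apply: Or41 => x Xx; left; exact: XC.
- by left; apply: Or42 => x Xx [+ _]; exact: XC.
- by right; apply: Or43 => x nX; left; exact: XC.
- by left; apply: Or44 => x nX [+ _]; exact: XC.
Qed.

Section Optimal.
Variables (V : choiceType) (e : V -> V -> Prop) (K : nat).
Hypothesis esym : forall x y, e x y -> e y x.
Hypothesis econn : connected_in e setT.
Implicit Types (C D P X : set V) (p q : set_system V).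

Definition cut C : Prop := finite_set (coboundary e C).

Definition cut_size C : nat := fcard (coboundary e C).

Definition splits C p q : bool := `[< p C >] != `[< q C >].

Definition minimal p q C : Prop := [/\ cut C, splits C p q, (cut_size C <= K)%N &
  forall D, cut D -> splits D p q -> (cut_size C <= cut_size D)%N].

Definition minimal_cut C : Prop :=
  exists p q, [/\ UltraFilter p, UltraFilter q & minimal p q C].

(** Only minimal cuts are counted: their sides are connected and their size is at most K, which
    makes the set finite when C is a tight cut. Counting optimal cuts would be circular. *)
Definition crossers C : set (set V) := [set X | minimal_cut X /\ ~ nested X C].

Definition optimal p q C : Prop := minimal p q C /\
  forall D, minimal p q D -> (fcard (crossers C) <= fcard (crossers D))%N.

Definition optimal_cut C : Prop :=
  exists p q, [/\ UltraFilter p, UltraFilter q & optimal p q C].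

Lemma cutC C : cut C -> cut (~` C).
Proof. by rewrite /cut coboundaryC//; exact: finite_image. Qed.

Lemma cut_sizeC C : cut C -> cut_size (~` C) = cut_size C.
Proof. exact: fcard_coboundaryC. Qed.

Lemma splitsC C p q : UltraFilter p -> UltraFilter q ->
  splits (~` C) p q = splits C p q.
Proof. by move=> pU qU; rewrite /splits !ultra_setC//; case: `[< _ >]; case: `[< _ >]. Qed.

Lemma minimalC p q C : UltraFilter p -> UltraFilter q ->
  minimal p q C -> minimal p q (~` C).
Proof.
move=> pU qU [fC sC CK minC]; split; rewrite ?cut_sizeC ?splitsC//.
exact: cutC.
Qed.

Lemma crossersC C : crossers (~` C) = crossers C.
Proof. by apply/funext => X; rewrite /crossers /= nestedCE. Qed.

Lemma optimalC p q C : UltraFilter p -> UltraFilter q ->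
  optimal p q C -> optimal p q (~` C).
Proof. by move=> pU qU [mC oC]; split; [exact: minimalC|rewrite crossersC]. Qed.

Lemma splits_ex C p q : UltraFilter p -> UltraFilter q -> splits C p q ->
  C !=set0 /\ ~` C !=set0.
Proof.
move=> pU qU; rewrite -(splitsC C pU qU) => sC.
have H D : splits D p q -> D !=set0.
  move=> sD; apply/set0P/eqP => D0; move: sD; rewrite /splits D0.
  by rewrite !asboolF//; exact: filter_not_empty.
by split; apply: H => //; rewrite -(splitsC C pU qU).
Qed.

Lemma cut_size_gt0 C : cut C -> C !=set0 -> ~` C !=set0 -> (0 < cut_size C)%N.
Proof.
move=> fC [x Cx] [y nCy]; have [|| u [v] [_ _ uv]] := econn (P := C).
- by exists x.
- by exists y.
by rewrite /cut_size /fcard cardfs_gt0; apply/fset0Pn; exists (u, v);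
  rewrite in_fset_set// inE.
Qed.

(** If no edge joined two parts of C, their coboundaries would be disjoint subsets of that of C. One
    part still splits p and q, and it is strictly smaller because the other part has a nonempty
    coboundary. *)
Lemma minimal_connected p q C : UltraFilter p -> UltraFilter q ->
  minimal p q C -> connected_in e C.
Proof.
move=> pU qU [fC sC CK minC] P [x Cx Px] [y Cy nPy]; apply: contrapT => nE.
have noedge u v : C u -> C v -> e u v -> P u -> P v.
  move=> Cu Cv uv Pu; apply: contrapT => nPv.
  by apply: nE; exists u, v; split.
have [_ nC] := splits_ex pU qU sC.
pose C1 := C `&` P; pose C2 := C `&` ~` P.
have sub1 : coboundary e C1 `<=` coboundary e C.
  move=> [u v] [/= [Cu Pu] nv uv]; split=> //= Cv; apply: nv; split=> //.
  exact: noedge uv Pu.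
have sub2 : coboundary e C2 `<=` coboundary e C.
  move=> [u v] [/= [Cu Pu] nv uv]; split=> //= Cv; apply: nv; split=> //= Pv.
  by apply: Pu; apply: noedge (esym uv) Pv.
have f1 : cut C1 := sub_finite_set sub1 fC.
have f2 : cut C2 := sub_finite_set sub2 fC.
have sum : (cut_size C1 + cut_size C2 <= cut_size C)%N.
  have <- : (cut_size C + fcard (@set0 (V * V)))%N = cut_size C.
    by rewrite /fcard fset_set0 cardfs0 addn0.
  apply: fcard_exchange => //; rewrite ?setU0 ?subUset//.
  by move=> [u v] [[/= [_ ?] _ _] [[_ ?]]].
have nC1 : ~` C1 !=set0 by case: nC => z nCz; exists z => -[].
have nC2 : ~` C2 !=set0 by case: nC => z nCz; exists z => -[].
have := cut_size_gt0 f1 (ex_intro _ x (conj Cx Px)) nC1.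
have := cut_size_gt0 f2 (ex_intro _ y (conj Cy nPy)) nC2.
have /orP[/(minC _ f1)|/(minC _ f2)] : splits C1 p q || splits C2 p q.
- move: sC; rewrite /splits /C1 /C2 !ultra_setI// !ultra_setC//.
  by do 4!case: `[< _ >].
- lia.
- lia.
Qed.

Lemma minimal_cut_tight C : minimal_cut C -> tight e C.
Proof.
move=> [p [q [pU qU mC]]]; split; first exact: minimal_connected mC.
exact: minimal_connected (minimalC pU qU mC).
Qed.

Lemma minimal_cut_cut C : minimal_cut C -> cut C.
Proof. by move=> [p [q [_ _ []]]]. Qed.

Lemma minimal_cut_size C : minimal_cut C -> (cut_size C <= K)%N.
Proof. by move=> [p [q [_ _ []]]]. Qed.

Lemma finite_separating x y : finite_set [set C | minimal_cut C /\ C x /\ ~ C y].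
Proof.
apply: sub_finite_set (finite_tight K x y esym econn) => C [mC [Cx nCy]].
by split=> //; [exact: minimal_cut_tight|exact: minimal_cut_cut|exact: minimal_cut_size].
Qed.

(* A crossing cut meets both ends of an edge of the coboundary of C, as its
   sides are connected; so it separates two of finitely many vertices. *)
Lemma finite_crossers C : cut C -> tight e C -> finite_set (crossers C).
Proof.
move=> fC tC; pose B := [set x | exists y, coboundary e C (x, y)].
have fB : finite_set B.
  apply: sub_finite_set (finite_image (@fst V V) fC) => x [y xy].
  by exists (x, y).
apply: (@sub_finite_set _ _ (\bigcup_(p in B `*` B)
   [set X | minimal_cut X /\ X p.1 /\ ~ X p.2])); last first.
  by apply: bigcup_finite => [|[x y] _]; [exact: finite_setX|exact: finite_separating].
have edge X : connected_in e X -> ~ X `<=` C -> ~ X `<=` ~` C ->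
    exists2 x, X x & B x.
  move=> cX /existsNP[y /not_implyP[Xy nCy]] /existsNP[x /not_implyP[Xx /contrapT Cx]].
  have [|| u [v] [Xu Xv uv]] := cX C; [by exists x|by exists y|].
  by exists u => //; exists v.
move=> X [mX nX]; have [cX cX'] := minimal_cut_tight mX.
have [x Xx Bx] : exists2 x, X x & B x.
  by apply: edge => // H; apply: nX; [apply: Or41|apply: Or42].
have [y Xy By] : exists2 x, (~` X) x & B x.
  by apply: edge => // H; apply: nX; [apply: Or43|apply: Or44].
by exists (x, y).
Qed.

Lemma exists_optimal C p q : UltraFilter p -> UltraFilter q -> cut C ->
  splits C p q -> (cut_size C <= K)%N -> exists D, optimal p q D.
Proof.
move=> pU qU fC sC CK.
have [D [fD sD] minD] := @exists_minimizer _ [set D | cut D /\ splits D p q]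
  cut_size (ex_intro _ C (conj fC sC)).
have mD : minimal p q D.
  split=> //; first by apply: leq_trans (minD C _) CK; split.
  by move=> X fX sX; exact: minD.
have [E mE minE] := @exists_minimizer _ (minimal p q)
  (fun E => fcard (crossers E)) (ex_intro _ D mD).
by exists E.
Qed.

Lemma optimal_minimal_cut p q C : UltraFilter p -> UltraFilter q ->
  optimal p q C -> minimal_cut C.
Proof. by move=> pU qU [mC _]; exists p, q. Qed.

Section Corner.
Variables (C D : set V) (p q p' q' : set_system V).
Hypotheses (pU : UltraFilter p) (qU : UltraFilter q).
Hypotheses (p'U : UltraFilter p') (q'U : UltraFilter q').
Hypotheses (oC : optimal p q C) (oD : optimal p' q' D).
Hypothesis nCD : ~ nested C D.

Let cutC' : cut C. Proof. by case: oC => -[]. Qed.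
Let cutD' : cut D. Proof. by case: oD => -[]. Qed.

Let cutI : cut (C `&` D).
Proof.
apply: (@sub_finite_set _ _ (coboundary e C `|` coboundary e D)).
  move=> [x y] [/= [Cx Dx] nCD' xy].
  by have [Cy|nCy] := pselect (C y); [right; split=> //= ?; apply: nCD'|left].
by rewrite finite_setU.
Qed.

Let cutU : cut (C `|` D).
Proof.
apply: (@sub_finite_set _ _ (coboundary e C `|` coboundary e D)).
  by move=> [x y] [/= [Cx|Dx] nCD' xy]; [left|right]; split=> //= ?; apply: nCD';
    [left|right].
by rewrite finite_setU.
Qed.

Let size_corner :
  (cut_size (C `&` D) + cut_size (C `|` D) <= cut_size C + cut_size D)%N.
Proof. exact: coboundary_corner. Qed.

(** Strictness comes from D itself: it crosses C, yet it is nested with the intersection and with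
    the union. *)
Let crossers_corner :
  (fcard (crossers (C `&` D)) + fcard (crossers (C `|` D)) <
   fcard (crossers C) + fcard (crossers D))%N.
Proof.
have mC := optimal_minimal_cut pU qU oC; have mD := optimal_minimal_cut p'U q'U oD.
have nDC : ~ nested D C by move=> /nested_sym.
have nU X : nested X C -> nested X D -> nested X (C `|` D).
  move=> XC XD; rewrite -(setCK (C `|` D)) setCU nestedCE.
  by apply: nested_corner; rewrite ?nestedCE// => /nested_sym; rewrite nestedCE.
apply: (@fcard_exchange_lt _ _ _ _ _ D).
- exact: finite_crossers (minimal_cut_tight mC).
- exact: finite_crossers (minimal_cut_tight mD).
- move=> X [[mX nX]|[mX nX]]; apply: contrapT => /not_orP[] XC XD; apply: nX.
    apply: nested_corner => //; apply: contrapT => ?; [exact: XC|exact: XD].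
  by apply: nU; apply: contrapT => ?; [exact: XC|exact: XD].
- move=> X [[mX nI] [_ nUX]]; split; split=> // H.
    by case: (nested_corners D H).
  by case: (nested_corners C H); rewrite 1?setIC 1?setUC.
- by left.
- case=> -[_]; apply.
    by apply/nested_sym; apply: Or41 => x [].
  by apply: Or41 => x; right.
Qed.

(** E competes with C for p and q, and F with D for p' and q'. Minimality and the bound on the sum
    force equal sizes, so both are again minimal; then the crossing numbers contradict
    optimality. *)
Lemma no_split_corners E F :
  cut E -> cut F -> (cut_size E + cut_size F <= cut_size C + cut_size D)%N ->
  (fcard (crossers E) + fcard (crossers F) <
   fcard (crossers C) + fcard (crossers D))%N ->
  splits E p q -> splits F p' q' -> False.
Proof.
case: oC oD => -[_ sC CK minC] optC [[_ sD DK minD] optD] fE fF EF EFlt sE sF.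
have CE := minC _ fE sE; have DF := minD _ fF sF.
have /optC CEx : minimal p q E by split=> [//|//||G /minC H /H]; lia.
have /optD DFx : minimal p' q' F by split=> [//|//||G /minD H /H]; lia.
lia.
Qed.

Lemma no_splitIU : splits (C `&` D) p q -> splits (C `|` D) p' q' -> False.
Proof. exact: no_split_corners. Qed.

Lemma no_splitUI : splits (C `|` D) p q -> splits (C `&` D) p' q' -> False.
Proof. by apply: no_split_corners; rewrite 1?addnC. Qed.

(** Both corners compete with C, so twice the size of C is at most the sum of the sizes of C and
    D. *)
Lemma split_both_size : splits (C `&` D) p q -> splits (C `|` D) p q ->
  (cut_size C <= cut_size D)%N.
Proof.
case: oC => -[_ _ _ minC] _ /(minC _ cutI) + /(minC _ cutU).
by move: size_corner; lia.
Qed.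

(** Equal sizes make both corners minimal for p and q, so twice the crossing number of C is less
    than the sum for C and D. *)
Lemma split_both_crossers : splits (C `&` D) p q -> splits (C `|` D) p q ->
  cut_size C = cut_size D -> (fcard (crossers C) < fcard (crossers D))%N.
Proof.
case: oC => -[_ _ CK minC] optC sI sU eCD.
have mI := minC _ cutI sI; have mU := minC _ cutU sU; move: size_corner => S.
have /optC CI : minimal p q (C `&` D).
  by split=> [//|//||G /minC H /H]; lia.
have /optC CU : minimal p q (C `|` D).
  by split=> [//|//||G /minC H /H]; lia.
by move: crossers_corner; lia.
Qed.

End Corner.

Lemma optimal_cut_nested C D : optimal_cut C -> optimal_cut D -> nested C D.
Proof.
move=> [p [q [pU qU oC]]] [p' [q' [p'U q'U oD]]]; apply: contrapT => nCD.
have nCD' : ~ nested C (~` D) by rewrite nestedCE.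
have nDC : ~ nested D C by move=> /nested_sym.
have nD'C : ~ nested (~` D) C by move=> /nested_sym.
have oD' := optimalC p'U q'U oD.
have H1 := no_splitIU pU qU p'U q'U oC oD nCD.
have H2 := no_splitUI pU qU p'U q'U oC oD nCD.
have H3 := no_splitIU pU qU p'U q'U oC oD' nCD'.
have H4 := no_splitUI pU qU p'U q'U oC oD' nCD'.
have S1 := split_both_size pU qU p'U q'U oC oD nCD.
have S2 := split_both_size pU qU p'U q'U oC oD' nCD'.
have S3 := split_both_size p'U q'U pU qU oD oC nDC.
have S4 := split_both_size p'U q'U pU qU oD' oC nD'C.
have X1 := split_both_crossers pU qU p'U q'U oC oD nCD.
have X2 := split_both_crossers pU qU p'U q'U oC oD' nCD'.
have X3 := split_both_crossers p'U q'U pU qU oD oC nDC.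
have X4 := split_both_crossers p'U q'U pU qU oD' oC nD'C.
have sD' : cut_size (~` D) = cut_size D by apply: cut_sizeC; case: oD => -[].
rewrite crossersC sD' in X2 X4; rewrite sD' in S2 S4.
have sC : splits C p q by case: oC => -[].
have sD : splits D p' q' by case: oD => -[].
(* Once every ultrafilter is placed in a corner, either some corner splits p from q while the
   opposite corner splits p' from q', or the two pairs occupy the two diagonals. In the second case
   each of C and D strictly precedes the other in the lexicographic order by size and crossing
   number. *)
move: sC sD H1 H2 H3 H4 S1 S2 S3 S4 X1 X2 X3 X4.
rewrite /splits !ultra_setI// !ultra_setU// !ultra_setC//.
move: (cut_size C) (cut_size D) (fcard _) (fcard _) => a b c d.
by case: `[< p C >]; case: `[< q C >] => // _;
  case: `[< p' D >]; case: `[< q' D >] => // _;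
  case: `[< p D >]; case: `[< q D >];
  case: `[< p' C >]; case: `[< q' C >] => H1 H2 H3 H4 S1 S2 S3 S4 X1 X2 X3 X4;
  solve [exact: (H1 isT isT)|exact: (H2 isT isT)|exact: (H3 isT isT)|exact: (H4 isT isT)
    |have := X1 isT isT; have := X4 isT isT; have := S1 isT isT; have := S4 isT isT; lia
    |have := X2 isT isT; have := X3 isT isT; have := S2 isT isT; have := S3 isT isT; lia].
Qed.

End Optimal.

(** * The tree of a nested family of cuts *)

Lemma finite_minimal_subset (V : Type) (S : set (set V)) (C : set V) :
  finite_set S -> S C ->
  exists M, [/\ S M, M `<=` C & forall D, S D -> D `<=` M -> D = M].
Proof.
move=> fS SC; pose below D := [set X | S X /\ X `<=` D].
have fb D : finite_set (below D) by apply: sub_finite_set fS => X [].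
have [M [SM MC] minM] := @exists_minimizer _ (below C) (fun D => fcard (below D))
  (ex_intro _ C (conj SC (@subset_refl _ C))).
exists M; split=> // D SD DM; apply: contrapT => nDM.
have := minM D (conj SD (subset_trans DM MC)).
apply/negP; rewrite -ltnNge; apply: fproper_ltn_card; rewrite fproperEneq.
apply/andP; split; last first.
  apply/fsubsetP => X; rewrite !in_fset_set// !inE => -[SX XD].
  by split=> //; exact: subset_trans DM.
apply: contra_notN nDM => /eqP E; apply/seteqP; split=> //.
have : M \in fset_set (below M) by rewrite in_fset_set// inE; split=> //; exact: subset_refl.
by rewrite -E in_fset_set// inE => -[].
Qed.

(* [s i] is the part of the tree beyond the neighbour [u i] of v, expressed
   without paths: its only entrance is the edge from v to [u i]. *)
Definition branching_vertex (T : tree) (v : vertex T) : Prop :=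
  exists (u : 'I_3 -> vertex T) (s : 'I_3 -> set (vertex T)), forall i,
  [/\ s i (u i), ~ s i v, infinite_set (s i),
      forall a b, edge a b -> s i b -> ~ s i a -> a = v /\ b = u i &
      forall j, j <> i -> ~ s i (u j)].

Section StructureTree.
Variables (V : choiceType) (N : set (set V)).
Hypothesis NC : forall C, N C -> N (~` C).
Hypothesis Nnested : forall C D, N C -> N D -> nested C D.
Hypothesis N0 : forall C, N C -> C !=set0.
Hypothesis Nfinite : forall x y, finite_set [set C | N C /\ C x /\ ~ C y].
Hypothesis V0 : exists x : V, True.
Implicit Types (C D : set V) (s t : set (set V)).

(** An orientation points every cut to one of its sides, consistently. The last condition excludes
    those pointing towards an end: it makes any two orientations differ on finitely many cuts
    only. *)
Definition is_orientation s : Prop := [/\ s `<=` N,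
  forall C, N C -> s (~` C) <-> ~ s C,
  forall C D, s C -> N D -> C `<=` D -> s D &
  exists x, finite_set [set C | s C /\ ~ C x]].

Lemma orientation_finite s x : is_orientation s -> finite_set [set C | s C /\ ~ C x].
Proof.
case=> sN _ _ [y fy].
apply: (@sub_finite_set _ _ ([set C | s C /\ ~ C y] `|`
  [set C | N C /\ C y /\ ~ C x])); last by rewrite finite_setU.
move=> C [sC nCx]; have [Cy|nCy] := pselect (C y); last by left.
by right; split=> //; exact: sN.
Qed.

Definition minimal_in s C : Prop :=
  s C /\ forall D, s D -> D `<=` C -> D = C.

Definition flip s C : set (set V) := [set D | (s D /\ D <> C) \/ D = ~` C].

Lemma setC_neq C : ~` C <> C.
Proof.
case: V0 => x _ E; have [Cx|nCx] := pselect (C x).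
  by have : (~` C) x by rewrite E.
by apply: (nCx); rewrite -E.
Qed.

Lemma minimal_below s C : is_orientation s -> s C ->
  exists2 M, minimal_in s M & M `<=` C.
Proof.
move=> os sC; have [sN _ _ _] := os.
have [x nCx] := N0 (NC (sN _ sC)).
have [M [[sM nMx] MC minM]] :=
  finite_minimal_subset (orientation_finite x os) (conj sC nCx).
exists M => //; split=> // D sD DM; apply: minM => //; split=> //.
by move=> /DM.
Qed.

(** The minimal members of s are the edges at the vertex s, and flipping crosses one. Minimality
    preserves upward closure: no other member lies below the removed C, and every larger cut than
    the added complement is already chosen. *)
Lemma flip_orientation s C : is_orientation s -> minimal_in s C ->
  is_orientation (flip s C).
Proof.
move=> os [sC minC]; have [sN sE sU [x fx]] := os; split.
- by move=> D [[/sN//]|->]; apply: NC; exact: sN.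
- move=> D ND; rewrite /flip /=; split.
    move=> [[nD DC]|/(congr1 setC)]; last first.
      by rewrite !setCK => ->; move=> [[_ //]|/esym/setC_neq].
    move=> [[sD _]|DE]; first by apply/(sE D ND).1: sD.
    by apply: DC; rewrite DE setCK.
  move=> /not_orP[/not_andP H DC].
  have [sD|nD] := pselect (s D).
    by case: H => // /contrapT ->; right.
  left; split; first exact/(sE D ND).2.
  by move=> E; apply: DC; rewrite -E setCK.
- move=> D E [[sD DC]|->] NE DE.
    left; split; first exact: sU sD NE DE.
    by move=> EC; apply: DC; apply: minC => //; rewrite -EC.
  have [->|nE] := pselect (E = ~` C); [by right|left; split]; last first.
    move=> EC; subst E; have [z nCz] := N0 (NC NE).
    exact: nCz (DE z nCz).
  apply: contrapT => nsE; have sE' : s (~` E) by apply/(sE E NE).2.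
  apply: nE; rewrite -[E]setCK; congr (~` _); apply: minC => // y nEy.
  by apply: contrapT => nCy; apply: nEy; exact: DE.
- exists x; apply: (@sub_finite_set _ _ ([set C | s C /\ ~ C x] `|` [set ~` C])).
    by move=> D [[[sD _]|->] nDx]; [left|right].
  by rewrite finite_setU; split=> //; exact: finite_set1.
Qed.

(** An oriented edge has a single origin: a member D of s is nested with C, and each relative
    position either puts D into t or is impossible. *)
Lemma minimal_in_inj s t C : is_orientation s -> is_orientation t ->
  minimal_in s C -> minimal_in t C -> s = t.
Proof.
suff H s' t' : is_orientation s' -> is_orientation t' ->
    minimal_in s' C -> minimal_in t' C -> s' `<=` t'.
  by move=> os ot ms mt; apply/seteqP; split; exact: H.
move=> [sN sE sU _] [tN tE tU _] [sC mC] [tC mC'] D sD.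
have ND := sN _ sD; have NC' := sN _ sC.
case: (Nnested ND NC') => H.
- by rewrite (mC D).
- have /(sE D ND).1// : s' (~` D).
  by apply: sU sC (NC ND) _ => x Cx Dx; exact: H Cx.
- apply: contrapT => /(tE D ND).2 tD.
  have DE := mC' _ tD H; have : s' (~` D) by rewrite DE.
  by move=> /(sE D ND).1.
- by apply: tU tC ND _ => x Cx; apply: contrapT => /H.
Qed.

Lemma flip_minimal s C : is_orientation s -> minimal_in s C ->
  minimal_in (flip s C) (~` C).
Proof.
move=> [sN sE sU _] [sC minC]; split; first by right.
move=> D [[sD DC]|//] DC'; have ND := sN _ sD.
have /(sE D ND).1// : s (~` D).
by apply: sU sC (NC ND) _ => x Cx /DC'.
Qed.

Lemma flipK s C : is_orientation s -> minimal_in s C ->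
  flip (flip s C) (~` C) = s.
Proof.
move=> os mC; apply: (minimal_in_inj _ os _ mC).
  by apply: flip_orientation (flip_minimal os mC); exact: flip_orientation.
rewrite -{3}(setCK C); apply: flip_minimal; last exact: flip_minimal.
exact: flip_orientation.
Qed.

(** The complements of the minimal members are the branches at the vertex s; for branches sharing a
    graph vertex, nestedness leaves no possibility but equality. *)
Lemma minimal_in_disjoint s C D x : is_orientation s -> minimal_in s C ->
  minimal_in s D -> ~ C x -> ~ D x -> C = D.
Proof.
move=> [sN sE sU _] [sC mC] [sD mD] nCx nDx.
have NC' := sN _ sC; have ND := sN _ sD.
case: (Nnested NC' ND) => H.
- exact: mD.
- have /(sE C NC').1// : s (~` C).
  by apply: sU sD (NC NC') _ => y Dy /H.
- by have := H x nCx.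
- by symmetry; apply: mC => // y Dy; apply: contrapT => /H.
Qed.

Definition orientation : Type := {s : set (set V) | `[< is_orientation s >]}.

HB.instance Definition _ := Choice.on orientation.

Implicit Types a b : orientation.

Definition osort a : set (set V) := val a.

Lemma orientationP a : is_orientation (osort a).
Proof. by apply/asboolP; exact: (valP a). Qed.

Definition mk_orientation s (os : is_orientation s) : orientation :=
  exist _ s (asboolT os).

Definition adjacent a b : bool :=
  `[< exists2 C, minimal_in (osort a) C & osort b = flip (osort a) C >].

Lemma osort_inj a b : osort a = osort b -> a = b.
Proof. exact: val_inj. Qed.

Lemma adjacent_minimal a b C : adjacent a b -> osort a C -> ~ osort b C ->
  minimal_in (osort a) C /\ osort b = flip (osort a) C.
Proof.
move=> /asboolP[D mD E] aC nbC; have [CD|CD] := pselect (C = D); first by subst.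
by exfalso; apply: nbC; rewrite E; left.
Qed.

Lemma adjacent_sym : symmetric adjacent.
Proof.
suff H a b : adjacent a b -> adjacent b a by move=> a b; apply/idP/idP; exact: H.
move=> /asboolP[C mC E]; apply/asboolP; exists (~` C).
  by rewrite E; exact: flip_minimal (orientationP a) mC.
by rewrite E flipK//; exact: orientationP.
Qed.

Lemma adjacent_irr : irreflexive adjacent.
Proof.
move=> a; apply/negbTE/negP => /asboolP[C [aC mC]] E.
have [sN sE _ _] := orientationP a.
have : osort a (~` C) by rewrite E; right.
by move/(sE C (sN _ aC)).1.
Qed.

Lemma finite_difference a b : finite_set (osort a `\` osort b).
Proof.
case: V0 => x _; have [bN bE _ _] := orientationP b.
have [aN _ _ _] := orientationP a.
apply: (@sub_finite_set _ _ ([set C | osort a C /\ ~ C x] `|`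
   setC @` [set C | osort b C /\ ~ C x])); last first.
  rewrite finite_setU; split; first exact: orientation_finite (orientationP a).
  by apply: finite_image; exact: orientation_finite (orientationP b).
move=> C [aC nbC]; have [Cx|nCx] := pselect (C x); last by left.
right; exists (~` C); last by rewrite setCK.
split; last by move=> /(_ Cx).
by apply/(bE C (aN _ aC)).2.
Qed.

Lemma orientation_sub a b : osort a `<=` osort b -> a = b.
Proof.
move=> ab; apply: osort_inj; apply/seteqP; split=> // C bC.
have [aN aE _ _] := orientationP a; have [bN bE _ _] := orientationP b.
have NC' := bN _ bC; apply: contrapT => /(aE C NC').2/ab.
by move/(bE C NC').1.
Qed.

(** Below a cut on which the orientations disagree lies a minimal member of a, which b cannot
    contain by upward closure. Flipping it lowers the number of disagreements. *)
Lemma adjacent_connected a b : exists2 p, path adjacent a p & last a p = b.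
Proof.
have [n] := ubnP (fcard (osort a `\` osort b)); elim: n a => // n IH a le_n.
have [ab|/existsNP[C /not_implyP[aC nbC]]] := pselect (osort a `<=` osort b).
  by exists [::] => //=; exact: orientation_sub.
have [M mM MC] := minimal_below (orientationP a) aC.
have [aN aE _ _] := orientationP a; have [bN bE bU _] := orientationP b.
have nbM : ~ osort b M by move=> bM; apply: nbC; exact: bU bM (aN _ aC) MC.
pose c : orientation := mk_orientation (flip_orientation (orientationP a) mM).
have ac : adjacent a c by apply/asboolP; exists M.
have [|p cp lp] := IH c; last by exists (c :: p) => //=; rewrite ac.
rewrite ltnS in le_n; apply: leq_trans le_n; apply: fproper_ltn_card.
have fa := finite_difference a b; have fc := finite_difference c b.
rewrite fproperEneq; apply/andP; split; last first.
  apply/fsubsetP => D; rewrite !in_fset_set// !inE => -[[[aD _]|->] nbD] //.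
  by case: nbD; apply/(bE M (aN _ mM.1)).2.
apply/eqP => E; have : M \in fset_set (osort a `\` osort b).
  by rewrite in_fset_set// inE; split=> //; exact: mM.1.
rewrite -E in_fset_set// inE => -[[[_ /(_ erefl)//]|/esym/setC_neq//]].
Qed.

Lemma path_enter a p C : path adjacent a p -> ~ osort a C -> osort (last a p) C ->
  exists i, [/\ (i.+1 < size (a :: p))%N, ~ osort (nth a (a :: p) i) C &
                osort (nth a (a :: p) i.+1) C].
Proof.
elim: p a => [//|b p IH] a /= /andP[ab bp] naC lC.
have [bC|nbC] := pselect (osort b C); first by exists 0%N.
have [i [ip nC iC]] := IH b bp nbC lC; exists i.+1.
rewrite ltnS; split=> //.
  by rewrite -[nth _ _ _]/(nth a (b :: p) i) (set_nth_default b)//; exact: ltnW.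
by rewrite -[nth _ _ _]/(nth a (b :: p) i.+1) (set_nth_default b).
Qed.

(** The step from the first vertex to the second gives up a cut C. The rest of the cycle must regain
    C, and by [minimal_in_inj] this can only happen along the same edge, against the distinctness of
    the vertices. *)
Lemma adjacent_acyclic (c : seq orientation) :
  (2 < size c)%N -> uniq c -> ~~ cycle adjacent c.
Proof.
case: c => [//|a0 [//|a1 [//|a2 c]]] _ uc; apply/negP => /andP[a01 a12].
have [C mC E] : exists2 C, minimal_in (osort a0) C & osort a1 = flip (osort a0) C.
  by apply/asboolP.
have [aN aE _ _] := orientationP a0; have NC' := aN _ mC.1.
have na1 : ~ osort a1 C by rewrite E => -[[_]|/esym/setC_neq].
pose p := a2 :: rcons c a0; have {}a12 : path adjacent a1 p := a12.
have lp : last a1 p = a0 by rewrite /p /= last_rcons.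
have [|i [ip ni iC]] := path_enter a12 na1 (C := C); first by rewrite lp; case: mC.
have us : uniq (a1 :: p).
  rewrite /p -!rcons_cons -cats1 uniq_catC.
  exact: uc.
have adj : adjacent (nth a1 (a1 :: p) i.+1) (nth a1 (a1 :: p) i).
  by rewrite adjacent_sym; exact: (pathP a1 a12).
have [m1 E1] := adjacent_minimal adj iC ni.
have e1 : nth a1 (a1 :: p) i.+1 = a0.
  by apply: osort_inj; apply: minimal_in_inj m1 mC; exact: orientationP.
have e0 : nth a1 (a1 :: p) i = a1 by apply: osort_inj; rewrite E1 e1.
have i0 : i = 0%N by apply/eqP; rewrite -(nth_uniq a1 (ltnW ip) _ us)// e0.
move: e1 uc; rewrite i0 /p /= => ->.
by rewrite !inE eqxx !orbT.
Qed.

Definition structure_tree (v0 : inhabited orientation) : tree :=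
  Tree v0 adjacent_sym adjacent_irr adjacent_connected adjacent_acyclic.


Lemma adjacent_minimalC a b C : adjacent a b -> ~ osort a C -> osort b C ->
  minimal_in (osort a) (~` C) /\ osort b = flip (osort a) (~` C).
Proof.
move=> ab naC bC; have [bN bE _ _] := orientationP b.
have [aN aE _ _] := orientationP a.
apply: adjacent_minimal ab _ _; first exact/(aE C (bN _ bC)).2.
by move/(bE C (bN _ bC)).1.
Qed.

Lemma principal_subproof (x : V) : is_orientation [set C | N C /\ C x].
Proof.
split=> [C [] //|C NC'|C D [NC' Cx] ND CD|].
- split=> [[_ nCx] [_ //]|H]; split; [exact: NC|by move=> Cx; apply: H].
- by split=> //; exact: CD.
- exists x; apply: sub_finite_set (@finite_set0 _) => C [[_ Cx]].
  by move=> /(_ Cx).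
Qed.

Definition principal x : orientation := mk_orientation (principal_subproof x).

(** * Group actions on the structure tree *)

Section Action.
Variables (G : groupType) (act : G -> V -> V) (e : V -> V -> Prop) (x0 : V).
Hypothesis act1 : forall x, act 1%g x = x.
Hypothesis actM : forall g h x, act (g * h)%g x = act g (act h x).
Hypothesis act_trans : forall x, exists g, act g x0 = x.
Hypothesis esym : forall x y, e x y -> e y x.
Hypothesis econn : connected_in e setT.
Hypothesis einv : forall g x y, e x y -> e (act g x) (act g y).
Hypothesis efin : finite_set [set y | e x0 y].
Hypothesis Ninv : forall g C, N C -> N (act g @^-1` C).

Lemma actK g x : act g^-1%g (act g x) = x.
Proof. by rewrite -actM mulVg act1. Qed.

Lemma actVK g x : act g (act g^-1%g x) = x.
Proof. by rewrite -actM mulgV act1. Qed.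

Lemma preimage_actK g C : act g^-1%g @^-1` (act g @^-1` C) = C.
Proof. by apply/funext => x; rewrite /preimage /= actVK. Qed.

Lemma preimage_actVK g C : act g @^-1` (act g^-1%g @^-1` C) = C.
Proof. by apply/funext => x; rewrite /preimage /= actK. Qed.

(** The preimage of C under [act g] is its translate by the inverse of g, so this family consists of
    the translates by g of the members of s. *)
Definition push_cuts g s : set (set V) := [set C | s (act g @^-1` C)].

Lemma push_cutsM g h s : push_cuts (g * h)%g s = push_cuts g (push_cuts h s).
Proof.
apply/funext => C; rewrite /push_cuts /=; congr s.
by apply/funext => x; rewrite /preimage /= actM.
Qed.

Lemma push_cuts1 s : push_cuts 1%g s = s.
Proof.
apply/funext => C; rewrite /push_cuts /=; congr s.
by apply/funext => x; rewrite /preimage /= act1.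
Qed.

Lemma push_orientation g s : is_orientation s -> is_orientation (push_cuts g s).
Proof.
move=> [sN sE sU [x fx]]; split.
- by move=> C /sN/(Ninv g^-1%g); rewrite preimage_actK.
- by move=> C NC'; exact: sE _ (Ninv g NC').
- move=> C D gC ND CD; apply: sU gC (Ninv g ND) _ => y; exact: CD.
- exists (act g x); apply: sub_finite_set (finite_image
    (fun C => act g^-1%g @^-1` C) fx) => C [gC nCx].
  by exists (act g @^-1` C) => //; exact: preimage_actK.
Qed.

Lemma push_minimal g s C :
  minimal_in s C -> minimal_in (push_cuts g s) (act g^-1%g @^-1` C).
Proof.
move=> [sC mC]; split; first by rewrite /push_cuts /= preimage_actVK.
move=> D gD DC; rewrite -(mC _ gD) ?preimage_actK// => x /DC.
by rewrite /preimage /= actK.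
Qed.

Lemma push_flip g s C :
  push_cuts g (flip s C) = flip (push_cuts g s) (act g^-1%g @^-1` C).
Proof.
apply/funext => D; apply/propext; split=> -[[gD DC]|E].
- by left; split=> // DE; apply: DC; rewrite DE preimage_actVK.
- by right; rewrite -(preimage_actK g D) E.
- by left; split=> // DE; apply: DC; rewrite -DE preimage_actK.
- right; rewrite E -[RHS](preimage_actVK g); exact: erefl.
Qed.

Definition oact g a : orientation := mk_orientation (push_orientation g (orientationP a)).

Lemma oact1 a : oact 1%g a = a.
Proof. by apply: osort_inj; rewrite /osort /= push_cuts1. Qed.

Lemma oactM g h a : oact (g * h)%g a = oact g (oact h a).
Proof. by apply: osort_inj; rewrite /osort /= push_cutsM. Qed.

Lemma oact_adjacent g a b : adjacent a b -> adjacent (oact g a) (oact g b).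
Proof.
move=> /asboolP[C mC E]; apply/asboolP; exists (act g^-1%g @^-1` C).
  exact: push_minimal.
by rewrite -[LHS]/(push_cuts g (osort b)) E push_flip.
Qed.

Lemma finite_neighbors x : finite_set [set y | e x y].
Proof.
have [g <-] := act_trans x.
apply: sub_finite_set (finite_image (act g) efin) => y xy.
by exists (act g^-1%g y); rewrite ?actVK//= -[x0](actK g); exact: einv.
Qed.

Lemma coboundary_ex C : N C -> exists u v, coboundary e C (u, v).
Proof.
move=> NC'; have [x Cx] := N0 NC'; have [y Cy] := N0 (NC NC').
by have [||u [v] [_ _ uv]] := econn (P := C); [exists x|exists y|exists u, v].
Qed.

Hypothesis Nex : exists C, N C.
Hypothesis Ncut : forall C, N C -> finite_set (coboundary e C).

Lemma minimal_ex a : exists C, minimal_in (osort a) C.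
Proof.
have [C NC'] := Nex; have [aN aE _ _] := orientationP a.
have [aC|/(aE C NC').2 aC] := pselect (osort a C);
  by have [M mM _] := minimal_below (orientationP a) aC; exists M.
Qed.

(** The finite set consists of the endpoints of the coboundary of one minimal cut C of a. An element
    fixing them preserves the coboundary, hence C, hence the vertex at which C is minimal. *)
Lemma oact_fix a : exists2 F : set V, finite_set F &
  forall g, (forall x, F x -> act g x = x) -> oact g a = a.
Proof.
have [C mC] := minimal_ex a; have [aN aE _ _] := orientationP a.
have NC' := aN _ mC.1; have fC := Ncut NC'.
exists (fst @` coboundary e C `|` snd @` coboundary e C).
  by rewrite finite_setU; split; exact: finite_image.
move=> g gF.
have gC u v : coboundary e C (u, v) -> act g u = u /\ act g v = v.
  by move=> uv; split; apply: gF; [left|right]; exists (u, v).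
have E : act g @^-1` C = C.
  symmetry; have [u0 [v0 uv0]] := coboundary_ex NC'.
  apply: (coboundary_inj esym econn uv0); apply/seteqP; split.
    by move=> [u v] uv; have [gu gv] := gC u v uv; case: uv => /= ? ? ?; split;
      rewrite /preimage/= ?gu ?gv.
  move=> [u v] [/= gu ngv uv].
  have [ggu ggv] : act g (act g u) = act g u /\ act g (act g v) = act g v.
    by apply: gC; split=> //; exact: einv.
  have /(congr1 (act g^-1%g)) := ggu; have /(congr1 (act g^-1%g)) := ggv.
  rewrite !actK => Ev Eu; split=> //=; first by rewrite -Eu.
  by rewrite -Ev.
apply: osort_inj; apply: (minimal_in_inj (orientationP _) (orientationP _) _ mC).
have -> : C = act g^-1%g @^-1` C by rewrite -{2}E preimage_actK.
exact: push_minimal.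
Qed.

(** The cut keeps clear of the neighbours of x and y as well; this margin is what makes two border
    vertices of one orientation inseparable. *)
Definition separated x y : Prop := exists D, [/\ N D,
  D x /\ (forall x', e x x' -> D x') & ~ D y /\ (forall y', e y y' -> ~ D y')].

Hypothesis finite_nonseparated : finite_set [set y | ~ separated x0 y].

Lemma separated_act g x y : separated x y -> separated (act g x) (act g y).
Proof.
move=> [D [ND [Dx nx] [Dy ny]]]; exists (act g^-1%g @^-1` D); split.
- exact: Ninv.
- rewrite /preimage /= actK; split=> // x' /(einv g^-1%g); rewrite actK; exact: nx.
- rewrite /preimage /= actK; split=> // x' /(einv g^-1%g); rewrite actK; exact: ny.
Qed.

Definition nonseparated_bound := fcard [set y | ~ separated x0 y].

Lemma nonseparated_act g x :
  [set y | ~ separated (act g x) y] = act g @` [set y | ~ separated x y].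
Proof.
apply/seteqP; split=> [y nxy|_ [y nxy <-] /= /(separated_act g^-1%g)].
  exists (act g^-1%g y); rewrite ?actVK//= => /(separated_act g).
  by rewrite actVK.
by rewrite !actK.
Qed.

Lemma finite_nonseparated_all x : finite_set [set y | ~ separated x y].
Proof.
by have [g <-] := act_trans x; rewrite nonseparated_act; exact: finite_image.
Qed.

Lemma nonseparated_card x : fcard [set y | ~ separated x y] = nonseparated_bound.
Proof.
have [g <-] := act_trans x; rewrite nonseparated_act fcard_inj//.
by move=> y z /(congr1 (act g^-1%g)); rewrite !actK.
Qed.

(** The border ties a tree vertex to a finite nonempty set of graph vertices, compatibly with the
    action. *)
Definition border s : set V :=
  [set x | exists C x', [/\ minimal_in s C, C x', ~ C x & e x x']].

(** Whichever side of a separating D the orientation chooses, a minimal member below that side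
    misses x or y, so it is the one bordered by that vertex; the neighbour inside it contradicts the
    margin. *)
Lemma border_nonseparated a x y : border (osort a) x -> border (osort a) y ->
  ~ separated x y.
Proof.
move=> [C [x' [mC Cx' nCx xx']]] [C2 [y' [mC2 C2y' nC2y yy']]].
move=> [D [ND [Dx nx] [Dy ny]]]; have oa := orientationP a.
have [aN aE _ _] := oa; have [aD|/(aE D ND).2 aD] := pselect (osort a D).
  have [M mM MD] := minimal_below oa aD.
  have E : M = C2 by apply: minimal_in_disjoint oa mM mC2 _ nC2y => /MD.
  by subst M; exact: ny yy' (MD _ C2y').
have [M mM MD] := minimal_below oa aD.
have E : M = C by apply: minimal_in_disjoint oa mM mC _ nCx => /MD.
by subst M; exact: MD _ Cx' (nx _ xx').
Qed.

Lemma minimal_border a C : minimal_in (osort a) C ->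
  exists2 x, border (osort a) x & ~ C x.
Proof.
move=> mC; have [aN _ _ _] := orientationP a.
have [u [v [/= Cu nCv uv]]] := coboundary_ex (aN _ mC.1).
by exists v => //; exists C, u; split=> //; exact: esym.
Qed.

Lemma finite_border a : finite_set (border (osort a)).
Proof.
have [x bx] : border (osort a) !=set0.
  by have [C /minimal_border[x bx _]] := minimal_ex a; exists x.
apply: sub_finite_set (finite_nonseparated_all x) => y; exact: border_nonseparated.
Qed.

Lemma oact_border g a x :
  border (osort a) x -> border (osort (oact g a)) (act g x).
Proof.
move=> [C [x' [mC Cx' nCx xx']]]; exists (act g^-1%g @^-1` C), (act g x').
by rewrite /preimage /= !actK; split=> //; [exact: push_minimal|exact: einv].
Qed.

Lemma finite_minimal a : finite_set [set C | minimal_in (osort a) C].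
Proof.
have [aN _ _ _] := orientationP a.
apply: (@sub_finite_set _ _ (\bigcup_(x in border (osort a))
   \bigcup_(x' in [set x' | e x x']) [set C | N C /\ C x' /\ ~ C x])); last first.
  apply: bigcup_finite => [|x _]; first exact: finite_border.
  by apply: bigcup_finite => [|x' _]; [exact: finite_neighbors|exact: Nfinite].
move=> C mC; have NC' := aN _ mC.1.
have [u [v [/= Cu nCv uv]]] := coboundary_ex NC'.
by exists v; [exists C, u; split=> //; exact: esym|exists u => //; exact: esym].
Qed.

(** Each neighbour flips a minimal cut, and a border vertex outside that cut is attached to it.
    Distinct minimal cuts have disjoint complements, so the attachment is injective, and border
    vertices are mutually inseparable. *)
Lemma adjacent_bound a (s : seq orientation) :
  uniq s -> all (adjacent a) s -> (size s <= nonseparated_bound)%N.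
Proof.
move=> us /allP sa; have [C0 mC0] := minimal_ex a.
have [x bx _] := minimal_border mC0.
have ex b : exists y, adjacent a b -> exists C, [/\ minimal_in (osort a) C,
    osort b = flip (osort a) C, border (osort a) y & ~ C y].
  have [/asboolP[C mC E]|nab] := boolP (adjacent a b); last by exists x.
  by have [y by' nCy] := minimal_border mC; exists y => _; exists C.
have [f Hf] := choice ex.
have fi : {in s &, injective f}.
  move=> b c /sa/Hf[C [mC Eb _ nC]] /sa/Hf[D [mD Ec _ nD]] E.
  rewrite -E in nD; apply: osort_inj; rewrite Eb Ec.
  by rewrite (minimal_in_disjoint (orientationP a) mC mD nC nD).
have -> : size s = #|` [fset y in [seq f b | b <- s]]|%fset.
  rewrite card_fseq undup_id ?size_map// map_inj_in_uniq//.
rewrite -(nonseparated_card x); apply: fsubset_leq_card; apply/fsubsetP => y.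
rewrite inE => /mapP[b /sa/Hf[C [_ _ by' _]] ->].
by rewrite in_fset_set ?inE; [exact: border_nonseparated bx by'|exact: finite_nonseparated_all].
Qed.

(** Some translate has x0 on its border. This is witnessed by a cut containing a neighbour of x0 but
    not x0: there are finitely many, and each is minimal in at most one orientation. *)
Lemma oact_orbits : exists2 S : set orientation, finite_set S &
  forall a, exists g, S (oact g a).
Proof.
exists [set a | border (osort a) x0]; last first.
  move=> a; have [C /minimal_border[x bx _]] := minimal_ex a.
  have [g gx] := act_trans x; exists g^-1%g => /=.
  by rewrite -(actK g x0) gx; exact: oact_border.
pose T := \bigcup_(x' in [set x' | e x0 x']) [set C | N C /\ C x' /\ ~ C x0].
have fT : finite_set T.
  by apply: bigcup_finite => [|x' _]; [exact: finite_neighbors|exact: Nfinite].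
apply: (@sub_finite_set _ _ (\bigcup_(C in T) [set a | minimal_in (osort a) C])).
  move=> a [C [x' [mC Cx' nCx xx']]]; exists C => //; exists x' => //.
  by have [aN _ _ _] := orientationP a; split=> //; exact: aN mC.1.
apply: bigcup_finite => // C _.
have [[a mC]|nE] := pselect ([set a | minimal_in (osort a) C] !=set0).
  apply: sub_finite_set (finite_set1 a) => b mC'; apply: osort_inj.
  exact: minimal_in_inj (orientationP _) (orientationP _) mC' mC.
by apply: sub_finite_set (@finite_set0 _) => a mC; apply: nE; exists a.
Qed.

(** * A branching vertex from three ends *)

Section Branching.
Variable p : 'I_3 -> set_system V.
Hypothesis pU : forall i, UltraFilter (p i).
Hypothesis p_free : forall i (F : set V), finite_set F -> ~ p i F.
Hypothesis p_split : forall i j, i <> j -> exists D, [/\ N D, p i D & ~ p j D].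

Let pC i C : p i (~` C) <-> ~ p i C.
Proof.
have := ultra_setC C (pU i).
by split; [move=> /asboolP; rewrite H => /negP + /asboolP; apply|
  move=> nC; apply/asboolP; rewrite H; apply/negP => /asboolP].
Qed.

(** Otherwise the ultrafilter contains all members of a, hence the intersection of the finitely many
    minimal ones. Vertices of this intersection lie in the same cuts, so they are mutually
    inseparable and finite in number, against freeness. *)
Lemma ultra_not_orientation i a : exists D, [/\ N D, p i D & osort a (~` D)].
Proof.
apply: contrapT => H; have [aN aE aU _] := orientationP a.
have aP D : osort a D -> p i D.
  move=> aD; apply: contrapT => /pC npD; apply: H; exists (~` D).
  by rewrite setCK; split=> //; apply: NC; exact: aN.
have fM := finite_minimal a.
have : p i (\bigcap_(C in [set C | minimal_in (osort a) C]) C).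
  rewrite -[X in \bigcap_(_ in X) _](fset_setK fM); apply: filter_bigI => C.
  by rewrite in_fset_set// inE => -[/aP].
set B := (X in p i X) => pB.
have [y By] : B !=set0 by exact: filter_ex pB.
have inB D z : B z -> osort a D -> D z.
  by move=> Bz /(minimal_below (orientationP a))[M mM]; apply; exact: Bz.
suff fB : finite_set B by exact: p_free fB pB.
apply: sub_finite_set (finite_nonseparated_all y) => z Bz.
move=> [D [ND [Dy _] [nDz _]]]; apply: nDz; apply: (inB _ _ Bz).
by apply: contrapT => /(aE D ND).2/(inB _ _ By).
Qed.

(** The median of three ends; their number being odd, exactly one side of each cut is chosen. *)
Definition majority : set (set V) :=
  [set D | N D /\ exists i j, [/\ i <> j, p i D & p j D]].

Lemma majority_orientation : is_orientation majority.
Proof.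
split.
- by move=> D [].
- move=> D ND; pose P (A : set V) := [set i | `[< p i A >]]%SET.
  have M A : N A -> majority A <-> (1 < #|P A|)%N.
    move=> NA; split=> [[_ [i [j [ij pi pj]]]]|].
      apply: leq_trans (subset_leq_card (A := [set i; j]%SET) _).
        by rewrite cards2; case: eqVneq ij.
      by apply/fintype.subsetP => k; rewrite /P !inE => /orP[]/eqP->; do 2!apply/asboolP.
    by move=> /card_gt1P[i [j [+ + /eqP ij]]]; rewrite /P !inE => /asboolP/asboolP pi /asboolP/asboolP pj;
      split=> //; exists i, j.
  have PC : P (~` D) = (~: P D)%SET.
    by apply/setP => i; rewrite !inE ultra_setC.
  have := cardsC (P D); rewrite card_ord -PC => c.
  move: c (M _ ND) (M _ (NC ND)); move: #|P D| #|P (~` D)| => u v c Mu Mv.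
  split=> [/Mv vP /Mu uP|nM]; first by lia.
  by apply/Mv; rewrite ltnNge; apply/negP => vP; apply/nM/Mu; lia.
- move=> C D [NC' [i [j [ij pi pj]]]] ND CD; split=> //; exists i, j; split=> //;
    exact: filterS CD _.
- exists x0; apply: (@sub_finite_set _ _ (\bigcup_i \bigcup_(j in ~` [set i])
    [set D | [/\ N D, p i D, p j D & ~ D x0]])).
    move=> D [[ND [i [j [ij pi pj]]]] nD]; exists i => //; exists j => //.
    by move=> /= E; apply: ij.
  apply: bigcup_finite => [|i _]; first exact: finite_finset.
  apply: bigcup_finite => [|j ji]; first exact: finite_finset.
  (* A cut E splitting the ends i and j is nested with D. As D contains both ends, it contains E or
     its complement, hence one of two fixed vertices, and finitely many cuts separate these from
     x0. *)
  have [E [NE pE npE]] : exists D, [/\ N D, p i D & ~ p j D].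
    by apply: p_split => ij; apply: ji.
  have [y Ey] := N0 NE; have [z nEz] := N0 (NC NE).
  apply: (@sub_finite_set _ _ ([set D | N D /\ D y /\ ~ D x0] `|`
    [set D | N D /\ D z /\ ~ D x0])); last by rewrite finite_setU.
  move=> D [ND pi pj nD]; case: (Nnested ND NE) => H.
  + by case: npE; exact: filterS H pj.
  + by case: ((pC i E).1 (filterS H pi)).
  + by right; split=> //; split=> //; apply: contrapT => /H.
  + by left; split=> //; split=> //; apply: contrapT => /H.
Qed.

(** For each end, some minimal cut at the median cuts that end off. No cut does so for two ends,
    since its complement would then be a majority. *)
Lemma exists_branching : exists (a : orientation) (C : 'I_3 -> set V),
  injective C /\ forall i, minimal_in (osort a) (C i) /\ infinite_set (~` C i).
Proof.
pose a := mk_orientation majority_orientation; have [aN aE aU _] := orientationP a.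
have ex i : exists C, minimal_in majority C /\ p i (~` C).
  have [D [ND pD aD]] := ultra_not_orientation i a.
  have [M mM MD] := minimal_below (orientationP a) aD.
  by exists M; split=> //; apply: filterS pD => x Dx /MD.
have [C HC] := choice ex; exists a, C; split=> [i j E|i].
  apply: contrapT => ij; have [[mC nC] pi] := HC i; have [_ pj] := HC j.
  have NCi := aN _ mC; apply: ((aE _ NCi).1 _ mC).
  split; first exact: NC.
  by exists i, j; split=> //; rewrite E.
have [mC pi] := HC i; split=> // fC.
exact: p_free fC pi.
Qed.

End Branching.

(** The principal orientations of the vertices outside C lie on this side, and only inseparable
    vertices share one, so the fibres are finite. *)
Lemma infinite_side C : infinite_set (~` C) -> N C ->
  infinite_set [set a | osort a (~` C)].
Proof.
move=> iC NC' fs; apply: iC.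
apply: (@sub_finite_set _ _ (\bigcup_(a in [set a | osort a (~` C)])
   [set x | principal x = a])).
  by move=> x nCx; exists (principal x) => //; split=> //; exact: NC.
apply: bigcup_finite => // a _.
have [[x Ex]|nE] := pselect ([set x | principal x = a] !=set0); last first.
  by apply: sub_finite_set (@finite_set0 _) => x Ex; apply: nE; exists x.
apply: sub_finite_set (finite_nonseparated_all x) => y /= Ey [D [ND [Dx _] [nDy _]]].
have : osort (principal x) D by split.
by rewrite Ex -Ey => -[].
Qed.

Lemma structure_tree_branching (v0 : inhabited orientation) (a : orientation)
    (C : 'I_3 -> set V) : injective C ->
  (forall i, minimal_in (osort a) (C i) /\ infinite_set (~` C i)) ->
  branching_vertex (a : vertex (structure_tree v0)).
Proof.
move=> Ci HC; have [aN aE _ _] := orientationP a.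
exists (fun i => mk_orientation (flip_orientation (orientationP a) (HC i).1)).
exists (fun i => [set b : orientation | osort b (~` C i)]) => i.
have [[aC mC] iC] := HC i; split=> /=.
- by right.
- by move/(aE _ (aN _ aC)).1.
- exact: infinite_side (aN _ aC).
- move=> b c bc cC nbC; have [] := adjacent_minimalC bc nbC cC.
  rewrite setCK => mb E; have ab : b = a.
    by apply: osort_inj; exact: minimal_in_inj (orientationP _) (orientationP _) mb (conj aC mC).
  by split=> //; apply: osort_inj; rewrite E ab.
- move=> j ji; rewrite /osort /= => -[[] /(aE _ (aN _ aC)).1//|/(congr1 setC)].
  by rewrite !setCK => /Ci E; apply: ji.
Qed.

Theorem structure_tree_action (p : 'I_3 -> set_system V) :
  (forall i, UltraFilter (p i)) ->
  (forall i (F : set V), finite_set F -> ~ p i F) ->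
  (forall i j, i <> j -> exists D, [/\ N D, p i D & ~ p j D]) ->
  exists (T : tree) (ta : G -> vertex T -> vertex T),
  [/\ forall v, ta 1%g v = v,
      forall g h v, ta (g * h)%g v = ta g (ta h v),
      forall g u v, edge u v -> edge (ta g u) (ta g v),
      bounded_valence T &
  [/\ forall v, exists2 F : set V, finite_set F &
        forall g, (forall x, F x -> act g x = x) -> ta g v = v,
      forall u v, exists2 F : set V, finite_set F &
        forall g, ta g u = v -> exists2 x, F x & F (act g x),
      exists2 S : set (vertex T), finite_set S & forall v, exists g, S (ta g v) &
      exists v : vertex T, branching_vertex v]].
Proof.
move=> pU p_free p_split; exists (structure_tree (inhabits (principal x0))), oact.
split; [exact: oact1|exact: oactM|exact: oact_adjacent| |split].
- by exists nonseparated_bound => a s; exact: adjacent_bound.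
- exact: oact_fix.
- move=> a b; exists (border (osort a) `|` border (osort b)).
    by rewrite finite_setU; split; exact: finite_border.
  move=> g <-; have [C /minimal_border[x bx _]] := minimal_ex a.
  by exists x; [left|right; exact: oact_border].
- exact: oact_orbits.
- have [a [C [Ci HC]]] := exists_branching pU p_free p_split.
  by exists a; exact: structure_tree_branching Ci HC.
Qed.

End Action.

End StructureTree.

(** * Free groups as trees *)

Section Words.
Context {A : choiceType}.
Implicit Types (u v w : free_group A) (l s t : seq (@letter A)) (a b : @letter A).

Definition wsize u : nat := size (val u).

(* Elements of the free group are vertices of the Cayley tree for LEFT
   multiplication by letters, so that the branch below w consists of the words
   with suffix w. *)
Definition near (c : nat) u v : Prop := (wsize (v * u^-1)%g <= c)%N.

Lemma size_push a s : (size (push a s) <= (size s).+1)%N.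
Proof. by case: s => [|b s] //=; case: ifP => //= _; lia. Qed.

Lemma size_foldr_push s l : (size (foldr push s l) <= size l + size s)%N.
Proof. by elim: l => //= a l IH; apply: leq_trans (size_push _ _) _; rewrite addSn ltnS. Qed.

Lemma push_id a s : reduced (a :: s) -> push a s = a :: s.
Proof. by case: s => [//|b s] /= /andP[/negbTE ->]. Qed.

Lemma wsizeM u v : (wsize (u * v)%g <= wsize u + wsize v)%N.
Proof. exact: size_foldr_push. Qed.

Lemma wsizeV u : wsize (u^-1)%g = wsize u.
Proof. by rewrite /wsize /= size_rev size_map. Qed.

Lemma near_refl u : near 0 u u.
Proof. by rewrite /near mulgV. Qed.

Lemma near_sym c u v : near c u v -> near c v u.
Proof. by rewrite /near -wsizeV invgM invgK. Qed.

Lemma near_trans c d v u w : near c u v -> near d v w -> near (c + d) u w.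
Proof.
rewrite /near => uv vw; have -> : (w * u^-1 = (w * v^-1) * (v * u^-1))%g.
  by rewrite mulgA mulgVK.
by apply: leq_trans (wsizeM _ _) _; rewrite addnC leq_add.
Qed.

Lemma near_mono c d u v : (c <= d)%N -> near c u v -> near d u v.
Proof. by move=> cd uv; exact: leq_trans cd. Qed.

Lemma near_size c u v : near c u v -> (wsize v <= wsize u + c)%N.
Proof.
move=> uv; rewrite -[v](mulgVK u); apply: leq_trans (wsizeM _ _) _.
by rewrite addnC leq_add2l.
Qed.

Lemma near1 c u : (wsize u <= c)%N -> near c 1%g u.
Proof. by rewrite /near invg1 mulg1. Qed.

Lemma near_letters c l u v : (size l <= c)%N -> val v = foldr push (val u) l ->
  near c u v.
Proof.
move=> lc vE; pose L : free_group A :=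
  exist (fun s => is_true (reduced s)) _ (@foldr_push_reduced A l [::] isT).
have -> : v = (L * u)%g by apply: val_inj; rewrite vE /= foldr_push_cat//; exact: (valP u).
rewrite /near mulgK; apply: leq_trans lc; apply: leq_trans (size_foldr_push _ _) _.
by rewrite addn0.
Qed.

Lemma push_suffix t a s : suffix t (push a s) -> ~~ suffix t s -> push a s = t.
Proof.
move=> /suffixP[[|x r] E] nt; first by [].
case/negP: nt; case: s E => [|b s] /=.
  by case: r t => [|? ?] [|? ?] //= _; exact: suffix0s.
case: ifP => _ E; last by case: E => _ ->; exact: suffix_suffix.
by apply/suffixP; exists (b :: x :: r); rewrite E.
Qed.

(** When t becomes a suffix for the last time, the word is t itself, so only the letters pushed
    afterwards matter. *)
Lemma foldr_push_suffix t l s : suffix t (foldr push s l) -> ~~ suffix t s ->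
  exists2 l', (size l' <= size l)%N & foldr push s l = foldr push t l'.
Proof.
elim: l => /= [-> //|a l IH] tl nt.
have [tl'|ntl] := boolP (suffix t (foldr push s l)).
  by have [l' l'l ->] := IH tl' nt; exists (a :: l').
by exists [::] => //=; exact: push_suffix.
Qed.

(* The words with suffix w can only be entered through w itself. *)
Lemma near_branch c u v w : near c u v -> suffix (val w) (val v) ->
  ~~ suffix (val w) (val u) -> near c w v.
Proof.
move=> uv wv wu; have vE : val v = foldr push (val u) (val (v * u^-1)%g).
  by rewrite -{1}[v](mulgVK u).
have [l lc El] : exists2 l, (size l <= size (val (v * u^-1)%g))%N &
    val v = foldr push (val w) l.
  by rewrite {1}vE; apply: foldr_push_suffix; rewrite -?vE.
by apply: near_letters El; exact: leq_trans lc uv.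
Qed.

Lemma near_branch_size c u v w : near c u v -> suffix (val w) (val v) ->
  ~~ suffix (val w) (val u) -> (wsize v <= wsize w + c)%N.
Proof. by move=> uv wv wu; apply: near_size; exact: near_branch uv wv wu. Qed.

Lemma near_cons u v a : val v = a :: val u -> near 1 u v.
Proof.
move=> E; apply: (near_letters (l := [:: a])) => //=.
by rewrite E push_id// -E; exact: (valP v).
Qed.

Lemma reduced_drop m u : reduced (drop m (val u)).
Proof. exact: drop_sorted (valP u). Qed.

(** The point at distance k from the root on the way to u; it is u itself when u is shorter than
    k. *)
Definition ancestor k u : free_group A :=
  exist (fun s => is_true (reduced s)) _ (@reduced_drop (wsize u - k) u).

Lemma ancestor_suffix k u : suffix (val (ancestor k u)) (val u).
Proof. by rewrite /ancestor /=; apply/suffixP; exists (take (wsize u - k) (val u)); rewrite cat_take_drop. Qed.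

Lemma wsize_ancestor k u : (k <= wsize u)%N -> wsize (ancestor k u) = k.
Proof. by move=> ku; rewrite /wsize /= size_drop subKn. Qed.

Lemma branch_ind (P : free_group A -> Prop) w :
  P w -> (forall u v a, suffix (val w) (val u) -> val v = a :: val u -> P u -> P v) ->
  forall u, suffix (val w) (val u) -> P u.
Proof.
move=> Pw IH u /suffixP[r]; elim: r u => [|a r IHr] u uE.
  by have -> : u = w by apply: val_inj.
have ru : reduced (r ++ val w) by have := valP u; rewrite uE => /reduced_cons.
pose u' : free_group A := exist (fun s => is_true (reduced s)) _ ru.
by apply: (IH u' u a) => //; [exact: suffix_suffix|exact: IHr].
Qed.

End Words.

(** Rank at least 2 enters here: there are at least four letters. *)
Lemma letter_avoid n (a b c : @letter 'I_n) : (2 <= n)%N ->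
  exists d, [/\ d != a, d != b & d != c].
Proof.
move=> n2; apply: contrapT => H.
have : (#|{: @letter 'I_n}| <= size [:: a; b; c])%N.
  apply: leq_trans (card_size _); apply: subset_leq_card; apply/fintype.subsetP => d _.
  rewrite !inE; apply: contraT => /norP[da /norP[db dc]]; case: H.
  by exists d.
by rewrite card_prod card_ord card_bool /=; lia.
Qed.

Lemma long_word n k (a b : @letter 'I_n) : b != letter_inv a ->
  exists u : free_group 'I_n, suffix [:: b; a] (val u) /\ (k <= wsize u)%N.
Proof.
move=> ba; have r : reduced (nseq k b ++ [:: b; a]).
  have nb : b != letter_inv b by case: b {ba} => x []; rewrite /letter_inv xpair_eqE /= andbF.
  have ab : a != letter_inv b by apply: contraNneq ba => ->; rewrite letter_invK.
  by rewrite /reduced; elim: k => [|[|k] IH] //=; rewrite ?nb ?ab// -[path _ _ _]/(sorted _ (nseq k.+1 b ++ [:: b; a])).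
exists (exist (fun s => is_true (reduced s)) _ r); split; first exact: suffix_suffix.
by rewrite /wsize /= size_cat size_nseq leq_addr.
Qed.

Section FreeWordNorm.
Context {R : realType} {n : nat}.
Implicit Types (g : free_group 'I_n).

Lemma free_gens_size (a : free_group 'I_n) :
  (a \in free_gens n) || ((a^-1)%g \in free_gens n) -> wsize a = 1%N.
Proof.
case/orP => /mapP[i _ E]; first by rewrite E.
by rewrite -wsizeV E.
Qed.

Lemma size_free_word (w : seq (free_group 'I_n)) :
  word (free_gens n) w -> (wsize (\prod_(a <- w) a)%g <= size w)%N.
Proof.
elim: w => [|a w IH]; first by rewrite big_nil.
move=> /= /andP[/free_gens_size a1 /IH H]; rewrite big_cons.
by apply: leq_trans (wsizeM _ _) _; rewrite a1 add1n ltnS.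
Qed.

Lemma free_word_ex g : exists w, [/\ word (free_gens n) w,
  (\prod_(a <- w) a)%g = g & size w = wsize g].
Proof.
case: g => s; elim: s => [|[i b] s IH] rs.
  by exists [::]; split=> //; rewrite big_nil; exact: val_inj.
have [w [ww wE sw]] := IH (reduced_cons rs).
pose x : free_group 'I_n := if b then free_gen i else ((free_gen i)^-1)%g.
have xE : val x = [:: (i, b)] by rewrite /x; case: (b).
exists (x :: w); split; last by rewrite /= sw.
  rewrite /= ww andbT /x; have gi : free_gen i \in free_gens n.
    by apply: map_f; rewrite mem_enum.
  by case: (b); rewrite ?gi// invgK gi orbT.
rewrite big_cons wE; apply: val_inj; rewrite /= xE /=.
exact: push_id rs.
Qed.

Lemma word_norm_free g : word_norm (R := R) (free_gens n) g = (wsize g)%:R%R.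
Proof.
have [w [ww wE sw]] := free_word_ex g.
apply/eqP; rewrite eq_le; apply/andP; split.
  apply: ge_inf; first by exists 0%R => _ [w' _ <-]; exact: ler0n.
  by exists w => //; rewrite sw.
apply: lb_le_inf; first by exists (size w)%:R%R; exists w.
by move=> _ [w' [ww' <-] <-]; rewrite ler_nat; exact: size_free_word.
Qed.

End FreeWordNorm.

Lemma word_norm_word (R : realType) (H : groupType) (S : seq H) (g : H) (c : nat) :
  generates S -> (word_norm S g <= c%:R :> R)%R ->
  exists w, [/\ word S w, (\prod_(a <- w) a)%g = g & (size w <= c)%N].
Proof.
move=> gen gc; have [w ww wE] := gen g; apply: contrapT => nE.
suff : (c.+1%:R <= word_norm S g :> R)%R by move/le_trans/(_ gc); rewrite ler_nat ltnn.
apply: lb_le_inf; first by exists (size w)%:R%R; exists w.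
move=> _ [w' [ww' wE'] <-]; rewrite ler_nat ltnNge; apply/negP => wc.
by apply: nE; exists w'.
Qed.

Lemma finite_word_ball (R : realType) (H : groupType) (S : seq H) (c : nat) :
  generates S -> finite_set [set g | (word_norm S g <= c%:R :> R)%R].
Proof.
move=> gen; pose T := S ++ [seq (a^-1)%g | a <- S].
suff fin k : finite_set [set g | exists w, [/\ word S w, (\prod_(a <- w) a)%g = g &
    (size w <= k)%N]].
  by apply: sub_finite_set (fin c) => g; exact: word_norm_word.
elim: k => [|k IH].
  apply: sub_finite_set (finite_set1 1%g) => g [w [_ <- /=]].
  by rewrite leqn0 size_eq0 => /eqP ->; rewrite big_nil.
apply: (@sub_finite_set _ _ ([set 1%g] `|` \bigcup_(a in [set` T])
   ((fun x => a * x)%g @` [set g | exists w, [/\ word S w, (\prod_(a <- w) a)%g = g &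
    (size w <= k)%N]]))); last first.
  rewrite finite_setU; split; first exact: finite_set1.
  apply: bigcup_finite => [|a _]; first exact: finite_seq.
  exact: finite_image.
move=> g [[|a w] [ww <- wk]]; first by left; rewrite big_nil.
right; move: ww => /= /andP[aS ww]; exists a => /=.
  rewrite /T mem_cat; case/orP: aS => [->//|aS]; apply/orP; right.
  by apply/mapP; exists (a^-1)%g => //; rewrite invgK.
by exists (\prod_(b <- w) b)%g; [exists w|rewrite big_cons].
Qed.

(** * Images and finite covers of ultrafilters *)

Lemma ultra_proper_dichotomy (T : Type) (F : set_system T) : ProperFilter F ->
  (forall A, F A \/ F (~` A)) -> UltraFilter F.
Proof.
move=> PF dF; split=> // H HF FH; apply/seteqP; split=> // A HA.
case: (dF A) => // /FH HnA; have [x [Ax]] := filter_ex (filterI HA HnA).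
by move=> /(_ Ax).
Qed.

Lemma ultra_pushforward (T U : Type) (f : T -> U) (F : set_system T) :
  UltraFilter F -> UltraFilter [set A | F (f @^-1` A)].
Proof.
move=> FU; apply: ultra_proper_dichotomy.
by move=> A; exact: (in_ultra_setVsetC (f @^-1` A) FU).
Qed.

Lemma ultra_finite_choice (T : Type) (I : choiceType) (F : set_system T)
    (D : set I) (A : I -> set T) : UltraFilter F -> finite_set D ->
  F (\bigcup_(i in D) A i) -> exists2 i, D i & F (A i).
Proof.
move=> FU fD FA; apply: contrapT => H.
have : F (\bigcap_(i in D) ~` A i).
  rewrite -[X in \bigcap_(_ in X) _](fset_setK fD); apply: filter_bigI => i.
  rewrite in_fset_set// inE => Di; case: (in_ultra_setVsetC (A i) FU) => // FAi.
  by case: H; exists i.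
by move=> /(filterI FA)/filter_ex[x [[i Di Aix] /(_ i Di)]].
Qed.

(** * Automorphisms preserve the optimal cuts *)

Section Invariance.
Variables (V : choiceType) (e : V -> V -> Prop) (K : nat).

Definition automorphism_pair (h k : V -> V) : Prop :=
  [/\ cancel h k, cancel k h, forall x y, e x y -> e (h x) (h y) &
      forall x y, e x y -> e (k x) (k y)].

Lemma automorphism_pair_sym h k : automorphism_pair h k -> automorphism_pair k h.
Proof. by case. Qed.

Implicit Types (h k : V -> V) (C D : set V).

Lemma preimage_pairK h k C : automorphism_pair h k -> k @^-1` (h @^-1` C) = C.
Proof. by move=> [_ kh _ _]; apply/funext => x; rewrite /preimage /= kh. Qed.

Lemma coboundary_preimage h k C : automorphism_pair h k ->
  coboundary e (h @^-1` C) = (fun z => (k z.1, k z.2)) @` coboundary e C.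
Proof.
move=> [hk kh he ke]; apply/seteqP; split=> [[x y] [/= Cx Cy xy]|].
  by exists (h x, h y); [split=> //=; exact: he|rewrite /= !hk].
by move=> _ [[x y] [/= Cx Cy xy] <-]; split; rewrite /preimage /= ?kh//; exact: ke.
Qed.

Lemma cut_preimage h k C : automorphism_pair h k -> cut e C -> cut e (h @^-1` C).
Proof. by move=> hk fC; rewrite /cut (coboundary_preimage _ hk); exact: finite_image. Qed.

Lemma cut_size_preimage h k C : automorphism_pair h k -> cut e C ->
  cut_size e (h @^-1` C) = cut_size e C.
Proof.
move=> hk fC; rewrite /cut_size (coboundary_preimage _ hk) fcard_inj//.
by case: hk => _ kh _ _ [a b] [c d] [/(can_inj kh) -> /(can_inj kh) ->].
Qed.

(** The ultrafilters are pushed forward along k, because the preimage of C under h is its image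
    under k. *)
Lemma minimal_preimage h k p q C : automorphism_pair h k -> minimal e K p q C ->
  minimal e K [set A | p (k @^-1` A)] [set A | q (k @^-1` A)] (h @^-1` C).
Proof.
move=> hk [fC sC CK minC]; split.
- exact: cut_preimage hk fC.
- by rewrite /splits/= !(preimage_pairK _ hk).
- by rewrite (cut_size_preimage hk).
- move=> D fD sD; rewrite (cut_size_preimage hk)//.
  rewrite -(cut_size_preimage (automorphism_pair_sym hk) fD).
  by apply: minC => //; exact: cut_preimage (automorphism_pair_sym hk) fD.
Qed.

Lemma minimal_cut_preimage h k C : automorphism_pair h k -> minimal_cut e K C ->
  minimal_cut e K (h @^-1` C).
Proof.
move=> hk [p [q [pU qU mC]]].
exists [set A | p (k @^-1` A)], [set A | q (k @^-1` A)].
by split; [exact: ultra_pushforward|exact: ultra_pushforward|exact: minimal_preimage].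
Qed.

Lemma nested_preimage h C D : nested C D -> nested (h @^-1` C) (h @^-1` D).
Proof.
by case=> H; [apply: Or41|apply: Or42|apply: Or43|apply: Or44] => x; exact: H.
Qed.

Arguments nested_preimage h [C D].

Lemma crossers_preimage h k C : automorphism_pair h k ->
  crossers e K (h @^-1` C) = (fun X => h @^-1` X) @` crossers e K C.
Proof.
move=> hk; have kh := automorphism_pair_sym hk.
apply/seteqP; split=> [X [mX nX]|_ [X [mX nX] <-]]; last first.
  split; first exact: minimal_cut_preimage hk mX.
  by move=> /(nested_preimage k); rewrite !(preimage_pairK _ hk).
exists (k @^-1` X); last by rewrite (preimage_pairK _ kh).
split; first exact: minimal_cut_preimage kh mX.
by move=> /(nested_preimage h); rewrite (preimage_pairK _ kh).
Qed.

Lemma crossers_card_preimage h k C : automorphism_pair h k ->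
  finite_set (crossers e K C) ->
  fcard (crossers e K (h @^-1` C)) = fcard (crossers e K C).
Proof.
move=> hk fC; rewrite (crossers_preimage _ hk) fcard_inj// => X Y.
by move=> /(congr1 (fun Z => k @^-1` Z)); rewrite !(preimage_pairK _ hk).
Qed.

Hypothesis esym : forall x y, e x y -> e y x.
Hypothesis econn : connected_in e setT.

Lemma optimal_cut_preimage h k C : automorphism_pair h k -> optimal_cut e K C ->
  optimal_cut e K (h @^-1` C).
Proof.
move=> hk [p [q [pU qU [mC oC]]]]; have kh := automorphism_pair_sym hk.
have fX D p' q' : UltraFilter p' -> UltraFilter q' -> minimal e K p' q' D ->
    finite_set (crossers e K D).
  move=> p'U q'U mD; have m : minimal_cut e K D by exists p', q'.
  apply: finite_crossers => //; first exact: minimal_cut_cut m.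
  exact: minimal_cut_tight m.
have pU' := ultra_pushforward k pU; have qU' := ultra_pushforward k qU.
exists [set A | p (k @^-1` A)], [set A | q (k @^-1` A)]; split=> //.
split; first exact: minimal_preimage.
move=> D mD; rewrite (crossers_card_preimage hk); last exact: fX mC.
rewrite -(crossers_card_preimage kh (fX _ _ _ pU' qU' mD)).
apply: oC; have := minimal_preimage kh mD.
by congr minimal; apply/funext => A /=; rewrite (preimage_pairK _ hk).
Qed.

End Invariance.

(** * Graphs coarsely equivalent to a free group *)

Lemma finite_uniform_bound (T : Type) (F : set T) (Q : T -> nat -> Prop) :
  finite_set F -> (forall x c d, (c <= d)%N -> Q x c -> Q x d) ->
  (forall x, exists c, Q x c) -> exists c, forall x, F x -> Q x c.
Proof.
move=> fF mono ex; have [f Hf] := choice (fun x : {classic T} => ex x).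
have fF' : finite_set (F : set {classic T}) by [].
exists (\max_(x <- fset_set (F : set {classic T})) f x)%N => x Fx.
apply: mono (Hf x); apply: (leq_bigmax_seq (P := xpredT)) => //.
by rewrite in_fset_set// inE.
Qed.

Section TreeLike.
Variables (n : nat) (G : groupType) (V : choiceType) (act : G -> V -> V).
Variables (e : V -> V -> Prop) (x0 : V) (phi : V -> free_group 'I_n).
Hypothesis n2 : (2 <= n)%N.
Hypothesis act1 : forall x, act 1%g x = x.
Hypothesis actM : forall g h x, act (g * h)%g x = act g (act h x).
Hypothesis act_trans : forall x, exists g, act g x0 = x.
Hypothesis esym : forall x y, e x y -> e y x.
Hypothesis econn : connected_in e setT.
Hypothesis einv : forall g x y, e x y -> e (act g x) (act g y).
Variables (c0 c1 : nat).
Hypothesis phi_edge : forall x y, e x y -> near c1 (phi x) (phi y).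
Hypothesis phi_proper : forall c, exists2 B : set V, finite_set B &
  forall g x, near c (phi (act g x0)) (phi x) -> B (act g^-1%g x).
Hypothesis phi_onto : forall w, exists x, near c0 (phi x) w.

Let actK g x : act g^-1%g (act g x) = x.
Proof. by rewrite -actM mulVg act1. Qed.

Let actVK g x : act g (act g^-1%g x) = x.
Proof. by rewrite -actM mulgV act1. Qed.

Lemma act_pair g : automorphism_pair e (act g) (act g^-1%g).
Proof. by split; [exact: actK|exact: actVK|exact: einv|exact: einv]. Qed.

Lemma finite_ball c : finite_set [set x | (wsize (phi x) <= c)%N].
Proof.
have [B fB HB] := phi_proper (wsize (phi x0) + c).
apply: sub_finite_set fB => x xc.
have := HB 1%g x; rewrite invg1 !act1; apply.
apply: (@near_trans _ _ _ 1%g).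
- by apply: near_sym; exact: near1.
- exact: near1.
Qed.

Lemma phi_edge_finite : finite_set [set y | e x0 y].
Proof.
have [B fB HB] := phi_proper c1; apply: sub_finite_set fB => x xx0.
by have := HB 1%g x; rewrite invg1 !act1; apply; exact: phi_edge.
Qed.

(** The vertices admitting a constant uniform in g contain x0 and are closed under edges, as edges
    are invariant and [phi] distorts them boundedly. *)
Lemma phi_displacement (S : set V) : finite_set S ->
  exists c, forall s, S s -> forall g, near c (phi (act g x0)) (phi (act g s)).
Proof.
move=> fS; pose Q x c := forall g, near c (phi (act g x0)) (phi (act g x)).
apply: (@finite_uniform_bound _ S Q fS) => [x c d cd H g|x].
  exact: near_mono cd (H g).
apply: contrapT => nx; have [||u [v] [_ _ [/= [c Hc] nv uv]]] := econn (P := fun x => exists c, Q x c).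
- by exists x0 => //; exists 0%N => g; exact: near_refl.
- by exists x.
apply: nv; exists (c + c1)%N => g; apply: near_trans (Hc g) _.
by apply: phi_edge; exact: einv.
Qed.

Definition branch_set (w : free_group 'I_n) : set V :=
  [set x | suffix (val w) (val (phi x))].

(** An edge leaving the half-tree of w has both ends over points close to w. Translating a vertex
    over w back to x0 moves all these ends into one finite set, whatever w is. *)
Lemma branch_coboundary : exists2 B : set V, finite_set B & forall w, exists g,
  near c0 (phi (act g x0)) w /\
  coboundary e (act g @^-1` branch_set w) `<=` B `*` B.
Proof.
(* c0 leads to w, the first c1 to the inner end of a boundary edge, the second to its outer end. *)
have [B fB HB] := phi_proper (c0 + (c1 + c1)); exists B => // w.
have [x xw] := phi_onto w; have [g gx] := act_trans x; exists g.
rewrite gx; split=> // -[u v] [/= gu /negP gv uv].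
have guv := einv g uv.
have wu : near c1 w (phi (act g u)).
  apply: near_branch gu gv; apply: near_sym; exact: phi_edge.
split; rewrite /= -[X in B X](actK g); apply: HB; rewrite gx.
  apply: near_trans xw _; exact: near_mono (leq_addr _ _) wu.
apply: near_trans xw _; apply: near_trans wu _; exact: phi_edge.
Qed.

Definition branch_basin := projT1 (cid2 branch_coboundary).

Let K := fcard (branch_basin `*` branch_basin).

Lemma finite_branch_basin : finite_set branch_basin.
Proof. by rewrite /branch_basin; case: cid2. Qed.

Lemma branch_basinP w : exists g, near c0 (phi (act g x0)) w /\
  coboundary e (act g @^-1` branch_set w) `<=` branch_basin `*` branch_basin.
Proof. by rewrite /branch_basin; case: cid2. Qed.

Lemma finite_basin2 : finite_set (branch_basin `*` branch_basin).
Proof. by apply: finite_setX; exact: finite_branch_basin. Qed.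

Lemma basin_cut C : coboundary e C `<=` branch_basin `*` branch_basin ->
  cut e C /\ (cut_size e C <= K)%N.
Proof.
move=> CB; split; first exact: sub_finite_set CB finite_basin2.
exact: fcard_sub finite_basin2 CB.
Qed.

Lemma branch_cut w : cut e (branch_set w) /\ (cut_size e (branch_set w) <= K)%N.
Proof.
have [g [_ /basin_cut[fC CK]]] := branch_basinP w.
have gp := automorphism_pair_sym (act_pair g).
rewrite -(preimage_pairK (branch_set w) (act_pair g)).
by split; [exact: cut_preimage gp fC|rewrite (cut_size_preimage gp)].
Qed.

Definition tree_cuts : set (set V) := optimal_cut e K.

Lemma tree_cuts_minimal C : tree_cuts C -> minimal_cut e K C.
Proof. by move=> [p [q [pU qU oC]]]; exact: optimal_minimal_cut oC. Qed.

Lemma tree_cutsC C : tree_cuts C -> tree_cuts (~` C).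
Proof.
by move=> [p [q [pU qU oC]]]; exists p, q; split=> //; exact: optimalC.
Qed.

Lemma tree_cuts_act g C : tree_cuts C -> tree_cuts (act g @^-1` C).
Proof. exact: optimal_cut_preimage (act_pair g). Qed.

Lemma tree_cuts_neq0 C : tree_cuts C -> C !=set0.
Proof. by move=> [p [q [pU qU [[_ /(splits_ex pU qU)[]]]]]]. Qed.

Lemma tree_cuts_finite x y : finite_set [set C | tree_cuts C /\ C x /\ ~ C y].
Proof.
apply: sub_finite_set (finite_separating K esym econn x y) => C [/tree_cuts_minimal].
by [].
Qed.

(** The given cut only certifies that the least size is at most K; the optimal cut is complemented
    if it faces q. *)
Lemma tree_cuts_separate C p q : UltraFilter p -> UltraFilter q ->
  cut e C -> (cut_size e C <= K)%N -> p C -> q (~` C) ->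
  exists D, [/\ tree_cuts D, p D & q (~` D)].
Proof.
move=> pU qU fC CK pC qC; have sC : splits C p q.
  have := ultra_setC C qU; rewrite /splits (asboolT pC) (asboolT qC).
  by case: `[< q C >].
have [D oD] := exists_optimal pU qU fC sC CK.
have tD : tree_cuts D by exists p, q.
have := oD.1; case=> _ sD _ _.
have [pD|npD] := pselect (p D).
  exists D; split=> //; move: sD; rewrite /splits (asboolT pD) => nq.
  by apply/asboolP; rewrite ultra_setC//; move: nq; case: `[< q D >].
exists (~` D); rewrite setCK; split; first exact: tree_cutsC.
  by apply/asboolP; rewrite ultra_setC//; apply/asboolPn.
by apply/asboolP; move: sD; rewrite /splits (asboolF npD); case: `[< q D >].
Qed.

Lemma ancestor_exists k (u : free_group 'I_n) : (k <= wsize u)%N ->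
  exists w, wsize w = k /\ suffix (val w) (val u).
Proof.
by move=> ku; exists (ancestor k u); split; [exact: wsize_ancestor|exact: ancestor_suffix].
Qed.

Lemma not_suffix_size (u w : free_group 'I_n) :
  (wsize u < wsize w)%N -> ~~ suffix (val w) (val u).
Proof.
by move=> uw; apply: contraTN uw => /size_suffix; rewrite /wsize -leqNgt.
Qed.

Let tree_separated := separated tree_cuts e.

(* If infinitely many vertices were inseparable from x0, recentring them at the
   middle of the tree geodesic would produce a pair of ultrafilters split by a
   small cut, hence by a cut of the tree. *)
Lemma tree_nonseparated : finite_set [set y | ~ tree_separated x0 y].
Proof.
apply: contrapT => infinite_ns.
pose F := branch_basin `*` branch_basin.
pose Q (S : set V) : set (V * V) := [set z | [/\ ~ tree_separated z.1 z.2,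
  ~ S z.1, ~ S z.2 & exists2 C, coboundary e C `<=` F & ~ C z.1 /\ C z.2]].
have Q0 S : finite_set S -> Q S !=set0.
  move=> fS; have [cS HS] := phi_displacement fS.
  (* A word w of length M on the way to y has x0 outside its half-tree, and both x0 and y are too
     far from w to land in S after recentring. *)
  pose M := (wsize (phi x0) + c0 + cS).+1.
  have [y [nsy yM]] : exists y, ~ tree_separated x0 y /\ (M + c0 + cS < wsize (phi y))%N.
    apply: contrapT => H; apply: infinite_ns.
    apply: sub_finite_set (finite_ball (M + c0 + cS)) => y nsy /=.
    by rewrite leqNgt; apply/negP => My; apply: H; exists y.
  have [|w [wM wy]] := @ancestor_exists M (phi y); first by lia.
  have [g [gw gF]] := branch_basinP w.
  exists (act g^-1%g x0, act g^-1%g y); split=> /=.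
  - move=> /(separated_act act1 actM einv tree_cuts_act g).
    by rewrite !actVK.
  - move=> /HS/(_ g); rewrite actVK => gx.
    have := near_size (near_trans (near_sym gx) gw); lia.
  - move=> /HS/(_ g); rewrite actVK => gy.
    have := near_size (near_trans (near_sym gw) gy); lia.
  - exists (act g @^-1` branch_set w) => //; rewrite /preimage /= !actVK.
    split=> //; apply/negP; apply: not_suffix_size; lia.
pose Fl := filter_from (@finite_set V) Q.
have PF : ProperFilter Fl.
  apply: filter_from_proper => //; apply: filter_from_filter.
    by exists set0; exact: finite_set0.
  move=> S1 S2 f1 f2; exists (S1 `|` S2); first by rewrite finite_setU.
  move=> z [ns n1 n2' exC]; split; split=> // Sz.
  - by apply: n1; left.
  - by apply: n2'; left.
  - by apply: n1; right.
  - by apply: n2'; right.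
have [W [WU FlW]] := ultraFilterLemma PF.
have WQ S : finite_set S -> W (Q S) by move=> fS; apply: FlW; exists S.
(* Only finitely many cuts have their coboundary inside F, so a single one splits almost all
   pairs. *)
have [C CF WC] : exists2 C, coboundary e C `<=` F & W [set z | ~ C z.1 /\ C z.2].
  apply: (ultra_finite_choice WU); first exact: (finite_coboundary_in esym econn finite_basin2).
  apply: filterS (WQ set0 (@finite_set0 _)) => z [_ _ _ [C CF Cz]].
  by exists C.
have [fC CK] := basin_cut CF.
have pU := ultra_pushforward fst WU; have qU := ultra_pushforward snd WU.
have [D [tD pD qD]] : exists D, [/\ tree_cuts D, W [set z | D z.2] & W [set z | ~ D z.1]].
  have W2 : W (snd @^-1` C) by apply: filterS WC => z [].
  have W1 : W (fst @^-1` (~` C)) by apply: filterS WC => z [].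
  exact: (tree_cuts_separate qU pU fC CK W2 W1).
have fD : finite_set (coboundary e D).
  by apply: minimal_cut_cut; exact: tree_cuts_minimal.
(* For a pair avoiding the endpoints of the coboundary of D, no edge at either vertex crosses D:
   this supplies the margin in [separated]. *)
pose S := fst @` coboundary e D `|` snd @` coboundary e D.
have fS : finite_set S by rewrite finite_setU; split; exact: finite_image.
have [[x y] [/= Dy [nDx [/= ns nSx nSy _]]]] :=
  filter_ex (filterI pD (filterI qD (WQ S fS))).
apply: ns; exists (~` D); split; first exact: tree_cutsC.
- split=> // x' xx' Dx'; apply: nSx; right; exists (x', x) => //; split=> //.
  exact: esym.
- split=> [/(_ Dy)//|y' yy' nDy']; apply: nSy; left; exists (y, y') => //.
Qed.

Lemma branch_unbounded (a : @letter 'I_n) (S : set V) : finite_set S ->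
  branch_set (exist (fun s => is_true (reduced s)) [:: a] isT) `\` S !=set0.
Proof.
move=> fS; set w := exist _ _ _.
have [cS HS] : exists c, forall s, S s -> (wsize (phi s) <= c)%N.
  apply: finite_uniform_bound => // [x c d cd H|x]; first exact: leq_trans cd.
  by exists (wsize (phi x)).
have [b [ba _ _]] := letter_avoid (letter_inv a) a a n2.
have [u [su ku]] := long_word (cS + c0 + 2) ba.
have [x xu] := phi_onto u; exists x; split.
  apply: contraT => /negP nx; have wu : suffix (val w) (val u).
    by apply: suffix_trans su; exact: suffix_cons.
  by have := near_branch_size xu wu (introN idP nx); rewrite {2}/wsize /=; lia.
by move=> /HS; have := near_size xu; lia.
Qed.

(** Three distinct letters give disjoint unbounded half-trees. Each carries an ultrafilter avoiding
    finite sets, and half-trees are cuts of size at most K, so tree cuts separate these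
    ultrafilters. *)
Lemma tree_three_ends : exists p : 'I_3 -> set_system V,
  [/\ forall i, UltraFilter (p i),
      forall i (F : set V), finite_set F -> ~ p i F &
      forall i j, i <> j -> exists D, [/\ tree_cuts D, p i D & ~ p j D]].
Proof.
have l3 : (3 <= #|{: @letter 'I_n}|)%N by rewrite card_prod card_ord card_bool; lia.
pose a (i : 'I_3) : @letter 'I_n := enum_val (widen_ord l3 i).
have a_inj : injective a by move=> i j /enum_val_inj/(congr1 val)/= /val_inj.
pose w (i : 'I_3) : free_group 'I_n := exist (fun s => is_true (reduced s)) [:: a i] isT.
pose A i := branch_set (w i).
have ex i : exists p : set_system V, [/\ UltraFilter p, p (A i) &
    forall F, finite_set F -> p (~` F)].
  have PF : ProperFilter (filter_from (@finite_set V) (fun S => A i `\` S)).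
    apply: filter_from_proper => [|S fS]; last exact: branch_unbounded.
    apply: filter_from_filter; first by exists set0; exact: finite_set0.
    move=> S1 S2 f1 f2; exists (S1 `|` S2); first by rewrite finite_setU.
    by move=> z [Az nS]; split; split=> // Sz; apply: nS; [left|right].
  have [p [pU Fp]] := ultraFilterLemma PF; exists p; split=> // [|F fF]; apply: Fp.
    by exists set0; [exact: finite_set0|move=> x []].
  by exists F => // x [].
have [p Hp] := choice ex; exists p; have pU i : UltraFilter (p i) by case: (Hp i).
split=> // [i F fF pF|i j ij].
  have [_ _ H] := Hp i; have [x []] := filter_ex (filterI pF (H F fF)).
  by [].
have [fA AK] := branch_cut (w i); have [_ pA _] := Hp i; have [_ pA' _] := Hp j.
have [|D [tD pD qD]] := tree_cuts_separate (pU i) (pU j) fA AK pA.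
  apply: filterS pA' => x /suffixP[r E] /suffixP[r'].
  by rewrite E !cats1 => /rcons_inj[_ /a_inj ji]; apply: ij.
exists D; split=> // pjD; have [x [Dx]] := filter_ex (filterI pjD qD).
by apply.
Qed.

Theorem tree_like_action : exists (T : tree) (ta : G -> vertex T -> vertex T),
  [/\ forall v, ta 1%g v = v,
      forall g h v, ta (g * h)%g v = ta g (ta h v),
      forall g u v, edge u v -> edge (ta g u) (ta g v),
      bounded_valence T &
  [/\ forall v, exists2 F : set V, finite_set F &
        forall g, (forall x, F x -> act g x = x) -> ta g v = v,
      forall u v, exists2 F : set V, finite_set F &
        forall g, ta g u = v -> exists2 x, F x & F (act g x),
      exists2 S : set (vertex T), finite_set S & forall v, exists g, S (ta g v) &
      exists v : vertex T, branching_vertex v]].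
Proof.
have [p [pU p_free p_split]] := tree_three_ends.
apply: (@structure_tree_action V tree_cuts tree_cutsC _ tree_cuts_neq0
  tree_cuts_finite (ex_intro _ x0 I) G act e x0 act1 actM act_trans esym econn
  einv phi_edge_finite tree_cuts_act _ _ tree_nonseparated p pU p_free p_split).
- by move=> C D; exact: optimal_cut_nested.
- have [|D [tD _ _]] := p_split ord0 ord_max; first by move=> /(congr1 val).
  by exists D.
- by move=> C /tree_cuts_minimal/minimal_cut_cut.
Qed.

End TreeLike.

(** * Locally compact groups with a cocompact lattice *)

Lemma compact_finite_nbhs (X : topologicalType) (K : set X) (N : X -> set X) :
  compact K -> (forall x, K x -> nbhs x (N x)) ->
  exists2 S : set X, finite_set S /\ S `<=` K & K `<=` \bigcup_(x in S) N x.
Proof.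
move=> cK KN; apply: contrapT => H.
pose F := filter_from [set S | finite_set S /\ S `<=` K]
  (fun S => K `\` \bigcup_(x in S) N x).
have PF : ProperFilter F.
  apply: filter_from_proper => [|S fS].
    apply: filter_from_filter; first by exists set0; split=> //; exact: finite_set0.
    move=> S1 S2 [f1 s1] [f2 s2]; exists (S1 `|` S2).
      by rewrite /= finite_setU subUset.
    by move=> x [Kx nx]; split; split=> // -[y Sy Ny]; apply: nx; exists y => //;
      [left|right].
  apply: contrapT => nE; apply: H; exists S => // x Kx.
  by apply: contrapT => nx; apply: nE; exists x.
have FK : F K by exists set0; [split=> //; exact: finite_set0|move=> x []].
have [x [Kx clx]] := cK F PF FK.
have FNx : F (K `\` \bigcup_(y in [set x]) N y).
  by exists [set x] => //; split; [exact: finite_set1|move=> _ ->].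
have [y [[_ ny] Ny]] := clx _ _ FNx (KN x Kx).
by apply: ny; exists x.
Qed.

Section TopologicalGroup.
Variable G : topologicalGroupType.
Implicit Types (g h x y : G) (A B K : set G).

Lemma cvg_mulg (T : Type) (F : set_system T) (f h : T -> G) x y : Filter F ->
  f @ F --> x -> h @ F --> y -> (fun t => (f t * h t)%g) @ F --> (x * y)%g.
Proof.
move=> FF fx hy; apply: (@cvg_comp _ _ _ (fun t => (f t, h t)) (fun z : G * G => (z.1 * z.2)%g)
  F (nbhs (x, y)) (nbhs (x * y)%g)).
  exact: cvg_pair.
exact: (@mulg_continuous G (x, y)).
Qed.

Lemma cvg_invg (T : Type) (F : set_system T) (f : T -> G) x : Filter F ->
  f @ F --> x -> (fun t => (f t)^-1%g) @ F --> (x^-1)%g.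
Proof.
move=> FF fx; apply: (@cvg_comp _ _ _ f (fun z : G => (z^-1)%g) F (nbhs x)) => //.
exact: invg_continuous.
Qed.

Lemma continuous_mull g : continuous (fun x : G => (g * x)%g).
Proof. by move=> x; apply: cvg_mulg; [exact: cvg_cst|exact: cvg_id]. Qed.

Lemma continuous_mulr g : continuous (fun x : G => (x * g)%g).
Proof. by move=> x; apply: cvg_mulg; [exact: cvg_id|exact: cvg_cst]. Qed.

Definition mul_set A B : set G := [set (x * y)%g | x in A & y in B].

Lemma compact_mul A B : compact A -> compact B -> compact (mul_set A B).
Proof.
move=> cA cB; have -> : mul_set A B = (fun z => (z.1 * z.2)%g) @` (A `*` B).
  apply/seteqP; split=> [_ [x Ax [y By <-]]|_ [[x y] [Ax By] <-]]; first by exists (x, y).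
  by exists x => //; exists y.
apply: continuous_compact; last exact: compact_setX.
by apply: continuous_subspaceT; exact: mulg_continuous.
Qed.

Lemma compact_inv A : compact A -> compact [set (x^-1)%g | x in A].
Proof.
move=> cA; apply: continuous_compact => //.
by apply: continuous_subspaceT; exact: invg_continuous.
Qed.

Lemma nbhs_mull g x A : nbhs x A -> nbhs (g * x)%g [set y | A (g^-1 * y)%g].
Proof.
move=> xA; apply: (@continuous_mull (g^-1)%g (g * x)%g).
by rewrite mulKg.
Qed.

Definition bounded A : Prop := exists2 K, compact K & A `<=` K.

Lemma bounded_sub A B : A `<=` B -> bounded B -> bounded A.
Proof. by move=> AB [K cK BK]; exists K => // x /AB/BK. Qed.

Lemma bounded_mul A B : bounded A -> bounded B -> bounded (mul_set A B).
Proof.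
move=> [K cK AK] [L cL BL]; exists (mul_set K L); first exact: compact_mul.
by move=> _ [x /AK Kx [y /BL Ly <-]]; exists x => //; exists y.
Qed.

Lemma bounded_inv A : bounded A -> bounded [set (x^-1)%g | x in A].
Proof.
move=> [K cK AK]; exists [set (x^-1)%g | x in K]; first exact: compact_inv.
by move=> _ [x /AK Kx <-]; exists x.
Qed.

Lemma bounded_finite A : finite_set A -> bounded A.
Proof. by move=> fA; exists A => //; exact: finite_compact. Qed.

Lemma bounded_compact A : compact A -> bounded A.
Proof. by move=> cA; exists A. Qed.

Lemma bounded_setU A B : bounded A -> bounded B -> bounded (A `|` B).
Proof.
move=> [K cK AK] [L cL BL]; exists (K `|` L); first exact: compactU.
by move=> x [/AK|/BL]; [left|right].
Qed.

Lemma compact_nbhs1 : locally_compact [set: G] ->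
  exists2 K : set G, compact K & nbhs (1%g : G) K.
Proof.
move=> /(_ 1%g I)[U U1 [cU _]]; exists U => //.
by have := U1; rewrite /within /=; apply: filterS => x; exact.
Qed.

Lemma nbhs1_div A : nbhs (1%g : G) A ->
  exists2 B, nbhs (1%g : G) B & forall x y, B x -> B y -> A (x^-1 * y)%g.
Proof.
move=> A1.
have : (fun z : G * G => (z.1^-1 * z.2)%g) @ nbhs ((1%g : G), (1%g : G)) --> (1^-1 * 1 : G)%g.
  apply: cvg_mulg; last exact: cvg_snd.
  by apply: cvg_invg; exact: cvg_fst.
rewrite invg1 mulg1 => /(_ A A1)[[B C] [/= B1 C1] BC].
exists (B `&` C); first exact: filterI.
by move=> x y [Bx _] [_ Cy]; exact: (BC (x, y)).
Qed.

(** A neighbourhood B of 1 is so small that each translate of B contains at most one element of S;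
    finitely many translates cover a compact set. *)
Lemma discrete_bounded_finite (S : groupClosed G) A : discrete_subgroup S ->
  bounded A -> finite_set [set x | x \in S /\ A x].
Proof.
move=> dS [K cK AK].
have [_ [W W1 WS]] := dS 1%g (gpred1 : 1%g \in S).
have [B B1 BW] := nbhs1_div W1.
have [F [fF _] KF] := @compact_finite_nbhs _ K (fun x => [set y | B (x^-1 * y)%g]) cK
  (fun x _ => ltac:(by have := nbhs_mull x B1; rewrite mulg1)).
apply: (@sub_finite_set _ _ (\bigcup_(x in F) [set y | y \in S /\ B (x^-1 * y)%g])).
  by move=> y [yS /AK/KF[x Fx Bxy]]; exists x.
apply: bigcup_finite => // x _.
have [[y [yS By]]|nE] := pselect ([set y | y \in S /\ B (x^-1 * y)%g] !=set0); last first.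
  by apply: sub_finite_set (@finite_set0 _) => y yS; apply: nE; exists y.
apply: sub_finite_set (finite_set1 y) => z [zS Bz].
have Wyz : W (y^-1 * z)%g.
  have -> : (y^-1 * z = (x^-1 * y)^-1 * (x^-1 * z))%g by rewrite invgM invgK mulgA mulgK.
  exact: BW.
have : (W `&` [set` S]) (y^-1 * z)%g.
  by split=> //=; apply: gpredM => //; rewrite gpredV.
by rewrite WS /= => /(congr1 (fun t => y * t)%g); rewrite mulVKg mulg1.
Qed.

(** Images of translates of a compact neighbourhood of 1 are neighbourhoods in the quotient; the
    union of finitely many translates meets every coset. *)
Lemma cocompact_cover (S : groupClosed G) : locally_compact [set: G] ->
  cocompact_subgroup S ->
  exists2 K, compact K & forall x, exists2 k, K k & (k^-1 * x)%g \in S.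
Proof.
move=> lcG cS; have [K0 cK0 K01] := compact_nbhs1 lcG.
pose Q := quotient_topology {eq_quot (coset_equiv S)}%qT.
pose p : G -> Q := fun x => (\pi_Q x)%qT.
have p_eq x y : p x = p y <-> (x^-1 * y)%g \in S.
  exact: (rwP (@eqmodP _ (coset_equiv S) x y)).
pose N (q : Q) := p @` [set y | K0 ((repr q)^-1 * y)%g].
have Nn q : [set: Q] q -> nbhs q (N q).
  move=> _; rewrite nbhsE; exists (p @` [set y | K0° ((repr q)^-1 * y)%g]); last first.
    by move=> _ [y Ky <-]; exists y => //; exact: interior_subset Ky.
  split; last first.
    exists (repr q); last by rewrite /p reprK.
    by rewrite /= mulVg; exact: nbhs_singleton (nbhs_interior K01).
  (* The saturation of an open set is a union of right translates by elements of S, so the quotient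
     map is open. *)
  have : open (p @^-1` (p @` [set y | K0° ((repr q)^-1 * y)%g])); last by [].
  rewrite openE => y [z Kz /p_eq zy].
  have : nbhs y [set t | K0° ((repr q)^-1 * (t * (z^-1 * y)^-1))%g].
    apply: (@continuous_mulr ((z^-1 * y)^-1)%g y [set s | K0° ((repr q)^-1 * s)%g]).
    have -> : (y * (z^-1 * y)^-1 = z)%g by rewrite invgM invgK mulVKg.
    apply: (@continuous_mull ((repr q)^-1)%g z K0°).
    by apply: open_nbhs_nbhs; split; [exact: open_interior|].
  apply: filterS => t Kt; exists (t * (z^-1 * y)^-1)%g => //.
  by apply/p_eq; rewrite invgM invgK mulgVK.
have [F [fF _] QF] := compact_finite_nbhs cS Nn.
exists (mul_set (repr @` F) K0).
  by apply: compact_mul => //; apply: finite_compact; exact: finite_image.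
move=> x; have [q Fq [y Ky /p_eq yx]] := QF (p x) I; exists y => //.
exists (repr q); first by exists q.
by exists ((repr q)^-1 * y)%g => //; rewrite mulVKg.
Qed.

End TopologicalGroup.

Lemma real_nat_bound (R : realType) (x : R) : exists m : nat, (x <= m%:R)%R.
Proof.
exists (Num.bound `|x|%R); apply: le_trans (ler_norm x) _.
by apply: ltW; exact: archi_boundP.
Qed.

(** [rho] moves a point of G to the lattice by an element of K, and [f] is the given quasi-isometry.
    The inverse is taken because the word metric is left-invariant, whereas [near] is invariant
    under right multiplication. *)
Lemma coarse_map (R : realType) (n : nat) (G : topologicalGroupType)
    (Gamma : groupClosed G) : locally_compact [set: G] ->
  discrete_subgroup Gamma -> cocompact_subgroup Gamma ->
  in_qi_class_free R n (subgroup Gamma) ->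
  exists psi : G -> free_group 'I_n,
  [/\ forall C : set G, bounded C -> exists c, forall x y, C (x^-1 * y)%g ->
        near c (psi x) (psi y),
      forall c, exists2 C : set G, compact C &
        forall x y, near c (psi x) (psi y) -> C (x^-1 * y)%g &
      exists c, forall w, exists x, near c (psi x) w].
Proof.
move=> lcG dG cG [S genS [f [L [C [L1 C0 fL fC]]]]].
have [K cK HK] := cocompact_cover lcG cG.
have /choice[rho Hrho] (x : G) : exists r : subgroup Gamma,
    [set (k^-1)%g | k in K] ((val r)^-1 * x)%g.
  have [k Kk kx] := HK (x^-1)%g.
  have xk : (x * k)%g \in Gamma by rewrite -gpredV invgM.
  exists (exist _ (x * k)%g xk); exists k => //=.
  by rewrite invgM mulgVK.
have bK : bounded [set (k^-1)%g | k in K] by exact/bounded_inv/bounded_compact.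
have bK' : bounded K := bounded_compact cK.
have dist_near (u v : free_group 'I_n) c :
    (word_dist (R := R) (free_gens n) v u <= c%:R)%R <-> near c (u^-1)%g (v^-1)%g.
  by rewrite /word_dist word_norm_free ler_nat /near invgK.
have mono (r : subgroup Gamma) c d : (c <= d)%N ->
    (word_norm S r <= c%:R :> R)%R -> (word_norm S r <= d%:R :> R)%R.
  by move=> cd /le_trans; apply; rewrite ler_nat.
exists (fun x => (f (rho x))^-1)%g; split.
- move=> D bD.
  (* The lattice element comparing [rho y] with [rho x] always falls in this bounded set, which
     contains finitely many lattice elements; m bounds their norms. *)
  pose D' := mul_set (mul_set [set (k^-1)%g | k in K] [set (d^-1)%g | d in D]) K.
  have bD' : bounded D' by do 2!apply: bounded_mul => //; exact: bounded_inv.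
  have fD' : finite_set [set r : subgroup Gamma | D' (val r)].
    apply: (@sub_finite_set _ _ (val @^-1` [set x | x \in Gamma /\ D' x])).
      by move=> r Dr; split=> //; exact: (valP r).
    apply: finite_preimage; first by move=> ? ? _ _; exact: val_inj.
    exact: discrete_bounded_finite.
  have [m Hm] := finite_uniform_bound (Q := fun r m => (word_norm (R := R) S r <= m%:R)%R)
    fD' mono
    (fun r => real_nat_bound (word_norm S r)).
  have [c Hc] := real_nat_bound (L * m%:R + C)%R.
  exists c => x y xy; apply/dist_near.
  have /andP[_ H] := fL (rho y) (rho x); apply: le_trans H (le_trans _ Hc).
  rewrite lerD2r ler_wpM2l//; first exact: le_trans L1.
  apply: Hm => /=.
  have [kx Kkx Ex] := Hrho x; have [ky Kky Ey] := Hrho y.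
  have -> : ((val (rho y))^-1 * val (rho x))%g = (ky^-1 * (x^-1 * y)^-1 * kx)%g.
    by rewrite Ey -[kx]invgK Ex !invgM !invgK !mulgA !mulgK.
  by exists (ky^-1 * (x^-1 * y)^-1)%g; [exists (ky^-1)%g; [exists ky|exists (x^-1 * y)^-1%g => //; exists (x^-1 * y)%g]|exists kx].
- move=> c.
  have [m Hm] := real_nat_bound (L * (c%:R + C))%R.
  pose E := [set r : subgroup Gamma | (word_norm (R := R) S r <= m%:R)%R].
  have fE : finite_set E by exact: finite_word_ball.
  have [D cD HD] : bounded (mul_set (mul_set K [set (val r)^-1%g | r in E])
      [set (k^-1)%g | k in K]).
    by do 2!apply: bounded_mul => //; apply: bounded_finite; exact: finite_image.
  exists D => // x y /dist_near xy; apply: HD.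
  have Er : E ((rho y)^-1 * rho x)%g.
    rewrite /E /=; apply: le_trans Hm.
    have /andP[H _] := fL (rho y) (rho x).
    have L0 : (0 < L)%R by exact: lt_le_trans L1.
    rewrite -ler_pdivrMl// -lerBlDr; exact: le_trans H xy.
  have [kx Kkx Ex] := Hrho x; have [ky Kky Ey] := Hrho y.
  have -> : (x^-1 * y = kx * ((val (rho y))^-1 * val (rho x))^-1 * ky^-1)%g.
    by rewrite Ey -[kx]invgK Ex !invgM !invgK !mulgA !mulgK.
  exists (kx * ((val (rho y))^-1 * val (rho x))^-1)%g; last by exists (ky^-1)%g => //; exists ky.
  by exists kx => //; exists ((val (rho y))^-1 * val (rho x))^-1%g => //; exists ((rho y)^-1 * rho x)%g.
- have fK : finite_set [set r : subgroup Gamma | K (val r)].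
    apply: (@sub_finite_set _ _ (val @^-1` [set x | x \in Gamma /\ K x])).
      by move=> r Dr; split=> //; exact: (valP r).
    apply: finite_preimage; first by move=> ? ? _ _; exact: val_inj.
    exact: discrete_bounded_finite.
  have [m Hm] := finite_uniform_bound (Q := fun r m => (word_norm (R := R) S r <= m%:R)%R)
    fK mono
    (fun r => real_nat_bound (word_norm S r)).
  have [c1 Hc1] := real_nat_bound (L * m%:R + C)%R.
  have [c2 Hc2] := real_nat_bound C.
  exists (c1 + c2)%N => w; have [r rw] := fC (w^-1)%g; exists (val r).
  apply: (@near_trans _ _ _ (f r)^-1%g).
    apply/dist_near; have /andP[_ H] := fL r (rho (val r)).
    apply: le_trans H (le_trans _ Hc1).
    rewrite lerD2r ler_wpM2l//; first exact: le_trans L1.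
    apply: Hm => /=; have [k Kk] := Hrho (val r).
    by move=> /(congr1 (fun t : G => t^-1)%g); rewrite invgK invgM invgK => <-.
  rewrite -[w]invgK; apply/near_sym/dist_near; exact: le_trans rw Hc2.
Qed.

(** * A compact open subgroup *)

Lemma suffix_eq_size (T : eqType) (r s t : seq T) : size s = size t ->
  suffix s r -> suffix t r -> s = t.
Proof. by rewrite !suffixE => -> /eqP <- /eqP ->. Qed.

Section OpenSubgroup.
Variables (n : nat) (G : topologicalGroupType) (psi : G -> free_group 'I_n).
Hypothesis n2 : (2 <= n)%N.
Hypothesis Glc : locally_compact [set: G].
Hypothesis psi_bornologous : forall C : set G, bounded C ->
  exists c, forall x y, C (x^-1 * y)%g -> near c (psi x) (psi y).
Hypothesis psi_proper : forall c, exists2 C : set G, compact C &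
  forall x y, near c (psi x) (psi y) -> C (x^-1 * y)%g.
Variable c0 : nat.
Hypothesis psi_onto : forall w, exists x, near c0 (psi x) w.
Implicit Types (g h x y : G) (u v w : free_group 'I_n).

Definition base_letter : @letter 'I_n := (Ordinal (ltnW n2), true).

Definition base_word : free_group 'I_n :=
  exist (fun s => is_true (reduced s)) [:: base_letter] isT.

Lemma wsize_base : wsize base_word = 1%N.
Proof. by []. Qed.

Definition half : set G := [set x | suffix (val base_word) (val (psi x))].

(* Working modulo bounded sets is what makes this stabilizer open: the set-wise
   stabilizer of the half-space need not be, as psi is not continuous. *)
Definition half_stab : set G := [set g | exists2 C, bounded C &
  forall x, ~ C x -> half (g^-1 * x)%g <-> half x].

Lemma half_stab1 : half_stab 1%g.
Proof.
exists set0; first by apply: bounded_finite; exact: finite_set0.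
by move=> x _; rewrite invg1 mul1g.
Qed.

Lemma half_stabV g : half_stab g -> half_stab (g^-1)%g.
Proof.
move=> [C bC HC]; exists (mul_set [set (g^-1)%g] C).
  by apply: bounded_mul => //; apply: bounded_finite; exact: finite_set1.
move=> x nCx; rewrite invgK -(HC (g * x)%g) ?mulKg// => Cgx; apply: nCx.
by exists (g^-1)%g => //; exists (g * x)%g => //; rewrite mulKg.
Qed.

Lemma half_stabM g h : half_stab g -> half_stab h -> half_stab (g * h)%g.
Proof.
move=> [C bC HC] [D bD HD]; exists (C `|` mul_set [set g] D).
  apply: bounded_setU => //; apply: bounded_mul => //.
  by apply: bounded_finite; exact: finite_set1.
move=> x /not_orP[nC nD]; rewrite invgM -mulgA HD ?HC// => Dx; apply: nD.
by exists g => //; exists (g^-1 * x)%g => //; rewrite mulVKg.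
Qed.

Lemma bounded_size C : bounded C -> exists m, forall x, C x -> (wsize (psi x) <= m)%N.
Proof.
move=> /psi_bornologous[c Hc]; exists (wsize (psi 1%g) + c)%N => x Cx.
by apply: near_size; apply: Hc; rewrite invg1 mul1g.
Qed.

Lemma size_bounded m : bounded [set x | (wsize (psi x) <= m)%N].
Proof.
have [C cC HC] := psi_proper (wsize (psi 1%g) + m).
exists C => // x xm; have := HC 1%g x; rewrite invg1 mul1g; apply.
apply: (@near_trans _ _ _ 1%g); first exact/near_sym/near1.
exact: near1.
Qed.

Definition lift_word w : G := projT1 (cid (psi_onto w)).

Lemma lift_wordP w : near c0 (psi (lift_word w)) w.
Proof. by rewrite /lift_word; case: cid. Qed.

(** The distance between lifts of adjacent words: c0 at each end and 1 between the words. *)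
Let c1 := (c0 + (1 + c0))%N.

Lemma near_lift u v : near 1 u v -> near c1 (psi (lift_word u)) (psi (lift_word v)).
Proof.
move=> uv; apply: near_trans (lift_wordP u) _; apply: near_trans uv _.
exact/near_sym/lift_wordP.
Qed.

Lemma near_lift_psi x : near c1 (psi x) (psi (lift_word (psi x))).
Proof. by apply: near_mono (near_sym (lift_wordP _)); exact: leq_addr. Qed.

(** A pair straddling the translate of [half] by g becomes, after translating back, a close pair
    straddling [half], which is near 1 in G; so x was near g, with a constant independent of g. *)
Lemma half_boundary_exists : exists c, forall g x y,
  near c1 (psi x) (psi y) -> ~ near c (psi g) (psi x) ->
  half (g^-1 * x)%g <-> half (g^-1 * y)%g.
Proof.
have [C cC HC] := psi_proper c1.
have [c' Hc'] := psi_bornologous (bounded_compact cC).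
have [c2 Hc2] := psi_bornologous (size_bounded (1 + c')).
have one g x y : near c1 (psi x) (psi y) -> half (g^-1 * x)%g -> ~ half (g^-1 * y)%g ->
    near c2 (psi g) (psi x).
  move=> xy hx /negP hy; apply: Hc2 => /=.
  have xy' : near c' (psi (g^-1 * y)%g) (psi (g^-1 * x)%g).
    by apply/near_sym/Hc'; rewrite invgM invgK mulgA mulgK; exact: HC.
  exact: near_branch_size xy' hx hy.
exists (c2 + c1)%N => g x y xy nx; split=> h; apply: contrapT => nh; apply: nx.
  by apply: near_mono (one g x y xy h nh); rewrite leq_addr.
by apply: near_trans (one g y x (near_sym xy) h nh) (near_sym xy).
Qed.

Definition half_width := projT1 (cid half_boundary_exists).

Lemma half_boundary g x y : near c1 (psi x) (psi y) ->
  ~ near half_width (psi g) (psi x) -> half (g^-1 * x)%g <-> half (g^-1 * y)%g.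
Proof. by rewrite /half_width; case: cid => c /= H; exact: H. Qed.

Let R := (half_width + c0)%N.

(* Moving along a connected part of the tree far from psi g, one does not
   cross the boundary of the translated half-space. *)
Lemma half_region g w (Z : set (free_group 'I_n)) :
  (forall u v a, val v = a :: val u -> Z v -> Z u) ->
  (forall u, suffix (val w) (val u) -> Z u -> ~ near R (psi g) u) ->
  forall u, suffix (val w) (val u) -> Z u ->
    half (g^-1 * lift_word u)%g <-> half (g^-1 * lift_word w)%g.
Proof.
move=> Zup Zfar; apply: branch_ind => // u v a wu E IH Zv.
have Zu := Zup _ _ _ E Zv; rewrite -(IH Zu).
have wv : suffix (val w) (val v) by rewrite E; exact: suffix_trans wu (suffix_cons _ _).
apply: half_boundary; first exact/near_lift/near_sym/(near_cons E).
move=> H; apply: Zfar wv Zv _; exact: near_trans H (lift_wordP v).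
Qed.

(** If [psi g] is long, the translate of [half] by g has its boundary deep inside the half-tree of a
    word h, so outside it contains all lifts or none. But [half] contains some far lifts there and
    misses others. *)
Lemma half_stab_size g : half_stab g -> (wsize (psi g) <= R + 2)%N.
Proof.
move=> [C bC HC]; rewrite leqNgt; apply/negP => gR.
have [m Hm] := bounded_size bC.
(* Length 2 rather than 1: whatever h is, the half-tree of any single letter still has arbitrarily
   long words outside that of h. *)
have [|h [h2 hg]] := @ancestor_exists n 2 (psi g); first by lia.
have [[|x [|y [|z s]]]] : {s | val h = s} by exists (val h).
- by move: h2; rewrite /wsize => /[swap] ->.
- by move: h2; rewrite /wsize => /[swap] ->.
- move=> hE.
  pose Z : set (free_group 'I_n) := [set u | ~~ suffix (val h) (val u)].
  have Zup u v a : val v = a :: val u -> Z v -> Z u.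
    rewrite /Z /= => ->; apply: contraNN => /suffix_trans; apply; exact: suffix_cons.
  have Zfar u : suffix (val (1%g : free_group 'I_n)) (val u) -> Z u -> ~ near R (psi g) u.
    move=> _ Zu /near_sym gu; have := near_branch_size gu hg Zu; rewrite h2; lia.
  have reg := half_region Zup Zfar.
  have long a : exists u, [/\ Z u, suffix [:: a] (val u) & (m + c0 + c0 + 2 < wsize u)%N].
    have [b [ba bx _]] := letter_avoid (letter_inv a) x x n2.
    have [u [su ku]] := long_word (m + c0 + c0 + 3) ba; exists u; split; last by lia.
      rewrite /Z /= hE; apply/negP => su'.
      by have [/eqP] := suffix_eq_size (erefl : size [:: x; y] = size [:: b; a]) su' su;
        rewrite eq_sym (negbTE bx).
    by apply: suffix_trans su; exact: suffix_cons.
  have half_lift u : (m + c0 + c0 + 2 < wsize u)%N -> Z u ->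
      half (lift_word u) <-> half (g^-1 * lift_word (1%g : free_group 'I_n))%g.
    move=> um Zu; rewrite -(reg u (suffix0s _) Zu); apply: iff_sym; apply: HC => /Hm.
    by have := near_size (lift_wordP u); lia.
  have [u [Zu su um]] := long base_letter.
  have [a [ab _ _]] := letter_avoid base_letter base_letter base_letter n2.
  have [v [Zv sv vm]] := long a.
  have hu : half (lift_word u).
    apply: contraT => /negP nh; have := near_branch_size (w := base_word) (lift_wordP u) su (introN idP nh).
    by rewrite wsize_base; lia.
  have : ~ half (lift_word v).
    move=> hv; have nsv : ~~ suffix (val base_word) (val v).
      apply/negP => sv'; have [/eqP] := suffix_eq_size (erefl : size [:: a] = size [:: base_letter]) sv sv'.
      by rewrite (negbTE ab).
    have := near_branch_size (near_sym (lift_wordP v)) hv nsv.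
    by rewrite wsize_base; have := near_size (lift_wordP v); lia.
  by apply; apply/(half_lift v vm Zv)/(half_lift u um Zu).
- by move: h2; rewrite /wsize => /[swap] ->.
Qed.

Lemma half_stab_bounded : bounded half_stab.
Proof. by apply: bounded_sub (size_bounded (R + 2)); exact: half_stab_size. Qed.

Lemma finite_words k : finite_set [set u : free_group 'I_n | wsize u = k].
Proof.
apply: (@finite_preimage _ _ [set s : seq (@letter 'I_n) | size s = k] val).
  by move=> ? ? _ _; exact: val_inj.
apply: (@sub_finite_set _ _ ((fun t : k.-tuple (@letter 'I_n) => val t) @` setT)).
  by move=> s /eqP sk; exists (Tuple sk).
apply: finite_image; exact: finite_finset.
Qed.

(** For g in K, agreement of [half] with its translate at the finitely many lifts of words of length
    k propagates to longer words by [half_region]. Each test holds near 1, since such a lift is far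
    from the boundary of [half]. *)
Lemma nbhs1_half_stab : nbhs (1%g : G) half_stab.
Proof.
have [K cK K1] := compact_nbhs1 Glc.
have [m Hm] := bounded_size (bounded_compact cK).
have [ck Hck] := psi_bornologous (bounded_compact cK).
(* m bounds the words over K and ck the displacement caused by K; words of length k then stay clear
   of the boundaries of all translates of [half] by K. *)
pose k := (R + half_width + m + ck + ck + c0 + 2)%N.
have far g u : K g -> (k <= wsize u)%N -> ~ near R (psi g) u.
  by move=> /Hm gm uk /near_size; rewrite /k in uk; lia.
have testN u : wsize u = k ->
    nbhs (1%g : G) [set g | half (g^-1 * lift_word u)%g <-> half (lift_word u)].
  move=> uk; set x := lift_word u.
  have cont : (fun g : G => (x^-1 * (g^-1 * x))%g) @ nbhs (1%g : G) --> (x^-1 * (1^-1 * x))%g.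
    apply: cvg_mulg; first exact: cvg_cst.
    apply: cvg_mulg; last exact: cvg_cst.
    by apply: cvg_invg; exact: cvg_id.
  have : nbhs (1%g : G) [set g | K (x^-1 * (g^-1 * x))%g].
    by apply: (cont K); rewrite invg1 mul1g mulVg.
  apply: filterS => g /Hck xg; have xk := near_size (near_sym (lift_wordP u)).
  have xk' := near_size (lift_wordP u); rewrite -/x in xk'.
  split=> hg; apply: contrapT => /negP nh.
    have := near_branch_size xg hg nh; rewrite wsize_base.
    by have := near_size (near_sym xg); rewrite /k in uk; lia.
  have := near_branch_size (near_sym xg) hg nh.
  by rewrite wsize_base; rewrite /k in uk; lia.
have : nbhs (1%g : G) (\bigcap_(u in [set u | wsize u = k])
    [set g | half (g^-1 * lift_word u)%g <-> half (lift_word u)]).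
  have fw := finite_words k; rewrite -[X in \bigcap_(_ in X) _](fset_setK fw).
  by apply: filter_bigI => u; rewrite in_fset_set// inE; exact: testN.
move=> tests; apply: filterS (filterI K1 tests) => g [Kg Hg].
have down h x : K h -> (k < wsize (psi x))%N ->
    half (h^-1 * x)%g <-> half (h^-1 * lift_word (ancestor k (psi x)))%g.
  move=> Kh xk.
  have -> : half (h^-1 * x)%g <-> half (h^-1 * lift_word (psi x))%g.
    apply: half_boundary (near_lift_psi x) _ => /near_size; have := Hm h Kh.
    by rewrite /k in xk; lia.
  apply: (half_region (Z := setT)) => //; last exact: ancestor_suffix.
  move=> u /size_suffix su _; apply: far => //.
  by apply: leq_trans su; rewrite -[size _]/(wsize _) wsize_ancestor// ltnW.
exists [set x | (wsize (psi x) <= k)%N]; first exact: size_bounded.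
move=> x /negP; rewrite -ltnNge => xk.
have := down 1%g x (nbhs_singleton K1) xk; rewrite invg1 !mul1g => ->.
rewrite (down g x Kg xk); apply: Hg.
by rewrite /= wsize_ancestor// ltnW.
Qed.

End OpenSubgroup.

(** * The graph of cosets of a bounded open subgroup *)

Section Cosets.
Variables (G : topologicalGroupType) (U : set G).
Hypothesis U1 : U 1%g.
Hypothesis UV : forall g, U g -> U (g^-1)%g.
Hypothesis UM : forall g h, U g -> U h -> U (g * h)%g.
Implicit Types (g h x y : G).

Definition coset_repr x : G := xget 1%g [set y | U (x^-1 * y)%g].

Lemma coset_reprP x : U (x^-1 * coset_repr x)%g.
Proof.
apply: (@xgetPex _ 1%g [set y | U (x^-1 * y)%g]).
by exists x; rewrite /= mulVg.
Qed.

Lemma coset_repr_eq x y : U (x^-1 * y)%g -> coset_repr x = coset_repr y.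
Proof.
move=> xy; congr (xget _ _); apply/seteqP; split=> z /= Uz.
  have -> : (y^-1 * z = (x^-1 * y)^-1 * (x^-1 * z))%g by rewrite invgM invgK mulgA mulgK.
  by apply: UM => //; exact: UV.
have -> : (x^-1 * z = (x^-1 * y) * (y^-1 * z))%g by rewrite -mulgA mulVKg.
exact: UM.
Qed.

(** Cosets are encoded by canonical representatives, which inherit the choice structure of G and can
    be fed to [psi]. *)
Definition coset_space : Type := {x : G | x == coset_repr x}.

HB.instance Definition _ := Choice.on coset_space.

Lemma coset_repr_idem x : coset_repr x == coset_repr (coset_repr x).
Proof. by apply/eqP/coset_repr_eq; exact: coset_reprP. Qed.

Definition coset_pi x : coset_space := 
  exist (fun y => is_true (y == coset_repr y)) _ (coset_repr_idem x).

Lemma coset_pi_eq x y : U (x^-1 * y)%g -> coset_pi x = coset_pi y.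
Proof. by move=> xy; apply: val_inj; exact: coset_repr_eq. Qed.

Lemma coset_pi_inv x y : coset_pi x = coset_pi y -> U (x^-1 * y)%g.
Proof.
move=> /(congr1 val)/= E.
have -> : (x^-1 * y = (x^-1 * coset_repr x) * (y^-1 * coset_repr y)^-1)%g.
  by rewrite E invgM invgK mulgA mulgK.
by apply: UM; [|apply: UV]; exact: coset_reprP.
Qed.

Lemma coset_piK (v : coset_space) : coset_pi (val v) = v.
Proof. by apply: val_inj => /=; apply/esym/eqP; exact: (valP v). Qed.

Definition coset_act g (v : coset_space) : coset_space := coset_pi (g * val v)%g.

Lemma coset_act_pi g x : coset_act g (coset_pi x) = coset_pi (g * x)%g.
Proof.
apply: coset_pi_eq; rewrite invgM -mulgA mulKg /=.
by rewrite -[X in U X]invgK invgM invgK; apply: UV; exact: coset_reprP.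
Qed.

Lemma coset_act1 v : coset_act 1%g v = v.
Proof. by rewrite /coset_act mul1g coset_piK. Qed.

Lemma coset_actM g h v : coset_act (g * h)%g v = coset_act g (coset_act h v).
Proof. by rewrite -(coset_piK v) !coset_act_pi mulgA. Qed.

Lemma coset_act_trans v : exists g, coset_act g (coset_pi 1%g) = v.
Proof. by exists (val v); rewrite coset_act_pi mulg1 coset_piK. Qed.

Lemma finite_cosets (C : set G) : nbhs (1%g : G) U -> bounded C ->
  finite_set (coset_pi @` C).
Proof.
move=> nU [K cK CK].
have [F [fF _] KF] := @compact_finite_nbhs _ K (fun x => [set y | U (x^-1 * y)%g]) cK
  (fun x _ => ltac:(by have := nbhs_mull x nU; rewrite mulg1)).
apply: sub_finite_set (finite_image coset_pi fF) => _ [x /CK/KF[y Fy Uyx] <-].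
by exists y => //; exact: coset_pi_eq.
Qed.

Section Graph.
Variables (n : nat) (psi : G -> free_group 'I_n) (c0 : nat).
Hypothesis n2 : (2 <= n)%N.
Hypothesis Uopen : nbhs (1%g : G) U.
Hypothesis Ubounded : bounded U.
Hypothesis psi_bornologous : forall C : set G, bounded C ->
  exists c, forall x y, C (x^-1 * y)%g -> near c (psi x) (psi y).
Hypothesis psi_proper : forall c, exists2 C : set G, compact C &
  forall x y, near c (psi x) (psi y) -> C (x^-1 * y)%g.
Hypothesis psi_onto : forall w, exists x, near c0 (psi x) w.

Let c1 := (c0 + (1 + c0))%N.

(** All translates of coarsely adjacent pairs are taken, since [psi] is not equivariant and the
    graph must be invariant. *)
Definition coset_edge (v w : coset_space) : Prop := exists g x y,
  [/\ v = coset_pi (g * x)%g, w = coset_pi (g * y)%g & near c1 (psi x) (psi y)].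

Definition coset_word (v : coset_space) : free_group 'I_n := psi (val v).

Lemma coset_edge_sym v w : coset_edge v w -> coset_edge w v.
Proof. by move=> [g [x [y [-> -> xy]]]]; exists g, y, x; split=> //; exact: near_sym. Qed.

Lemma coset_edge_act g v w :
  coset_edge v w -> coset_edge (coset_act g v) (coset_act g w).
Proof.
move=> [h [x [y [-> -> xy]]]]; exists (g * h)%g, x, y.
by rewrite !coset_act_pi !mulgA.
Qed.

(** Every x is coarsely adjacent to the lift of its word, and lifts are joined letter by letter down
    to that of the empty word. *)
Lemma coset_connected : connected_in coset_edge setT.
Proof.
move=> P [v _ Pv] [w _ nPw]; apply: contrapT => nE.
have no_exit x y : near c1 (psi x) (psi y) -> P (coset_pi x) -> P (coset_pi y).
  move=> xy Px; apply: contrapT => nPy; apply: nE; exists (coset_pi x), (coset_pi y).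
  by split=> //; split=> //; exists 1%g, x, y; rewrite !mul1g.
have no_cross x y : near c1 (psi x) (psi y) -> P (coset_pi x) <-> P (coset_pi y).
  by move=> xy; split; apply: no_exit => //; exact: near_sym.
pose o := lift_word psi_onto 1%g.
have const x : P (coset_pi x) <-> P (coset_pi o).
  rewrite (no_cross _ _ (near_lift_psi psi_onto x)).
  apply: (branch_ind (w := 1%g) (P := fun u =>
    P (coset_pi (lift_word psi_onto u)) <-> P (coset_pi o))) => //; last exact: suffix0s.
  move=> u u' a _ /near_cons/near_sym uu' <-; apply: no_cross; exact: near_lift.
by apply: nPw; rewrite -(coset_piK w) const -(const (val v)) coset_piK.
Qed.

Lemma coset_word_edge : exists c, forall v w, coset_edge v w ->
  near c (coset_word v) (coset_word w).
Proof.
have [D cD HD] := psi_proper c1.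
have [|c Hc] := psi_bornologous (C := mul_set (mul_set U D) U).
  by do 2!apply: bounded_mul => //; exact: bounded_compact.
exists c => _ _ [g [x [y [-> -> xy]]]]; apply: Hc => /=.
have rx := coset_reprP (g * x)%g; have ry := coset_reprP (g * y)%g.
exists (((g * x)^-1 * coset_repr (g * x))^-1 * (x^-1 * y))%g.
  exists ((g * x)^-1 * coset_repr (g * x))^-1%g; first exact: UV.
  by exists (x^-1 * y)%g => //; exact: HD.
exists ((g * y)^-1 * coset_repr (g * y))%g => //.
by rewrite !invgM !invgK !mulgA !mulgK.
Qed.

Lemma coset_word_proper c : exists2 B : set coset_space, finite_set B &
  forall g v, near c (coset_word (coset_act g (coset_pi 1%g))) (coset_word v) ->
    B (coset_act g^-1%g v).
Proof.
have [D cD HD] := psi_proper c.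
exists (coset_pi @` mul_set U D).
  by apply: finite_cosets => //; apply: bounded_mul => //; exact: bounded_compact.
move=> g v; rewrite coset_act_pi mulg1 /coset_word /= => /HD gv.
exists (g^-1 * val v)%g => //.
exists (g^-1 * coset_repr g)%g; first exact: coset_reprP.
by exists ((coset_repr g)^-1 * val v)%g => //; rewrite mulgA mulgK.
Qed.

Lemma coset_word_onto : exists c, forall w, exists v, near c (coset_word v) w.
Proof.
have [c Hc] := psi_bornologous Ubounded; exists (c + c0)%N => w.
have [x xw] := psi_onto w; exists (coset_pi x); apply: near_trans xw.
by apply/near_sym/Hc; exact: coset_reprP.
Qed.

Lemma coset_act_fix v : nbhs (1%g : G) [set g | coset_act g v = v].
Proof.
have cont : (fun g : G => ((val v)^-1 * (g * val v))%g) @ nbhs (1%g : G) -->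
    ((val v)^-1 * (1 * val v))%g.
  apply: cvg_mulg; first exact: cvg_cst.
  by apply: cvg_mulg; [exact: cvg_id|exact: cvg_cst].
have : nbhs (1%g : G) [set g | U ((val v)^-1 * (g * val v))%g].
  by apply: (cont U); rewrite mul1g mulVg.
apply: filterS => g Ug; rewrite /= -[RHS]coset_piK; symmetry; exact: coset_pi_eq.
Qed.

Lemma coset_act_bounded v w : bounded [set g | coset_act g v = w].
Proof.
apply: (@bounded_sub _ _ (mul_set (mul_set [set (val w)] U) [set ((val v)^-1)%g])).
  move=> g /= gv; exists (g * val v)%g; last by exists ((val v)^-1)%g => //; rewrite mulgK.
  exists (val w) => //; exists ((val w)^-1 * (g * val v))%g; last by rewrite mulVKg.
  by apply: coset_pi_inv; rewrite coset_piK; exact: esym gv.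
do 2?[apply: bounded_mul => //]; apply: bounded_finite; exact: finite_set1.
Qed.

Lemma coset_tree_action : exists (T : tree) (ta : G -> vertex T -> vertex T),
  [/\ forall v, ta 1%g v = v,
      forall g h v, ta (g * h)%g v = ta g (ta h v),
      forall g u v, edge u v -> edge (ta g u) (ta g v),
      bounded_valence T &
  [/\ forall v, nbhs (1%g : G) [set g | ta g v = v],
      forall u v, bounded [set g | ta g u = v],
      exists2 S : set (vertex T), finite_set S & forall v, exists g, S (ta g v) &
      exists v : vertex T, branching_vertex v]].
Proof.
have [c2 Hc2] := coset_word_edge; have [c3 Hc3] := coset_word_onto.
have [T [ta [ta1 taM tae Tb [fixT boundT orbT brT]]]] := tree_like_action n2
  coset_act1 coset_actM coset_act_trans coset_edge_sym coset_connected
  coset_edge_act Hc2 coset_word_proper Hc3.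
exists T, ta; split=> //; split=> // [v|u v].
  have [F fF HF] := fixT v.
  have : nbhs (1%g : G) (\bigcap_(x in F) [set g | coset_act g x = x]).
    rewrite -[X in \bigcap_(_ in X) _](fset_setK fF); apply: filter_bigI => x _.
    exact: coset_act_fix.
  by apply: filterS => g Hg; apply: HF => x Fx; exact: Hg.
have [F fF HF] := boundT u v.
have bF (A : set (coset_space * coset_space)) : finite_set A ->
    bounded (\bigcup_(z in A) [set g | coset_act g z.1 = z.2]).
  move=> fA; rewrite -bigsetU_fset_set//.
  elim/big_ind : _ => [|A1 A2|z _].
  - by apply: bounded_finite; exact: finite_set0.
  - exact: bounded_setU.
  - exact: coset_act_bounded.
apply: bounded_sub (bF (F `*` F) (finite_setX fF fF)) => g /HF[x Fx Fgx].
by exists (x, coset_act g x).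
Qed.

End Graph.
End Cosets.

Theorem lattice_tree_action (R : realType) (n : nat) (G : topologicalGroupType)
    (Gamma : groupClosed G) : (2 <= n)%N -> locally_compact [set: G] ->
  discrete_subgroup Gamma -> cocompact_subgroup Gamma ->
  in_qi_class_free R n (subgroup Gamma) ->
  exists (T : tree) (ta : G -> vertex T -> vertex T),
  [/\ forall v, ta 1%g v = v,
      forall g h v, ta (g * h)%g v = ta g (ta h v),
      forall g u v, edge u v -> edge (ta g u) (ta g v),
      bounded_valence T &
  [/\ forall v, nbhs (1%g : G) [set g | ta g v = v],
      forall u v, bounded [set g | ta g u = v],
      exists2 S : set (vertex T), finite_set S & forall v, exists g, S (ta g v) &
      exists v : vertex T, branching_vertex v]].
Proof.
move=> n2 lcG dG cG qG; have [psi [p1 p2 [c0 p3]]] := coarse_map lcG dG cG qG.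
apply: (@coset_tree_action G (half_stab psi n2) _ _ _ n psi c0) => //.
- exact: half_stab1.
- exact: half_stabV.
- exact: half_stabM.
- exact: nbhs1_half_stab.
- exact: half_stab_bounded.
Qed.

(** * Realizations of trees and their isometries *)

Lemma compact_bigcup (X : topologicalType) (I : Type) (D : set I) (F : I -> set X) :
  finite_set D -> (forall i, D i -> compact (F i)) -> compact (\bigcup_(i in D) F i).
Proof.
move=> fD cF; have fD' : finite_set (D : set {classic I}) := fD.
rewrite -(@bigsetU_fset_set _ {classic I})// big_seq; apply: bigsetU_compact => i.
by rewrite in_fset_set// inE; exact: cF.
Qed.

Section TreePath.
Variable T : tree.
Implicit Types u v w : vertex T.

Lemma path_length_exists u v :
  exists k, `[< exists2 p, path (@edge T) u p /\ size p = k & last u p = v >].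
Proof. by have [p up pv] := tree_connected u v; exists (size p); apply/asboolP; exists p. Qed.

Definition path_dist u v : nat := ex_minn (path_length_exists u v).

Lemma path_distP u v : exists2 p, path (@edge T) u p /\ size p = path_dist u v & last u p = v.
Proof. by rewrite /path_dist; case: ex_minnP => k /asboolP. Qed.

Lemma path_dist_le u p : path (@edge T) u p -> (path_dist u (last u p) <= size p)%N.
Proof.
move=> up; rewrite /path_dist; case: ex_minnP => k _; apply.
by apply/asboolP; exists p.
Qed.

Lemma path_dist0 u : path_dist u u = 0%N.
Proof. by apply/eqP; rewrite -leqn0; exact: (@path_dist_le u [::]). Qed.

Lemma path_dist_eq0 u v : path_dist u v = 0%N -> u = v.
Proof. by have [[|w p] [_ <-] <-] := path_distP u v. Qed.

Lemma path_dist_edge u v w : edge v w -> (path_dist u w <= (path_dist u v).+1)%N.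
Proof.
move=> vw; have [p [up <-] pv] := path_distP u v.
have := @path_dist_le u (rcons p w); rewrite rcons_path last_rcons size_rcons.
by rewrite up pv; apply.
Qed.

Lemma path_dist1 u v : edge u v -> path_dist u v = 1%N.
Proof.
move=> uv; apply/eqP; rewrite eqn_leq; apply/andP; split.
  by have := path_dist_edge u uv; rewrite path_dist0.
by rewrite lt0n; apply: contraL uv => /eqP/path_dist_eq0 ->; rewrite edge_irr.
Qed.

Hypothesis Tb : bounded_valence T.

Lemma finite_edge v : finite_set [set w | edge v w].
Proof.
have [N HN] := Tb; apply: contrapT => inf.
have [s [us sv ss]] : exists s, [/\ uniq s, all (edge v) s & size s = N.+1].
  elim: N.+1 => [|k [s [us sv ss]]]; first by exists [::].
  have : infinite_set ([set w | edge v w] `\` [set` s]).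
    by apply: infinite_setD => //; exact: finite_seq.
  move=> /infinite_setN0[w [/= vw /negP ws]]; exists (w :: s).
  by rewrite /= ss us ws vw sv.
by have := HN v s us sv; rewrite ss ltnn.
Qed.

Lemma finite_path_ball u k : finite_set [set v | (path_dist u v <= k)%N].
Proof.
elim: k => [|k IH].
  apply: sub_finite_set (finite_set1 u) => v /=.
  by rewrite leqn0 => /eqP/path_dist_eq0.
apply: (@sub_finite_set _ _ ([set u] `|`
  \bigcup_(w in [set v | (path_dist u v <= k)%N]) [set v | edge w v])); last first.
  by rewrite finite_setU; split; [exact: finite_set1|apply: bigcup_finite => // w _;
    exact: finite_edge].
move=> v; have [p [up sp] pv] := path_distP u v; case/lastP: p up sp pv => [|p w].
  by move=> _ _ <-; left.
rewrite rcons_path size_rcons last_rcons => /andP[up pw] sp E; subst v => /=.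
rewrite -sp ltnS => pk; right; exists (last u p) => //=.
exact: leq_trans (path_dist_le up) pk.
Qed.

End TreePath.

(** * Distances and compact balls in the realization *)

Section TreeMetric.
Context {R : realType} {T : tree}.
Notation V := (vertex T).
Notation X := (realization R T).
Implicit Types (u v w : V) (x y : X) (d : V -> R).
Local Open Scope ring_scope.
Hypothesis neighbour : forall u, exists v, edge u v.

Lemma on_edge_exists x : exists u v, on_edge u v x.
Proof.
case: (baryP x) => [[u xu]|//]; have [v uv] := neighbour u; exists u, v.
have -> : bary x = vertex_point R u by rewrite /= xu.
exact: vertex_on_edgel.
Qed.

Definition lipschitz1 d : Prop := forall u v, edge u v -> `|d u - d v| <= 1.

(** A vertex point lies on every edge at that vertex, so an affine extension must be checked not to
    depend on the edge. *)
Lemma affine_unique d u v u' v' x : on_edge u v x -> on_edge u' v' x ->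
  x u * d u + x v * d v = x u' * d u' + x v' * d v'.
Proof.
move=> [uv xu xv xs x0] [uv' xu' xv' xs' x0'].
have nuv : v != u by apply: contraTneq uv => ->; rewrite edge_irr.
have nuv' : v' != u' by apply: contraTneq uv' => ->; rewrite edge_irr.
have sym (a b : V) : a != b -> b != a by rewrite eq_sym.
have [Eu|nu] := eqVneq u' u.
  subst u'; have [->//|nv] := eqVneq v' v.
  by rewrite (x0 v' nuv' nv) (x0' v nuv (sym _ _ nv)) !mul0r.
have [Ev|nv] := eqVneq u' v.
  subst u'; have [->|nv'] := eqVneq v' u; first by rewrite addrC.
  by rewrite (x0 v' nv' nuv') (x0' u (sym _ _ nu) (sym _ _ nv')) !mul0r addr0 add0r.
have E0 := x0 u' nu nv; rewrite E0 add0r in xs'; rewrite E0 mul0r add0r.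
have [Eu'|nu'] := eqVneq v' u.
  by subst v'; rewrite (x0' v (sym _ _ nv) nuv) mul0r addr0.
have [Ev'|nv'] := eqVneq v' v.
  by subst v'; rewrite (x0' u (sym _ _ nu) (sym _ _ nuv)) mul0r add0r.
by move: xs'; rewrite (x0 v' nu' nv') => /eqP; rewrite eq_sym oner_eq0.
Qed.

Lemma affine_extension_exists d : {h : X -> R | forall u v x, on_edge u v x ->
  h x = x u * d u + x v * d v}.
Proof.
have /choice[h Hh] (x : X) : exists r : R, forall u v, on_edge u v x ->
    r = x u * d u + x v * d v.
  have [u [v xuv]] := on_edge_exists x; exists (x u * d u + x v * d v).
  by move=> u' v' xuv'; exact: affine_unique.
by exists h => u v x; exact: Hh.
Qed.

Definition affine_extension d : X -> R := sval (affine_extension_exists d).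

Lemma affine_extensionE d u v x : on_edge u v x ->
  affine_extension d x = x u * d u + x v * d v.
Proof. exact: (svalP (affine_extension_exists d)). Qed.

Lemma affine_extension_vertex d u : affine_extension d (vertex_point R u) = d u.
Proof.
have [v uv] := neighbour u; rewrite (affine_extensionE d (vertex_on_edgel (R := R) uv)) /=.
have vu : v != u by apply: contraTneq uv => ->; rewrite edge_irr.
by rewrite eqxx (negbTE vu) mul1r mul0r addr0.
Qed.

(** This is the source of lower bounds for a distance defined as an infimum over chains: on one
    edge, the extension changes by the change of a barycentric coordinate times the difference of d
    at the endpoints. *)
Lemma affine_extension_lipschitz d x y : lipschitz1 d ->
  `|affine_extension d x - affine_extension d y| <= mdist x y.
Proof.
move=> d1; apply: lb_le_inf; first exact: chain_exists.
move=> l; elim=> [{}x|u v {}x z {}y {}l xuv zuv _ IH]; first by rewrite subrr normr0.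
apply: le_trans (ler_distD (affine_extension d z) _ _) _; apply: lerD IH.
rewrite (affine_extensionE d xuv) (affine_extensionE d zuv).
case: xuv zuv => uv _ _ xs _ [_ _ _ zs _].
have -> : x u * d u + x v * d v - (z u * d u + z v * d v) =
    (x u - z u) * (d u - d v).
  have -> : x v = 1 - x u by rewrite -xs addrC addKr.
  have -> : z v = 1 - z u by rewrite -zs addrC addKr.
  ring.
by rewrite normrM ler_piMr// d1.
Qed.

Lemma mdist_on_edge u v x y : on_edge u v x -> on_edge u v y ->
  mdist x y <= `|x u - y u|.
Proof.
move=> xuv yuv; apply: ge_inf; first exact: chain_lbound.
by rewrite /= -[X in chain _ _ X]addr0; apply: chain_step xuv yuv (chain_nil _).
Qed.

Lemma on_edge_le1 u v x : on_edge u v x -> x u <= 1.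
Proof. by case=> _ _ xv <- _; rewrite lerDl. Qed.

Lemma mdist_on_edge1 u v x y : on_edge u v x -> on_edge u v y -> mdist x y <= 1.
Proof.
move=> xuv yuv; apply: le_trans (mdist_on_edge xuv yuv) _.
have := on_edge_le1 xuv; have := on_edge_le1 yuv.
case: xuv yuv => _ ? _ _ _ [_ ? _ _ _]; rewrite ler_norml; lra.
Qed.

Lemma near_vertex x : exists u, mdist x (vertex_point R u) <= 1.
Proof.
have [u [v xuv]] := on_edge_exists x; exists u.
have uv : edge u v by case: xuv.
exact: mdist_on_edge1 xuv (vertex_on_edgel uv).
Qed.

Definition clamp (t : R) : R := Num.max 0 (Num.min 1 t).

Lemma clamp_ge0 t : 0 <= clamp t.
Proof. by rewrite /clamp le_max lexx. Qed.

Lemma clamp_le1 t : clamp t <= 1.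
Proof. by rewrite /clamp ge_max ler01 ge_min lexx. Qed.

Lemma clamp_id t : 0 <= t <= 1 -> clamp t = t.
Proof. by move=> /andP[t0 t1]; rewrite /clamp (min_idPr t1) (max_idPr t0). Qed.

Lemma clamp_lipschitz s t : `|clamp s - clamp t| <= `|s - t|.
Proof.
have cases (r : R) : [\/ r <= 0 /\ clamp r = 0, 0 <= r <= 1 /\ clamp r = r |
    1 <= r /\ clamp r = 1].
  have [r0|r0] := leP r 0.
    by apply: Or31; rewrite /clamp (min_idPr _) ?(max_idPl _)//; lra.
  have [r1|r1] := leP r 1; first by apply: Or32; rewrite clamp_id ?r1 ?ltW.
  by apply: Or33; rewrite /clamp (min_idPl _) ?(max_idPr _) ?ltW.
have h1 := ler_norm (s - t); have h2 := ler_norm (t - s); rewrite distrC in h2.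
by rewrite ler_norml; case: (cases s) => -[? ->]; case: (cases t) => -[? ->];
  apply/andP; split; lra.
Qed.

Definition edge_bary u v (t : R) : V -> R :=
  fun w => if w == u then 1 - clamp t else if w == v then clamp t else 0.

Lemma edge_bary_on_edge u v t : edge u v -> on_edge u v (edge_bary u v t).
Proof.
move=> uv; have vu : v != u by apply: contraTneq uv => ->; rewrite edge_irr.
rewrite /edge_bary; split; rewrite ?eqxx ?(negbTE vu)//.
- by rewrite subr_ge0 clamp_le1.
- exact: clamp_ge0.
- by rewrite subrK.
- by move=> w /negbTE -> /negbTE ->.
Qed.

Definition edge_point u v (uv : edge u v) (t : R) : X :=
  Realization (or_intror (ex_intro _ u (ex_intro _ v (edge_bary_on_edge t uv)))).

Lemma edge_point_continuous u v (uv : edge u v) : continuous (edge_point uv).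
Proof.
move=> t; apply/cvg_ballP => e e0.
apply: filterS (nbhsx_ballx t e e0) => s; rewrite ballEmdist -ball_normE /= => ts.
apply: le_lt_trans ts; apply: le_trans (clamp_lipschitz t s).
apply: le_trans (mdist_on_edge (x := edge_point uv t) (y := edge_point uv s)
  (edge_bary_on_edge t uv) (edge_bary_on_edge s uv)) _.
rewrite /= /edge_bary eqxx -normrN.
by have -> : - (1 - clamp t - (1 - clamp s)) = clamp t - clamp s by ring.
Qed.

Lemma edge_point_bary u v (uv : edge u v) x : on_edge u v x -> edge_point uv (x v) = x.
Proof.
move=> xuv; have x1 := on_edge_le1 (on_edgeC xuv); case: xuv => _ x0 xv0 xs xw.
apply: realization_eq => w; rewrite /= /edge_bary clamp_id ?xv0//.
have [->|wu] := eqVneq w u; first by rewrite -xs addrK.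
by have [->//|wv] := eqVneq w v; rewrite xw.
Qed.

Lemma closed_edgeE u v (uv : edge u v) :
  [set x : X | on_edge u v x] = edge_point uv @` `[0, 1].
Proof.
apply/seteqP; split=> [x xuv|_ [t _ <-]]; last exact: edge_bary_on_edge.
exists (x v); last exact: edge_point_bary.
by rewrite /= in_itv /= (on_edge_le1 (on_edgeC xuv)) andbT; case: xuv.
Qed.

Lemma closed_edge_compact u v (uv : edge u v) : compact [set x : X | on_edge u v x].
Proof.
rewrite (closed_edgeE uv); apply: continuous_compact; last exact: segment_compact.
by apply: continuous_subspaceT; exact: edge_point_continuous.
Qed.

Lemma closed_edge_connected u v (uv : edge u v) : connected [set x : X | on_edge u v x].
Proof.
rewrite (closed_edgeE uv); apply: connected_continuous_connected.
  exact: segment_connected.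
by apply: continuous_subspaceT; exact: edge_point_continuous.
Qed.

Lemma path_dist_lipschitz u : lipschitz1 (fun v => (path_dist u v)%:R).
Proof.
move=> v w vw; have h1 := path_dist_edge u vw; rewrite edge_sym in vw.
have h2 := path_dist_edge u vw; rewrite -(ler_nat R) -natr1 in h1.
by rewrite -(ler_nat R) -natr1 in h2; rewrite ler_norml; lra.
Qed.

Lemma path_dist_mdist u v : (path_dist u v)%:R <= mdist (vertex_point R u) (vertex_point R v).
Proof.
have := affine_extension_lipschitz (vertex_point R v) (vertex_point R u) (path_dist_lipschitz u).
by rewrite !affine_extension_vertex path_dist0 subr0 metric_sym ger0_norm.
Qed.

Hypothesis Tb : bounded_valence T.

Lemma finite_vertices_ball (p : X) (r : R) :
  finite_set [set v | mdist p (vertex_point R v) <= r].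
Proof.
have [u pu] := near_vertex p; have [k kr] := real_nat_bound (r + 1).
apply: sub_finite_set (finite_path_ball Tb u k) => v /= pv.
rewrite -(ler_nat R); apply: le_trans (path_dist_mdist u v) (le_trans _ kr).
apply: le_trans (metric_triangle _ p _) _; rewrite addrC.
by apply: lerD pv _; rewrite metric_sym.
Qed.

Lemma compact_ball (p : X) (r : R) : exists2 K, compact K & [set x | mdist p x <= r] `<=` K.
Proof.
have fB := finite_vertices_ball p (r + 1).
exists (\bigcup_(u in [set v | mdist p (vertex_point R v) <= r + 1])
  \bigcup_(v in [set v | edge u v]) [set x : X | on_edge u v x]).
  apply: compact_bigcup => // u _; apply: compact_bigcup => [|v uv].
    exact: finite_edge.
  exact: closed_edge_compact uv.
move=> x /= px; have [u [v xuv]] := on_edge_exists x.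
have uv : edge u v by case: xuv.
exists u; last by exists v.
apply: le_trans (metric_triangle _ x _) _; apply: lerD px _.
exact: mdist_on_edge1 xuv (vertex_on_edgel (R := R) uv).
Qed.

End TreeMetric.

(** * Isometries of proper metric spaces *)

Section IsomTopology.
Context {R : realType} (X : metricType R).
Local Open Scope ring_scope.
Implicit Types (f g : isom X) (x y : X).

Lemma isom_cvgP (F : set_system (isom X)) f : Filter F ->
  F --> f <-> forall K O, compact K -> open O -> f @` K `<=` O ->
    F [set g : isom X | g @` K `<=` O].
Proof.
move=> FF; split=> [Ff K O cK oO fKO|H].
  apply: (Ff [set g : isom X | g @` K `<=` O]).
  apply: (@initial_continuous _ _ (@isom_compact_open R X) f
    [set g : {compact-open, X -> X} | g @` K `<=` O]).
  by apply: open_nbhs_nbhs; split=> //; exact: compact_open_open.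
have : (fun g : isom X => isom_compact_open g) @ F --> isom_compact_open f.
  by apply/compact_open_cvgP => K O cK oO fKO; exact: H.
move=> cf A [_ [[B oB <-] /= Bf BA]]; apply: filterS BA _.
by apply: (cf B); exact: open_nbhs_nbhs.
Qed.

Lemma isom_eval_continuous x : continuous (fun f : isom X => f x).
Proof.
move=> f A /= ; rewrite nbhsE => -[B [oB Bfx] BA].
have [H _] := isom_cvgP f (nbhs_filter f).
have cx : compact [set x] := @compact_set1 _ x.
have fx : f @` [set x] `<=` B by move=> _ [_ -> <-].
by apply: filterS (H cvg_id _ _ cx oB fx) => g gx; apply: BA; apply: gx; exists x.
Qed.

Lemma isom_hausdorff : hausdorff_space (isom X).
Proof.
move=> f g fg; apply: isom_eq => x; apply: (metric_hausdorff (T := X)) => A B nA nB.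
have := fg _ _ (@isom_eval_continuous x f A nA) (@isom_eval_continuous x g B nB).
by move=> [h [Ah Bh]]; exists (h x).
Qed.

(* Isometries are equicontinuous, so pointwise convergence on a compact set is
   uniform. *)
Lemma isom_pointwise_cvg (F : set_system (isom X)) f : Filter F ->
  (forall x (e : R), 0 < e -> F [set g : isom X | mdist (f x) (g x) < e]) -> F --> f.
Proof.
move=> FF H; apply/isom_cvgP => K O cK oO fKO.
have ballO x : K x -> exists2 e : R, 0 < e & forall y, mdist (f x) y < e -> O y.
  move=> Kx; have : nbhs (f x) O.
    by apply: open_nbhs_nbhs; split=> //; apply: fKO; exists x.
  rewrite -nbhs_ballE => -[e /= e0 eO]; exists e => // y fxy; apply: eO.
  by rewrite ballEmdist.
pose rad x : R := xget 1 [set e : R | 0 < e /\ forall y, mdist (f x) y < e -> O y].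
have radP x : K x -> 0 < rad x /\ forall y, mdist (f x) y < rad x -> O y.
  move=> Kx; apply: (@xgetPex _ (1 : R) [set e : R | 0 < e /\ forall y, mdist (f x) y < e -> O y]).
  by have [e e0 eO] := ballO x Kx; exists e.
have [S [fS SK] KS] : exists2 S, finite_set S /\ S `<=` K &
    K `<=` \bigcup_(x in S) ball x (rad x / 2).
  apply: compact_finite_nbhs => // x /radP[r0 _]; apply: nbhsx_ballx.
  exact: divr_gt0.
have : F (\bigcap_(x in S) [set g : isom X | mdist (f x) (g x) < rad x / 2]).
  rewrite -[X in \bigcap_(_ in X) _](fset_setK fS); apply: filter_bigI => x.
  by rewrite in_fset_set// inE => /SK/radP[r0 _]; apply: H; exact: divr_gt0.
apply: filterS => g Hg _ [y Ky <-]; have [x Sx] := KS y Ky.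
rewrite ballEmdist /= => xy; have [_ radO] := radP x (SK _ Sx); apply: radO.
apply: le_lt_trans (metric_triangle _ (g x) _) _; rewrite isom_dist [ltRHS]splitr.
by apply: ltrD => //; exact: Hg.
Qed.

Hypothesis X_proper : forall (p : X) (r : R),
  exists2 K : set X, compact K & [set x | mdist p x <= r] `<=` K.

Lemma ultra_limit (F : set_system (isom X)) (h : isom X -> X) (p : X) (r : R) :
  UltraFilter F -> F [set g | mdist p (h g) <= r] ->
  exists y, forall e : R, 0 < e -> F [set g | mdist y (h g) < e].
Proof.
move=> FU Fr; have [K cK rK] := X_proper p r.
have FhU := ultra_pushforward h FU.
have FhK : F (h @^-1` K) by apply: filterS Fr => g; exact: rK.
have := cK; rewrite compact_ultra => /(_ _ FhU FhK)[y [_ Fy]].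
exists y => e e0; have Fe : F (h @^-1` ball y e) := Fy _ (nbhsx_ballx y e e0).
by apply: filterS Fe => g; rewrite /preimage /= ballEmdist.
Qed.

(** Along an ultrafilter, the images of each point stay in a ball and so converge. Surjectivity does
    not pass to a pointwise limit by itself, so the inverses are given their own limit k. *)
Lemma isom_bounded_compact (p : X) (r : R) :
  compact [set f : isom X | mdist p (f p) <= r].
Proof.
rewrite compact_ultra => F FU FQ.
have /choice[f Hf] (x : X) : exists y, forall e : R, 0 < e ->
    F [set g : isom X | mdist y (g x) < e].
  apply: (@ultra_limit F (fun g => g x) p (r + mdist p x)) => //.
  apply: filterS FQ => g /= gr; apply: le_trans (metric_triangle _ (g p) _) _.
  by rewrite isom_dist lerD2r.
have /choice[k Hk] (y : X) : exists x, forall e : R, 0 < e ->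
    F [set g : isom X | mdist x (isom_preim g y) < e].
  apply: (@ultra_limit F (fun g => isom_preim g y) p (r + mdist p y)) => //.
  apply: filterS FQ => g /= gr; rewrite -(isom_dist g) isom_preimK.
  apply: le_trans (metric_triangle _ p _) _.
  by rewrite lerD2r metric_sym.
have f_dist x y : mdist (f x) (f y) = mdist x y.
  apply/eqP; rewrite eq_le; apply/andP; split; apply/ler_addgt0Pl => e e0;
    have e2 : 0 < e / 2 by exact: divr_gt0.
    have [g [gx gy]] := filter_ex (filterI (Hf x _ e2) (Hf y _ e2)).
    have t1 := metric_triangle (f x) (g x) (f y).
    have t2 := metric_triangle (g x) (g y) (f y).
    by rewrite isom_dist (metric_sym (g y)) in t2; rewrite /= in gx gy; lra.
  have [g [gx gy]] := filter_ex (filterI (Hf x _ e2) (Hf y _ e2)).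
  have t1 := metric_triangle (g x) (f x) (g y).
  have t2 := metric_triangle (f x) (f y) (g y).
  by rewrite isom_dist (metric_sym (g x)) in t1; rewrite /= in gx gy; lra.
have f_surj y : exists x, f x = y.
  exists (k y); apply: mdist_positivity; apply/eqP; rewrite eq_le mdist_ge0 andbT.
  apply/ler_addgt0Pl => e e0; have e2 : 0 < e / 2 by exact: divr_gt0.
  have [g [gx gy]] := filter_ex (filterI (Hf (k y) _ e2) (Hk y _ e2)).
  have t1 := metric_triangle (f (k y)) (g (k y)) y.
  have t2 : mdist (g (k y)) y = mdist (k y) (isom_preim g y).
    by rewrite -(isom_dist g (k y)) isom_preimK.
  by rewrite t2 in t1; rewrite /= in gx gy; lra.
pose F0 := Isom f_dist f_surj; exists F0; split.
  apply/ler_addgt0Pl => e e0.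
  have [g [gx gr]] := filter_ex (filterI (Hf p _ e0) FQ).
  have t1 := metric_triangle p (g p) (f p).
  by rewrite (metric_sym (g p)) in t1; rewrite /= in gx gr *; lra.
by apply: isom_pointwise_cvg => x e e0; exact: Hf.
Qed.

End IsomTopology.

(** * The isometric action induced by an action on vertices *)

Section TreeAction.
Context {R : realType} {G : topologicalGroupType} {T : tree}.
Notation V := (vertex T).
Notation X := (realization R T).
Variable ta : G -> V -> V.
Hypothesis ta1 : forall v, ta 1%g v = v.
Hypothesis taM : forall g h v, ta (g * h)%g v = ta g (ta h v).
Hypothesis ta_edge : forall g u v, edge u v -> edge (ta g u) (ta g v).
Hypothesis neighbour : forall u : V, exists v, edge u v.
Hypothesis Tb : bounded_valence T.
Hypothesis ta_fix : forall v, nbhs (1%g : G) [set g | ta g v = v].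
Hypothesis ta_bounded : forall u v, bounded [set g | ta g u = v].
Hypothesis ta_orbits : exists2 S : set V, finite_set S & forall v, exists g, S (ta g v).
Implicit Types (g h : G) (u v w : V) (x y : X).
Local Open Scope ring_scope.

Lemma taK g v : ta g^-1%g (ta g v) = v.
Proof. by rewrite -taM mulVg ta1. Qed.

Lemma taVK g v : ta g (ta g^-1%g v) = v.
Proof. by rewrite -taM mulgV ta1. Qed.

Lemma ta_eq g v w : (ta g^-1%g w == v) = (w == ta g v).
Proof. by apply/eqP/eqP => [<-|->]; rewrite ?taVK ?taK. Qed.

Lemma ta_on_edge g u v (x : V -> R) : on_edge u v x ->
  on_edge (ta g u) (ta g v) (fun w => x (ta g^-1%g w)).
Proof.
case=> uv xu xv xs xw; split; rewrite ?taK//; first exact: ta_edge.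
by move=> w; rewrite -!ta_eq; exact: xw.
Qed.

Lemma real_act_subproof g x :
  (exists u, on_vertex u (fun w => x (ta g^-1%g w))) \/
  (exists u v, on_edge u v (fun w => x (ta g^-1%g w))).
Proof.
have [u [v xuv]] := on_edge_exists neighbour x.
by right; exists (ta g u), (ta g v); exact: ta_on_edge.
Qed.

Definition real_act g x : X := Realization (real_act_subproof g x).

Lemma real_act1 x : real_act 1%g x = x.
Proof. by apply: realization_eq => w; rewrite /= invg1 ta1. Qed.

Lemma real_actM g h x : real_act (g * h)%g x = real_act g (real_act h x).
Proof. by apply: realization_eq => w; rewrite /= invgM taM. Qed.

Lemma real_act_vertex g v : real_act g (vertex_point R v) = vertex_point R (ta g v).
Proof. by apply: realization_eq => w; rewrite /= ta_eq. Qed.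

Lemma real_act_chain g x y l : chain x y l -> chain (real_act g x) (real_act g y) l.
Proof.
elim=> [{}x|u v {}x z {}y {}l xuv zuv _ IH]; first exact: chain_nil.
have -> : `|x u - z u| = `|real_act g x (ta g u) - real_act g z (ta g u)|.
  by rewrite /= taK.
exact: (@chain_step R T (ta g u) (ta g v) (real_act g x) (real_act g z)
  (real_act g y) l (ta_on_edge g xuv) (ta_on_edge g zuv) IH).
Qed.

Lemma real_act_dist g x y : mdist (real_act g x) (real_act g y) = mdist x y.
Proof.
have H h a b : mdist (real_act h a) (real_act h b) <= mdist a b.
  apply: lb_le_inf; first exact: chain_exists.
  move=> l ab; apply: ge_inf; first exact: chain_lbound.
  exact: real_act_chain.
apply/eqP; rewrite eq_le H /=.
by have := H g^-1%g (real_act g x) (real_act g y); rewrite -!real_actM mulVg !real_act1.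
Qed.

Lemma real_act_surj g y : exists x, real_act g x = y.
Proof. by exists (real_act g^-1%g y); rewrite -real_actM mulgV real_act1. Qed.

Definition tree_isom g : isom X := Isom (real_act_dist g) (real_act_surj g).

Lemma tree_isom_morphism :
  ((tree_isom 1%g = 1%g) * {morph tree_isom : g h / (g * h)%g >-> (g * h)%g})%type.
Proof.
split=> [|g h]; apply: isom_eq => x /=; first exact: real_act1.
exact: real_actM.
Qed.

Definition tree_hom : UMagmaMorphism.type G (isom X) :=
  HB.pack tree_isom (isUMagmaMorphism.Build G (isom X) tree_isom tree_isom_morphism).

Lemma compact_dist_bound (p : X) (K : set X) : compact K ->
  exists m : nat, forall x, K x -> mdist p x <= m%:R.
Proof.
move=> cK; have [S [fS SK] KS] : exists2 S, finite_set S /\ S `<=` K &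
    K `<=` \bigcup_(x in S) ball x (1 : R).
  by apply: compact_finite_nbhs => // x _; exact: nbhsx_ballx.
have [m Hm] := finite_uniform_bound (Q := fun x m => mdist p x + 1 <= m%:R) fS
  (fun x c d cd H => le_trans H (etrans (ler_nat R c d) cd))
  (fun x => real_nat_bound (mdist p x + 1)).
exists m => y Ky; have [x Sx] := KS y Ky; rewrite ballEmdist /= => xy.
apply: le_trans (Hm x Sx); apply: le_trans (metric_triangle _ x _) _.
by rewrite lerD2l ltW.
Qed.

(** K is bounded, and a vertex with nonzero coordinate at a point is within distance 1 of it. *)
Lemma finite_carrier (K : set X) : compact K ->
  finite_set [set w : V | exists2 x : X, K x & x w != 0].
Proof.
move=> cK; have [v0] := tree_inhabited T.
have [m Hm] := compact_dist_bound (vertex_point R v0) cK.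
apply: sub_finite_set (finite_vertices_ball neighbour Tb (vertex_point R v0) (m%:R + 1)).
move=> w [x Kx xw] /=; apply: le_trans (metric_triangle _ x _) _.
apply: lerD; first exact: Hm.
have [u [v xuv]] := on_edge_exists neighbour x.
have uv : edge u v by case: xuv.
have [->|wu] := eqVneq w u; first exact: mdist_on_edge1 xuv (vertex_on_edgel uv).
have [->|wv] := eqVneq w v; first exact: mdist_on_edge1 xuv (vertex_on_edger uv).
by case: xuv => _ _ _ _ x0; rewrite x0// eqxx in xw.
Qed.

Lemma real_act_fix (K : set X) : compact K ->
  nbhs (1%g : G) [set g | forall x, K x -> real_act g x = x].
Proof.
move=> cK; have fC := finite_carrier cK; set C := [set w | _] in fC.
have fC' : finite_set (C : set {classic V}) := fC.
have : nbhs (1%g : G) (\bigcap_(w in (C : set {classic V})) [set g | ta g w = w]).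
  rewrite -[X in \bigcap_(_ in X) _](fset_setK fC'); apply: filter_bigI => w _.
  exact: ta_fix.
apply: filterS => g Hg x Kx; apply: realization_eq => w /=.
have gC v : x v != 0 -> ta g v = v by move=> xv; apply: Hg; exists x.
have [xw|/gC gw] := eqVneq (x w) 0; last by rewrite -{1}gw taK.
have [xw'|/gC] := eqVneq (x (ta g^-1%g w)) 0; first by rewrite xw xw'.
by rewrite taVK => <-.
Qed.

(** An element of the left coset of g by the pointwise stabilizer of K agrees with g on K. *)
Lemma tree_hom_continuous : continuous tree_hom.
Proof.
move=> g; apply/isom_cvgP => K O cK oO gKO /=.
have := nbhs_mull g (real_act_fix cK); rewrite mulg1.
apply: filterS => h Hh _ [x Kx <-]; apply: gKO; exists x => //=.
by rewrite -{1}(Hh x Kx) -real_actM mulVKg.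
Qed.

(** Evaluation at p sends K to a bounded set, so the preimage moves v0 to finitely many vertices and
    is bounded. It is closed because the isometry group is Hausdorff. *)
Lemma tree_hom_proper : proper_map tree_hom.
Proof.
move=> K cK; have [v0] := tree_inhabited T; pose p : X := vertex_point R v0.
have cE : compact [set f p | f in K].
  apply: continuous_compact => //; apply: continuous_subspaceT.
  exact: isom_eval_continuous.
have [m Hm] := compact_dist_bound p cE.
have fF := finite_vertices_ball neighbour Tb p m%:R.
set F := [set v | _] in fF.
have [C cC HC] : bounded (\bigcup_(v in F) [set g | ta g v0 = v]).
  have fF' : finite_set (F : set {classic V}) := fF.
  rewrite -(@bigsetU_fset_set _ {classic V})//.
  elim/big_ind : _ => [|A1 A2|z _].
  - by apply: bounded_finite; exact: finite_set0.
  - exact: bounded_setU.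
  - exact: ta_bounded.
apply: (subclosed_compact _ cC); last first.
  move=> g Kg; apply: HC; exists (ta g v0) => //.
  by rewrite /F /= -real_act_vertex; apply: Hm; exists (tree_hom g).
apply: closed_comp; first by move=> g _; exact: tree_hom_continuous.
by apply: compact_closed => //; exact: isom_hausdorff.
Qed.

Lemma tree_hom_kernel : compact (gker tree_hom).
Proof. by apply: (tree_hom_proper (K := [set 1%g])); exact: compact_set1. Qed.

Lemma tree_hom_cocompact : cocompact_action tree_hom.
Proof.
have [S fS HS] := ta_orbits.
pose K : set X := \bigcup_(u in S) \bigcup_(v in [set v | edge u v]) [set x : X | on_edge u v x].
have cK : compact K.
  apply: compact_bigcup => // u _; apply: compact_bigcup => [|v uv].
    exact: finite_edge.
  exact: closed_edge_compact uv.
rewrite /cocompact_action /cocompact_rel.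
set Q := quotient_topology _; pose pi : X -> Q := fun x => (\pi_Q x)%qT.
have -> : [set: Q] = pi @` K.
  apply/seteqP; split=> // q _.
  have [u [v xuv]] := on_edge_exists neighbour (repr q).
  have [g Sg] := HS u; exists (real_act g (repr q)).
    have uv : edge u v by case: xuv.
    by exists (ta g u) => //; exists (ta g v); [exact: ta_edge|exact: ta_on_edge].
  rewrite -[q in RHS]reprK; apply/(@eqmodP _ (orbit_equiv tree_hom)).
  apply/asboolP; exists (g^-1)%g.
  by rewrite /= -real_actM mulVg real_act1.
apply: continuous_compact => //; apply: continuous_subspaceT; exact: pi_continuous.
Qed.

(** Each isometry f can be multiplied on the right by some k of the image so as to move p by at most
    r: k brings p close to the preimage of p under f, through the finite set S meeting every
    orbit. *)
Lemma tree_hom_image_cocompact : cocompact_subgroup (gimage tree_hom).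
Proof.
have [v0] := tree_inhabited T; pose p : X := vertex_point R v0.
have [S fS HS] := ta_orbits.
have [m Hm] := finite_uniform_bound
  (Q := fun s m => mdist (vertex_point R s) p + 1 <= m%:R) fS
  (fun s c d cd H => le_trans H (etrans (ler_nat R c d) cd))
  (fun s => real_nat_bound (mdist (vertex_point R s) p + 1)).
(* One m for each of the two passages through S; the 1 included in m pays for the distance to the
   nearest vertex. *)
pose r : R := m%:R + m%:R.
have cQ : compact [set f : isom X | mdist p (f p) <= r].
  exact: (isom_bounded_compact (compact_ball neighbour Tb)).
set K := [set f | _] in cQ.
rewrite /cocompact_subgroup /cocompact_rel.
set Q := quotient_topology _; pose pi : isom X -> Q := fun f => (\pi_Q f)%qT.
have -> : [set: Q] = pi @` K.
  apply/seteqP; split=> // q _; set f := repr q.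
  have [v pv] := near_vertex neighbour (isom_preim f p).
  have [g Sg] := HS v; have [h Sh] := HS v0.
  pose k := (g^-1 * h)%g.
  exists (f * tree_hom k)%g.
    rewrite /K /=.
    have -> : mdist p (f (real_act k p)) = mdist (isom_preim f p) (real_act k p).
      by rewrite -(isom_dist f) isom_preimK.
    have t1 := metric_triangle (isom_preim f p) (vertex_point R v) (real_act k p).
    have t2 := metric_triangle (vertex_point R v) (real_act g^-1%g p) (real_act k p).
    have e1 : mdist (vertex_point R v) (real_act g^-1%g p) =
        mdist (vertex_point R (ta g v)) p.
      by rewrite -(real_act_dist g) -real_actM mulgV real_act1 real_act_vertex.
    have e2 : mdist (real_act g^-1%g p) (real_act k p) = mdist p (vertex_point R (ta h v0)).
      by rewrite -(real_act_dist g) -!real_actM mulgV real_act1 mulVKg real_act_vertex.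
    have := Hm _ Sg; have := Hm _ Sh; rewrite -e1 metric_sym -e2 /r.
    move: pv t1 t2; lra.
  rewrite -[q in RHS]reprK; apply/(@eqmodP _ (coset_equiv (gimage tree_hom))).
  apply/asboolP; exists (k^-1)%g; rewrite gmulfV.
  by rewrite invgM mulgVK.
apply: continuous_compact => //; apply: continuous_subspaceT; exact: pi_continuous.
Qed.

End TreeAction.

Lemma branching_neighbour (T : tree) (v : vertex T) : branching_vertex v ->
  forall w : vertex T, exists w', edge w w'.
Proof.
move=> [u [s H]] w; have [su sv _ _ _] := H ord0.
have step (a b : vertex T) : a <> b -> exists w', edge a w'.
  have [[|c p] + lp] := tree_connected a b; first by move: lp => /= ->.
  by move=> /= /andP[ac _] _; exists c.
have [wv|wv] := eqVneq w v; last by apply: (step _ v); apply/eqP.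
by apply: (step _ (u ord0)) => wu; apply: sv; rewrite -wv wu.
Qed.

Lemma lipschitz_continuous (R : realType) (X : metricType R) (h : X -> R) :
  (forall x y, `|h x - h y| <= mdist x y)%R -> continuous h.
Proof.
move=> h1 x; apply/cvg_ballP => e e0.
apply: filterS (nbhsx_ballx x e e0) => y; rewrite ballEmdist -ball_normE /=.
exact: le_lt_trans.
Qed.

(** * Complementary components at a branching vertex *)

Section Bushy.
Context {R : realType} {T : tree}.
Notation V := (vertex T).
Notation X := (realization R T).
Local Open Scope ring_scope.
Hypothesis neighbour : forall u : V, exists v, edge u v.
Hypothesis Tb : bounded_valence T.

Lemma vertex_point_inj : injective (@vertex_point R T).
Proof.
move=> u v /(congr1 (fun x : X => x u))/=; rewrite eqxx.
by case: eqVneq => // _ /eqP; rewrite oner_eq0.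
Qed.

Section Branch.
Variables (v u : V) (s : set V).
Hypotheses (su : s u) (sv : ~ s v).
Hypothesis s_enter : forall a b, edge a b -> s b -> ~ s a -> a = v /\ b = u.

(** Positive on the branch s and zero only at v, so its extension detects that v separates the
    branch from the rest. *)
Definition signed_dist (w : V) : R :=
  if `[< s w >] then (path_dist v w)%:R else - (path_dist v w)%:R.

Lemma signed_dist_in w : s w -> signed_dist w = (path_dist v w)%:R.
Proof. by move=> sw; rewrite /signed_dist asboolT. Qed.

Lemma signed_dist_out w : ~ s w -> signed_dist w = - (path_dist v w)%:R.
Proof. by move=> sw; rewrite /signed_dist asboolF. Qed.

(** The sign changes only along the edge from v to u, where the values are 0 and 1. *)
Lemma signed_dist_lipschitz : lipschitz1 signed_dist.
Proof.
have same (a b : V) : edge a b -> `|(path_dist v a)%:R - (path_dist v b)%:R| <= 1 :> R.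
  exact: (@path_dist_lipschitz R T v).
have cross (a b : V) : edge a b -> s b -> ~ s a -> signed_dist a = 0 /\ signed_dist b = 1.
  move=> ab sb sa; have [av bu] := s_enter ab sb sa; subst a b.
  by rewrite signed_dist_out// signed_dist_in// path_dist0 oppr0 path_dist1.
move=> a b ab; have [sa|sa] := pselect (s a); have [sb|sb] := pselect (s b).
- by rewrite !signed_dist_in//; exact: same.
- have ba : edge b a by rewrite edge_sym.
  by have [-> ->] := cross _ _ ba sa sb; rewrite subr0 normr1.
- by have [-> ->] := cross _ _ ab sb sa; rewrite sub0r normrN normr1.
- by rewrite !signed_dist_out// -opprD normrN; exact: same.
Qed.

Lemma signed_dist_eq0 w : signed_dist w = 0 -> w = v.
Proof.
rewrite /signed_dist => H; apply/esym/path_dist_eq0/eqP.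
by move: H; case: ifP => _ /eqP; rewrite ?oppr_eq0 pnatr_eq0.
Qed.

Definition side_height : X -> R := affine_extension neighbour signed_dist.

Lemma side_height_continuous : continuous side_height.
Proof.
apply: lipschitz_continuous => x y.
exact: affine_extension_lipschitz signed_dist_lipschitz.
Qed.

Lemma side_height_eq0 x : side_height x = 0 -> x = vertex_point R v.
Proof.
have [a [b xab]] := on_edge_exists neighbour x.
rewrite /side_height (affine_extensionE _ _ xab) => H.
have [ab xa xb xs x0] := xab.
have ge0 w : 0 <= (path_dist v w)%:R :> R by exact: ler0n.
have [Ea Eb] : x a * signed_dist a = 0 /\ x b * signed_dist b = 0.
  (* An edge crossing s has v as an endpoint, with value 0. Hence the two terms have the same weak
     sign, and a vanishing sum makes each vanish. *)
  suff : (0 <= x a * signed_dist a /\ 0 <= x b * signed_dist b) \/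
         (x a * signed_dist a <= 0 /\ x b * signed_dist b <= 0) by lra.
  have pos w : s w -> 0 <= x w -> 0 <= x w * signed_dist w.
    by move=> sw xw; rewrite signed_dist_in// mulr_ge0.
  have neg w : ~ s w -> 0 <= x w -> x w * signed_dist w <= 0.
    by move=> sw xw; rewrite signed_dist_out// mulr_ge0_le0// oppr_le0.
  have zero : signed_dist v = 0 by rewrite signed_dist_out// path_dist0 oppr0.
  have [sa|sa] := pselect (s a); have [sb|sb] := pselect (s b).
  - by left; split; exact: pos.
  - have ba : edge b a by rewrite edge_sym.
    have [bv _] := s_enter ba sa sb; left; split; first exact: pos.
    by rewrite bv zero mulr0.
  - have [av _] := s_enter ab sb sa; left; split; last exact: pos.
    by rewrite av zero mulr0.
  - by right; split; exact: neg.
have at_v (c d : V) : on_edge c d x -> c = v -> x d * signed_dist d = 0 ->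
    x = vertex_point R v.
  move=> [cd xc xd xs' x0'] cv /eqP; rewrite mulf_eq0 => /orP[/eqP xd0|/eqP/signed_dist_eq0 dv]; last first.
    by move: cd; rewrite cv dv edge_irr.
  apply: realization_eq => w /=; subst c.
  have [->|wv] := eqVneq w v; first by rewrite -xs' xd0 addr0.
  by have [->|wd] := eqVneq w d; [|exact: x0'].
move: (Ea) => /eqP; rewrite mulf_eq0 => /orP[/eqP xa0|/eqP/signed_dist_eq0 av].
  move: (Eb) => /eqP; rewrite mulf_eq0 => /orP[/eqP xb0|/eqP/signed_dist_eq0 bv].
    by move: xs => /eqP; rewrite xa0 xb0 addr0 eq_sym oner_eq0.
  exact: at_v (on_edgeC xab) bv Ea.
exact: at_v xab av Eb.
Qed.

(** A connected set containing both points has an interval through 0 as its image under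
    [side_height], and only v has height 0. *)
Lemma not_same_component w : ~ s w ->
  ~ connected_component [set~ vertex_point R v] (vertex_point R u) (vertex_point R w).
Proof.
move=> sw Cw; set C := connected_component _ _ in Cw.
have wv : w <> v.
  move=> E; have := @connected_component_sub _ [set~ vertex_point R v] (vertex_point R u) _ Cw.
  by rewrite E; apply.
have uv : u <> v by move=> E; apply: sv; rewrite -E.
have Cu : C (vertex_point R u).
  by apply: connected_component_refl => /vertex_point_inj.
have /connected_intervalP Ci : connected (side_height @` C).
  apply: connected_continuous_connected; first exact: component_connected.
  apply: continuous_subspaceT; exact: side_height_continuous.
have dpos z : z <> v -> (0 : R) < (path_dist v z)%:R.
  move=> zv; rewrite ltr0n lt0n; apply/eqP => /path_dist_eq0/esym; exact: zv.
suff [x Cx /side_height_eq0 xv] : (side_height @` C) 0.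
  have := @connected_component_sub _ [set~ vertex_point R v] (vertex_point R u) _ Cx.
  by rewrite xv; apply.
apply: (Ci (side_height (vertex_point R w)) (side_height (vertex_point R u))).
- by exists (vertex_point R w).
- by exists (vertex_point R u).
rewrite /side_height !affine_extension_vertex signed_dist_out// signed_dist_in//.
by rewrite oppr_le0 !ltW ?dpos.
Qed.

(** Induction on a path from w to v: an edge with both ends in s avoids v, and the edge leaving s
    starts at u. *)
Lemma branch_in_component w : s w ->
  connected_component [set~ vertex_point R v] (vertex_point R u) (vertex_point R w).
Proof.
have [p] := tree_connected w v; elim: p w => [|w' p IH] w /=.
  by move=> _ -> /sv.
move=> /andP[ww' w'p] lp sw.
have [sw'|nsw'] := pselect (s w'); last first.
  have w'w : edge w' w by rewrite edge_sym.
  have [_ ->] := s_enter w'w sw nsw'; apply: connected_component_refl.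
  by move=> /vertex_point_inj E; apply: sv; rewrite -E.
apply: connected_component_trans (IH w' w'p lp sw') _.
apply: (@connected_component_max _ _ [set x : X | on_edge w w' x] _).
- exact: vertex_on_edger.
- move=> x xww' xv; case: xww' => _ _ _ _ /(_ v); rewrite xv /= eqxx.
  have vw : v != w by apply: contra_notN sv => /eqP ->.
  have vw' : v != w' by apply: contra_notN sv => /eqP ->.
  by move=> /(_ vw vw') /eqP; rewrite oner_eq0.
- exact: closed_edge_connected ww'.
- exact: vertex_on_edgel.
Qed.

Lemma branch_component_unbounded : infinite_set s ->
  ~ bounded_subset (connected_component [set~ vertex_point R v] (vertex_point R u)).
Proof.
move=> inf [M HM]; apply: inf.
apply: sub_finite_set (finite_vertices_ball neighbour Tb (vertex_point R u) M) => w sw.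
by apply: HM; exact: branch_in_component.
Qed.

End Branch.

Lemma branching_components (v : V) : branching_vertex v ->
  exists A : 'I_3 -> set X, injective A /\
    forall i, complementary_component (vertex_point R v) (A i) /\
              ~ bounded_subset (A i).
Proof.
move=> [u [s H]].
have uv i : u i <> v by have [su sv _ _ _] := H i => E; apply: sv; rewrite -E.
exists (fun i => connected_component [set~ vertex_point R v] (vertex_point R (u i))).
split=> [i j E|i].
  apply: contrapT => ij; have [su sv _ se sj] := H i.
  apply: (not_same_component su sv se (sj j (fun ji => ij (esym ji)))).
  by rewrite E; apply: connected_component_refl => /vertex_point_inj/uv.
have [su sv si se _] := H i; split; last exact: branch_component_unbounded si.
exists (vertex_point R (u i)) => //.
by apply/eqP => /vertex_point_inj/uv.
Qed.

End Bushy.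

(** Translates of the branching vertex branch as well, and a finite set meeting all orbits keeps
    every vertex within a fixed distance of one of them. *)
Theorem tree_bushy (R : realType) (G : topologicalGroupType) (T : tree)
    (ta : G -> vertex T -> vertex T) :
  (forall v, ta 1%g v = v) -> (forall g h v, ta (g * h)%g v = ta g (ta h v)) ->
  (forall g u v, edge u v -> edge (ta g u) (ta g v)) ->
  bounded_valence T ->
  (exists2 S : set (vertex T), finite_set S & forall v, exists g, S (ta g v)) ->
  (exists v : vertex T, branching_vertex v) -> bushy R T.
Proof.
move=> ta1 taM ta_edge Tb [S fS HS] [v0 [u [s H]]].
have taK g v : ta g^-1%g (ta g v) = v by rewrite -taM mulVg ta1.
have taVK g v : ta g (ta g^-1%g v) = v by rewrite -taM mulgV ta1.
have neighbour := branching_neighbour (ex_intro _ u (ex_intro _ s H)).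
have branching g : branching_vertex (ta g v0).
  exists (fun i => ta g (u i)), (fun i => [set w | s i (ta g^-1%g w)]) => i.
  have [su sv si se sj] := H i; split=> /=; rewrite ?taK//.
  - move=> fin; apply: si; apply: sub_finite_set (finite_image (ta g^-1%g) fin).
    by move=> w sw; exists (ta g w); rewrite /= taK.
  - move=> a b ab sb sa; have [av bu] := se _ _ (ta_edge g^-1%g _ _ ab) sb sa.
    by rewrite -av -bu !taVK.
  - by move=> j ji; rewrite taK; exact: sj.
pose p : realization R T := vertex_point R v0.
have [m Hm] := finite_uniform_bound
  (Q := fun w m => (mdist (vertex_point R w) p <= m%:R)%R) fS
  (fun w c d cd H => le_trans H (etrans (ler_nat R c d) cd))
  (fun w => real_nat_bound (mdist (vertex_point R w) p)).
exists (1 + m%:R)%R => x; have [w xw] := near_vertex neighbour x.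
have [g Sg] := HS w; exists (ta g^-1%g v0); split; last exact: branching_components.
apply: le_trans (metric_triangle _ (vertex_point R w) _) _; apply: lerD xw _.
apply: le_trans (Hm _ Sg).
have <- := real_act_dist ta1 taM ta_edge neighbour g (vertex_point R w)
  (vertex_point R (ta g^-1%g v0)).
by rewrite !real_act_vertex taVK.
Qed.

Theorem theorem9 (R : realType) (n : nat) (n_ge2 : (2 <= n)%N)
    (G : topologicalGroupType) (G_lc : locally_compact [set: G])
    (Gamma : groupClosed G)
    (Gamma_discrete : discrete_subgroup Gamma)
    (Gamma_cocompact : cocompact_subgroup Gamma)
    (Gamma_qi : in_qi_class_free R n (subgroup Gamma)) :
  exists T : tree, [/\ bounded_valence T, bushy R T &
    exists a : UMagmaMorphism.type G (isom (realization R T)),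
      [/\ cocompact_action a, continuous a, proper_map a,
          compact (gker a) & cocompact_subgroup (gimage a)]].
Proof.
have [T [ta [ta1 taM ta_edge Tb [ta_fix ta_bounded ta_orbits Tbr]]]] :=
  lattice_tree_action n_ge2 G_lc Gamma_discrete Gamma_cocompact Gamma_qi.
have neighbour : forall u : vertex T, exists v, edge u v.
  by have [v /branching_neighbour] := Tbr.
exists T; split=> //; first exact: tree_bushy ta1 taM ta_edge Tb ta_orbits Tbr.
exists (tree_hom ta1 taM ta_edge neighbour); split.
- exact: tree_hom_cocompact.
- exact: tree_hom_continuous.
- exact: tree_hom_proper.
- exact: tree_hom_kernel.
- exact: tree_hom_image_cocompact.
Qed.
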